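(* Let $C_0\in \mathrm{Sym}^+(\mathcal H)\cap \mathrm{Tr}(\mathcal H)$ with $\ker(C_0)=\{0\}$ and $\mu_0=\mathcal N(0,C_0)$. The Fisher-Rao metric $g$ on the set $\mathrm{Gauss}(\mathcal H,\mu_0)$ of centered Gaussian measures equivalent to $\mu_0$, parametrized by $S\in \mathrm{SymHS}(\mathcal H)_{<I}$, is given as follows: for each $S\in \mathrm{SymHS}(\mathcal H)_{<I}$, $$g_S(V_1,V_2)=\frac12\mathrm{tr}[(I-S)^{-1}V_1(I-S)^{-1}V_2],\qquad V_1,V_2\in \mathrm{Sym}(\mathcal H)\cap \mathrm{HS}(\mathcal H).$$ The corresponding Riemannian metric on $\mathrm{Tr}(\mathcal H,C_0)$ is given as follows: for $\Sigma\in \mathrm{Tr}(\mathcal H,C_0)$ and $A_1,A_2\in T_\Sigma(\mathrm{Tr}(\mathcal H,C_0))\cong \mathrm{SymHS}(\mathcal H,C_0)=\mathrm{SymHS}(\mathcal H,\Sigma)$, $$\langle A_1,A_2\rangle_\Sigma=\frac12\langle \Sigma^{-1/2}A_1\Sigma^{-1/2},\Sigma^{-1/2}A_2\Sigma^{-1/2}\rangle_{\mathrm{HS}}=\frac12\mathrm{tr}(\Sigma^{-1/2}A_1\Sigma^{-1}A_2\Sigma^{-1/2}).$$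
   Context: $\mathcal H$ is a real separable Hilbert space with $\dim\mathcal H=\infty$. $\mathrm{Sym}(\mathcal H)$, $\mathrm{Sym}^+(\mathcal H)$ are the bounded self-adjoint, resp. self-adjoint positive ($\langle Ax,x\rangle\ge0$) operators; $\mathrm{Tr}(\mathcal H)$, $\mathrm{HS}(\mathcal H)$ are the trace class and Hilbert-Schmidt operators, $\langle A,B\rangle_{\mathrm{HS}}=\mathrm{tr}(A^*B)$. $A>0$ means $A$ self-adjoint with $\langle x,Ax\rangle>0$ for $x\ne0$. $\mathrm{SymHS}(\mathcal H)_{<I}=\{S\in \mathrm{Sym}(\mathcal H)\cap \mathrm{HS}(\mathcal H): I-S>0\}$, an open subset of $\mathrm{Sym}(\mathcal H)\cap \mathrm{HS}(\mathcal H)$, with tangent space $\mathrm{Sym}(\mathcal H)\cap \mathrm{HS}(\mathcal H)$ at each point. By the Feldman-Hajek theorem, $$\mathrm{Gauss}(\mathcal H,\mu_0)=\{\mathcal N(0,C): C=C_0^{1/2}(I-S)C_0^{1/2},\ S\in \mathrm{SymHS}(\mathcal H)_{<I}\}.$$ With $\mu=\mu(S)=\mathcal N(0,C_0^{1/2}(I-S)C_0^{1/2})$, the Fisher-Rao metric at $S$ is defined by $$g_S(V_1,V_2)=\int_{\mathcal H}D\log\left\{\tfrac{d\mu}{d\mu_0}(x)\right\}(S)(V_1)\,D\log\left\{\tfrac{d\mu}{d\mu_0}(x)\right\}(S)(V_2)\,d\mu(x),$$ where $D$ is the Fréchet derivative with respect to the parameter, at $S$, of the map $S'\mapsto\log\frac{d\mu(S')}{d\mu_0}$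 from $\mathrm{SymHS}(\mathcal H)_{<I}$ to $\mathcal L^2(\mathcal H,\mu(S))$. $\mathrm{Tr}(\mathcal H,C_0)=\{C_0^{1/2}(I-S)C_0^{1/2}:S\in \mathrm{SymHS}(\mathcal H)_{<I}\}$ is the corresponding set of covariance operators, with manifold structure given by the bijection $S\mapsto C_0^{1/2}(I-S)C_0^{1/2}$; the corresponding Riemannian metric on it is the one obtained from $g$ via this bijection, i.e. for $\Sigma=C_0^{1/2}(I-S)C_0^{1/2}$ and $A_j=-C_0^{1/2}V_jC_0^{1/2}$, $\langle A_1,A_2\rangle_\Sigma=g_S(V_1,V_2)$. For a positive injective trace class $Q$, $\mathrm{SymHS}(\mathcal H,Q)=\{Q^{1/2}XQ^{1/2}:X\in \mathrm{Sym}(\mathcal H)\cap \mathrm{HS}(\mathcal H)\}$; the tangent space of $\mathrm{Tr}(\mathcal H,C_0)$ at $\Sigma$ is $\mathrm{SymHS}(\mathcal H,C_0)=\mathrm{SymHS}(\mathcal H,\Sigma)$. For $A_j=\Sigma^{1/2}W_j\Sigma^{1/2}$ with $W_j\in \mathrm{Sym}(\mathcal H)\cap \mathrm{HS}(\mathcal H)$, one understands $\Sigma^{-1/2}A_j\Sigma^{-1/2}=W_j$ and $\Sigma^{-1/2}A_1\Sigma^{-1}A_2\Sigma^{-1/2}=W_1W_2$. *)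

(* Defs.v *)
From HB Require Import structures.
From mathcomp Require Import all_boot all_order all_algebra.
From mathcomp Require Import all_classical all_reals all_analysis.

Set Implicit Arguments.
Unset Strict Implicit.
Unset Printing Implicit Defensive.

Import Order.TTheory GRing.Theory Num.Theory.
Import numFieldNormedType.Exports.

Local Open Scope classical_set_scope.
Local Open Scope ring_scope.

(* Positive definiteness of the inner product follows from sqr_normE. *)
HB.mixin Record isHilbert (R : realType) H of CompleteNormedModule R H := {
  hdot : H -> H -> R ;
  hdotC : forall x y, hdot x y = hdot y x ;
  hdot_linear : forall z a x y,
    hdot (a *: x + y) z = a * hdot x z + hdot y z ;
  sqr_normE : forall x, `|x| ^+ 2 = hdot x x
}.

#[short(type=hilbertType)]
HB.structure Definition Hilbert (R : realType) :=
  {H of isHilbert R H & CompleteNormedModule R H}.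

Notation "'<< x , y >>" := (hdot x y)
  (at level 0, x at level 99, y at level 99, format "''<<' x ,  y >>") :
  ring_scope.

Section Space.
Context {R : realType} (H : hilbertType R).

Definition separable := exists2 D : set H, countable D & dense D.

Definition infinite_dimensional := forall (n : nat) (v : 'I_n -> H),
  exists x : H, forall c : 'I_n -> R, x <> \sum_(i < n) c i *: v i.

Definition orthonormal_basis (e : nat -> H) :=
  (forall i j, '<<e i, e j>> = (i == j)%:R) /\
  (forall x, series (fun i => '<<x, e i>> *: e i) @ \oo --> x).

(* A fixed orthonormal basis, used to compute traces and Hilbert-Schmidt norms,
   which do not depend on it. It exists when H is separable and
   infinite-dimensional. *)
Definition basis : nat -> H := xget (fun=> 0) orthonormal_basis.

Definition borel : measurableType _ := g_sigma_algebraType (@open H).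

End Space.

Section Operators.
Context {R : realType} {H : hilbertType R}.
Implicit Types A B C Q S V W X : H -> H.

Definition bounded_op : set (H -> H) := [set A | linear A /\ continuous A].

Definition Sym : set (H -> H) :=
  [set A | bounded_op A /\ forall x y, '<<A x, y>> = '<<x, A y>>].

Definition SymPos : set (H -> H) :=
  [set A | Sym A /\ forall x, 0 <= '<<A x, x>>].

Definition strictly_positive A := Sym A /\ forall x, x != 0 -> 0 < '<<x, A x>>.

(* The operators below are picked by their defining property (they are unique);
   the default value \0 is used when there is no such operator. *)
Definition adjoint A : H -> H :=
  xget \0 [set B | bounded_op B /\ forall x y, '<<A x, y>> = '<<x, B y>>].

Definition sqrt_op A : H -> H := xget \0 [set B | SymPos B /\ B \o B = A].

Definition inv_op A : H -> H :=
  xget \0 [set B | [/\ bounded_op B, A \o B = idfun & B \o A = idfun]].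

Definition abs_op A : H -> H := sqrt_op (adjoint A \o A).

Definition Tr : set (H -> H) := [set A | bounded_op A /\
  (\sum_(0 <= n <oo) ('<<abs_op A (basis H n), basis H n>>)%:E < +oo)%E].

Definition trace A : R :=
  limn (series (fun n => '<<A (basis H n), basis H n>>)).

Definition HS : set (H -> H) := [set A | bounded_op A /\
  (\sum_(0 <= n <oo) (`|A (basis H n)| ^+ 2)%:E < +oo)%E].

Definition hs_dot A B : R := trace (adjoint A \o B).
Definition hs_norm A : R := Num.sqrt (hs_dot A A).

Definition SymHS : set (H -> H) := Sym `&` HS.

Definition SymHS_ltI : set (H -> H) :=
  [set S | SymHS S /\ strictly_positive (idfun \- S)].

Definition sandwich Q X : H -> H := sqrt_op Q \o X \o sqrt_op Q.

Definition SymHS_of Q : set (H -> H) := sandwich Q @` SymHS.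

(* Q^(-1/2) A Q^(-1/2) for A in SymHS_of Q *)
Definition sandwich_inv Q A : H -> H :=
  xget \0 [set X | SymHS X /\ sandwich Q X = A].

Definition cov C0 S : H -> H := sandwich C0 (idfun \- S).

Definition TrC C0 : set (H -> H) := cov C0 @` SymHS_ltI.

End Operators.

Section Measures.
Context {R : realType} {H : hilbertType R}.

(* N(0, v) on the real line; normal_prob takes the standard deviation and is
   not the Dirac measure when that is 0. *)
Definition centered_normal (v : R) (A : set R) : \bar R :=
  if v == 0 then \d_(0 : R) A else normal_prob 0 (Num.sqrt v) A.

Definition is_gaussian (mu : probability (borel H) R) (C : H -> H) :=
  forall (h : H) (A : set R), measurable A ->
    mu [set x : H | A '<<x, h>>] = centered_normal '<<C h, h>> A.

Definition log_density (nu mu : probability (borel H) R) (x : H) : R :=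
  ln (fine (Radon_Nikodym (charge_of_finite_measure nu) mu x)).

Definition L2norm (mu : probability (borel H) R) (f : H -> R) : R :=
  fine ('N[mu]_2%:E [EFin \o f])%E.

(* D is the Frechet derivative at S of F : SymHS_ltI -> L^2(mu), where
   SymHS_ltI is seen as a subset of SymHS with the Hilbert-Schmidt norm.
   Elements of L^2(mu) are represented by functions. *)
Definition is_frechet_derivative (mu : probability (borel H) R)
    (F : (H -> H) -> H -> R) (S : H -> H) (D : (H -> H) -> H -> R) :=
  [/\ forall S', SymHS_ltI S' -> (F S' : borel H -> R) \in Lfun mu 2%:E,
      forall V, SymHS V -> (D V : borel H -> R) \in Lfun mu 2%:E,
      forall (a : R) V W, SymHS V -> SymHS W ->
        {ae mu, forall x, D (a \*: V \+ W) x = a * D V x + D W x},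
      exists M : R, forall V, SymHS V -> L2norm mu (D V) <= M * hs_norm V
    & forall eps : R, 0 < eps -> exists2 delta : R, 0 < delta &
        forall V, SymHS V -> SymHS_ltI (S \+ V) -> hs_norm V < delta ->
          L2norm mu (fun x => F (S \+ V) x - F S x - D V x)
            <= eps * hs_norm V].

(* N C is the centered Gaussian measure with covariance operator C. *)
Variables (N : (H -> H) -> probability (borel H) R) (C0 : H -> H).

Definition log_likelihood (S : H -> H) : H -> R :=
  log_density (N (cov C0 S)) (N C0).

Definition score (S : H -> H) : (H -> H) -> H -> R :=
  xget (fun _ _ => 0) (is_frechet_derivative (N (cov C0 S)) log_likelihood S).

Definition fisher_rao (S V1 V2 : H -> H) : R :=
  (\int[N (cov C0 S)]_x (score S V1 x * score S V2 x))%R.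

(* The metric transported to TrC C0 by the bijection S |-> cov C0 S, whose
   differential is V |-> - sandwich C0 V. *)
Definition chart (Sigma : H -> H) : H -> H :=
  xget \0 [set S | SymHS_ltI S /\ cov C0 S = Sigma].

Definition dchart (A : H -> H) : H -> H :=
  xget \0 [set V | SymHS V /\ A = \- sandwich C0 V].

Definition cov_metric (Sigma A1 A2 : H -> H) : R :=
  fisher_rao (chart Sigma) (dchart A1) (dchart A2).

End Measures.

(* Main.v *)
(* Write T = C0^(1/2), G = I - S and B = G^-1, so that N(0, T G T) is the
   measure attached to S. A finite measure on the Borel sets of H is determined
   by the integrals of the functions cos (<x, h> + c): they span an algebra
   whose bounded pointwise limits contain the indicators of the open sets.

   If B is changed by k (T g) (x) (T g), the Gaussian measure is multiplied by
   exp (- k <x, g>^2 / 2) up to a constant, by the Sherman-Morrison formula and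
   because exp (- k <x, g>^2 / 2) is the mean of cos (xi <x, g>) for a normal
   xi. Finite sums V = sum_i k_i (T g_i) (x) (T g_i) are dense in the symmetric
   Hilbert-Schmidt operators, and Q_V = sum_i k_i (<x, g_i>^2 - |T g_i|^2) has
   mean - <V, I - G> and covariances 2 <V, G W G>, hence extends to all of them
   by an L^2 limit. Approximating B - I in Hilbert-Schmidt norm, the log density
   is - Q_(B - I) / 2 plus a constant; the constants stay under control since a
   log density has nonpositive mean under the reference measure (Jensen).

   The derivative at S is D V = - (Q_(B V B) + <B V B, S>) / 2, because
   B' = B + B V B + B' V B V B, where the last term is O(|V|^2). D V is centered,
   and the integral of D V1 * D V2 is <B V1 B, V2> / 2. In the coordinates of
   Sigma = T G T, the same number is <W1, W2> / 2, because B = K K^* where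
   K Sigma^(1/2) = T, and W_j = - K^* V_j K. *)

Require Import Defs.
From HB Require Import structures.
From mathcomp Require Import all_boot all_order all_algebra.
From mathcomp Require Import all_classical all_reals all_analysis.
From mathcomp Require Import measurable_realfun ring lra.

Set Implicit Arguments.
Unset Strict Implicit.
Unset Printing Implicit Defensive.

Import Order.TTheory GRing.Theory Num.Theory.
Import numFieldNormedType.Exports.

Local Open Scope classical_set_scope.
Local Open Scope ring_scope.

(** * Hilbert spaces and bounded operators *)

(** Some obstacles shape the development. [SymHS_ltI] asks only for pointwise positivity of I - S,
    while inverses and estimates need a uniform lower bound. It holds because S is small on the
    orthogonal of finitely many basis vectors, which are then put back one at a time. The functional
    <x, T^-1 u> is not continuous in x for general u, so quadratic forms are built only on vectors u
    = T g, for which it is <x, g>; this calls for an orthonormal basis inside the range of T. The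
    normalizing constants, regularized determinants in closed form, are never computed: they stay
    existential, and Jensen's inequality is used in both directions. Applied under the measure of S
    and under that of S + V, it encloses the constant of the remainder between two quantities of
    order |V|^2, as differentiability requires. Finally, Q_V must be one function for all the
    measures involved, since log densities of different measures are subtracted; it is therefore the
    limit along approximations chosen once, from V alone. *)

Section hilbert_basics.
Context {R : realType} {H : hilbertType R}.
Implicit Types (x y z : H) (a : R).

Lemma hdotDl x y z : '<<x + y, z>> = '<<x, z>> + '<<y, z>>.
Proof. by rewrite -[x in LHS]scale1r hdot_linear mul1r. Qed.

Lemma hdot0l z : '<<0, z>> = 0 :> R.
Proof. by apply: (addrI '<<0, z>>); rewrite -hdotDl !addr0. Qed.

Lemma hdotZl a x z : '<<a *: x, z>> = a * '<<x, z>>.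
Proof. by rewrite -[a *: x]addr0 hdot_linear hdot0l addr0. Qed.

Lemma hdotNl x z : '<<- x, z>> = - '<<x, z>>.
Proof. by rewrite -scaleN1r hdotZl mulN1r. Qed.

Lemma hdotBl x y z : '<<x - y, z>> = '<<x, z>> - '<<y, z>>.
Proof. by rewrite hdotDl hdotNl. Qed.

Lemma hdotDr x y z : '<<z, x + y>> = '<<z, x>> + '<<z, y>>.
Proof. by rewrite !(hdotC z) hdotDl. Qed.

Lemma hdot0r z : '<<z, 0>> = 0 :> R.
Proof. by rewrite hdotC hdot0l. Qed.

Lemma hdotZr a x z : '<<z, a *: x>> = a * '<<z, x>>.
Proof. by rewrite !(hdotC z) hdotZl. Qed.

Lemma hdotNr x z : '<<z, - x>> = - '<<z, x>>.
Proof. by rewrite !(hdotC z) hdotNl. Qed.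

Lemma hdotBr x y z : '<<z, x - y>> = '<<z, x>> - '<<z, y>>.
Proof. by rewrite !(hdotC z) hdotBl. Qed.

Lemma hdot_suml I (r : seq I) (P : pred I) (F : I -> H) z :
  '<<\sum_(i <- r | P i) F i, z>> = \sum_(i <- r | P i) '<<F i, z>>.
Proof.
elim/big_rec2: _ => [|i y1 y2 _ <-]; first exact: hdot0l.
by rewrite hdotDl.
Qed.

Lemma hdot_sumr I (r : seq I) (P : pred I) (F : I -> H) z :
  '<<z, \sum_(i <- r | P i) F i>> = \sum_(i <- r | P i) '<<z, F i>>.
Proof. by rewrite hdotC hdot_suml; apply: eq_bigr => i _; rewrite hdotC. Qed.

Lemma hdot_ge0 x : 0 <= '<<x, x>>.
Proof. by rewrite -sqr_normE sqr_ge0. Qed.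

Lemma hdot_eq0 x : '<<x, x>> = 0 -> x = 0.
Proof. by rewrite -sqr_normE => /eqP; rewrite sqrf_eq0 normr_eq0 => /eqP. Qed.

Lemma hdot_inj x y : (forall z, '<<x, z>> = '<<y, z>>) -> x = y.
Proof.
move=> xy; apply/eqP; rewrite -subr_eq0; apply/eqP/hdot_eq0.
by rewrite hdotBl xy subrr.
Qed.

(** The discriminant argument shared by the Cauchy-Schwarz inequalities for vectors, for
    Hilbert-Schmidt operators and for square-integrable functions. The second hypothesis itself
    rules out [w < 0], and forces [v = 0] when [w = 0]. *)
Lemma discriminant_le (u v w : R) : 0 <= u ->
  (forall t, 0 <= u + 2 * t * v + t ^+ 2 * w) -> v ^+ 2 <= u * w.
Proof.
move=> u0 h; have [w0|w0|w0] := ltgtP 0 w.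
- have := h (- (v / w)).
  have -> : u + 2 * - (v / w) * v + (- (v / w)) ^+ 2 * w = u - v ^+ 2 / w.
    by field; rewrite gt_eqF.
  by rewrite subr_ge0 ler_pdivrMr.
- exfalso.
  (* A point where the quadratic is negative: [t >= 1] and [t * w = w - (u + 1 + 2 |v|)], so its
     value is at most [w - 1]. *)
  have := h ((u + 1 + `|v| * 2) / - w + 1).
  set t := _ + 1.
  have hv : - `|v| <= v <= `|v| by rewrite -ler_norml lexx.
  have nw : w != 0 by rewrite lt_eqF.
  have tw : t * w = - (u + 1 + `|v| * 2) + w.
    by rewrite /t; field.
  have t1 : 1 <= t.
    by rewrite /t lerDr divr_ge0// ?oppr_ge0 ?(ltW w0)// !addr_ge0// mulr_ge0.
  have -> : u + 2 * t * v + t ^+ 2 * w = u + 2 * t * v + t * (t * w) by ring.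
  rewrite tw.
  have : t * (2 * v - 2 * `|v|) <= 0 by rewrite mulr_ge0_le0 ?subr_le0; lra.
  have : t * (u + 1 - w) >= 1 * (u + 1 - w) by rewrite ler_wpM2r; lra.
  by lra.
- rewrite -w0 mulr0.
  have [->|v0] := eqVneq v 0; first by rewrite expr0n.
  have := h (- (u + 1) / (2 * v)); rewrite -w0 mulr0 addr0.
  have -> : u + 2 * (- (u + 1) / (2 * v)) * v = -1 by field.
  by lra.
Qed.

(** The form <<A x, y>> is only semidefinite. For the identity this is the usual inequality; for
    general [A] it bounds norms and locates kernels of positive operators. *)
Lemma psd_CauchySchwarz (A : H -> H) x y : linear A ->
  (forall x y, '<<A x, y>> = '<<x, A y>>) -> (forall x, 0 <= '<<A x, x>>) ->
  '<<A x, y>> ^+ 2 <= '<<A x, x>> * '<<A y, y>>.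
Proof.
move=> lA sA pA; apply: discriminant_le => // t.
have := pA (t *: y + x); rewrite lA !hdotDl !hdotDr !hdotZl !hdotZr.
rewrite -(hdotC x) -sA; congr (_ <= _); ring.
Qed.

Lemma CauchySchwarz x y : `|'<<x, y>>| <= `|x| * `|y|.
Proof.
rewrite -ler_sqr ?nnegrE ?mulr_ge0// exprMn !sqr_normE real_normK ?num_real//.
by apply: (@psd_CauchySchwarz idfun) => // z; exact: hdot_ge0.
Qed.

Lemma norm_le_hdot x (M : R) : 0 <= M ->
  (forall y, `|'<<x, y>>| <= M * `|y|) -> `|x| <= M.
Proof.
move=> M0 /(_ x); rewrite -sqr_normE ger0_norm ?sqr_ge0// expr2.
have [->|x0] := eqVneq x 0; first by rewrite normr0.
by rewrite ler_pM2r// normr_gt0.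
Qed.

Lemma normDsqr x y : `|x + y| ^+ 2 = `|x| ^+ 2 + 2 * '<<x, y>> + `|y| ^+ 2.
Proof.
by rewrite !sqr_normE hdotDl !hdotDr (hdotC y); ring.
Qed.

Lemma normBsqr x y : `|x - y| ^+ 2 = `|x| ^+ 2 - 2 * '<<x, y>> + `|y| ^+ 2.
Proof. by rewrite normDsqr normrN hdotNr; ring. Qed.

Lemma cvg_hdotl (u : nat -> H) x y : u @ \oo --> x ->
  (fun n => '<<u n, y>>) @ \oo --> ('<<x, y>> : R).
Proof.
move=> ux; apply/cvgrPdist_lt => e e0.
have d0 : 0 < e / (`|y| + 1) by rewrite divr_gt0// ltr_wpDl.
move/cvgrPdist_lt: ux => /(_ _ d0); apply: filterS => n.
rewrite ltr_pdivlMr ?ltr_wpDl// => h.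
rewrite -hdotBl; apply: le_lt_trans (CauchySchwarz _ _) _.
by apply: le_lt_trans h; rewrite ler_wpM2l// lerDl.
Qed.

Lemma cvg_hdotr (u : nat -> H) x y : u @ \oo --> x ->
  (fun n => '<<y, u n>>) @ \oo --> ('<<y, x>> : R).
Proof.
by move=> ux; rewrite (hdotC y); under eq_fun do rewrite hdotC; exact: cvg_hdotl.
Qed.

Lemma continuous_hdot y : continuous (fun x : H => '<<x, y>>).
Proof.
move=> x; apply/cvgrPdist_lt => e e0.
have d0 : 0 < e / (`|y| + 1) by rewrite divr_gt0// ltr_wpDl.
have : (fun z : H => z) @ nbhs x --> x by exact: cvg_id.
move/cvgrPdist_lt => /(_ _ d0); apply: filterS => z.
rewrite ltr_pdivlMr ?ltr_wpDl// => h.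
rewrite -hdotBl; apply: le_lt_trans (CauchySchwarz _ _) _.
by apply: le_lt_trans h; rewrite ler_wpM2l// lerDl.
Qed.

End hilbert_basics.
Arguments cvg_hdotl {R H u x} y.
Arguments cvg_hdotr {R H u x} y.

Section bounded_operators.
Context {R : realType} {H : hilbertType R}.
Implicit Types A B : H -> H.

Definition bnd A (M : R) := forall x, `|A x| <= M * `|x|.

Lemma linearD_ A : linear A -> forall x y, A (x + y) = A x + A y.
Proof. by move=> lA x y; have := lA 1 x y; rewrite !scale1r. Qed.

Lemma linear0_ A : linear A -> A 0 = 0.
Proof. by move=> lA; apply: (addrI (A 0)); rewrite -linearD_// !addr0. Qed.

Lemma linearZ_ A : linear A -> forall a x, A (a *: x) = a *: A x.
Proof. by move=> lA a x; have := lA a x 0; rewrite (linear0_ lA) !addr0. Qed.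

Lemma linearN_ A : linear A -> forall x, A (- x) = - A x.
Proof. by move=> lA x; rewrite -scaleN1r linearZ_// scaleN1r. Qed.

Lemma linearB_ A : linear A -> forall x y, A (x - y) = A x - A y.
Proof. by move=> lA x y; rewrite linearD_// linearN_. Qed.

Lemma linear_sum_ A I (r : seq I) (P : pred I) (F : I -> H) : linear A ->
  A (\sum_(i <- r | P i) F i) = \sum_(i <- r | P i) A (F i).
Proof.
move=> lA; elim/big_rec2: _ => [|i y1 y2 _ <-]; first exact: linear0_.
by rewrite linearD_.
Qed.

Lemma bnd_continuous A M : linear A -> bnd A M -> continuous A.
Proof.
move=> lA bA x; apply/cvgrPdist_lt => e e0.
have M1 : 0 < `|M| + 1 by rewrite ltr_wpDl.
have d0 : 0 < e / (`|M| + 1) by rewrite divr_gt0.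
have : (fun z : H => z) @ nbhs x --> x by exact: cvg_id.
move/cvgrPdist_lt => /(_ _ d0); apply: filterS => z.
rewrite ltr_pdivlMr// => h.
rewrite -linearB_//; apply: le_lt_trans (bA _) _.
rewrite mulrC; apply: le_lt_trans h; rewrite ler_wpM2l//.
by rewrite (le_trans (ler_norm M))// lerDl.
Qed.

Lemma bounded_opP A : bounded_op A <-> linear A /\ exists2 M, 0 <= M & bnd A M.
Proof.
split=> [[lA cA]|[lA [M M0 bA]]]; split => //; last exact: bnd_continuous bA.
have := cA 0; rewrite /continuous_at linear0_// => /cvgrPdist_lt /(_ 1 ltr01).
rewrite near_nbhs => /nbhs_ballP[d /= d0 hd].
(* Rescaled to norm [d / 2], the vector [x] enters the ball on which images have norm below 1. *)
exists (2 / d); first by rewrite divr_ge0// ltW.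
move=> x; have [->|x0] := eqVneq x 0; first by rewrite linear0_// !normr0 mulr0.
have nx : 0 < `|x| by rewrite normr_gt0.
pose t := d / (2 * `|x|).
have t0 : 0 < t by rewrite divr_gt0// mulr_gt0.
have : ball (0 : H) d (t *: x).
  rewrite -ball_normE /= sub0r normrN normrZ gtr0_norm// /t.
  have -> : d / (2 * `|x|) * `|x| = d / 2 by field; rewrite gt_eqF.
  by rewrite ltr_pdivrMr// ltr_pMr// ltr1n.
move=> /hd /=; rewrite sub0r normrN linearZ_// normrZ gtr0_norm//.
rewrite mulrC -ltr_pdivlMr// => /ltW/le_trans; apply.
rewrite /t le_eqVlt; apply/orP; left; apply/eqP.
by field; rewrite !gt_eqF.
Qed.

Lemma bounded_op_linear A : bounded_op A -> linear A.
Proof. by case. Qed.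

Lemma bounded_op_cvg A (u : nat -> H) x : bounded_op A ->
  u @ \oo --> x -> (A \o u) @ \oo --> A x.
Proof. by move=> [_ cA] ux; apply: continuous_cvg => //; exact: cA. Qed.

Lemma bounded_opD A B : bounded_op A -> bounded_op B -> bounded_op (A \+ B).
Proof.
move=> /bounded_opP[lA [M M0 bA]] /bounded_opP[lB [N N0 bB]]; apply/bounded_opP.
split.
  by move=> a x y /=; rewrite lA lB scalerDr addrACA.
exists (M + N); first exact: addr_ge0.
by move=> x /=; rewrite mulrDl (le_trans (ler_normD _ _))// lerD.
Qed.

Lemma bounded_opZ a A : bounded_op A -> bounded_op (a \*: A).
Proof.
move=> /bounded_opP[lA [M M0 bA]]; apply/bounded_opP; split.
  by move=> b x y /=; rewrite lA scalerDr !scalerA mulrC.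
exists (`|a| * M); first exact: mulr_ge0.
by move=> x /=; rewrite normrZ -mulrA ler_wpM2l.
Qed.

Lemma bounded_opN A : bounded_op A -> bounded_op (\- A).
Proof.
move=> /(bounded_opZ (-1)); congr bounded_op.
by apply/funext => x /=; rewrite scaleN1r.
Qed.

Lemma bounded_opB A B : bounded_op A -> bounded_op B -> bounded_op (A \- B).
Proof. by move=> bA /bounded_opN bB; have := bounded_opD bA bB. Qed.

Lemma bounded_op_id : bounded_op (idfun : H -> H).
Proof. by apply/bounded_opP; split=> //; exists 1 => // x; rewrite mul1r. Qed.

Lemma bounded_op0 : bounded_op (\0 : H -> H).
Proof.
apply/bounded_opP; split; first by move=> a x y /=; rewrite scaler0 addr0.
by exists 0 => // x; rewrite mul0r normr0.
Qed.

Lemma bounded_op_comp A B : bounded_op A -> bounded_op B -> bounded_op (A \o B).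
Proof.
move=> /bounded_opP[lA [M M0 bA]] /bounded_opP[lB [N N0 bB]]; apply/bounded_opP.
split; first by move=> a x y /=; rewrite lB lA.
exists (M * N); first exact: mulr_ge0.
by move=> x /=; rewrite (le_trans (bA _))// -mulrA ler_wpM2l.
Qed.

End bounded_operators.

(** * Orthonormal sequences: Bessel, Riesz-Fischer, Parseval *)

Section orthonormal.
Context {R : realType} {H : hilbertType R}.
Implicit Types (x y z : H) (e : nat -> H) (c : nat -> R).

Definition orthonormal e := forall i j, '<<e i, e j>> = (i == j)%:R :> R.

Lemma hdot_onsum e c m n k : orthonormal e ->
  '<<\sum_(m <= i < n) c i *: e i, e k>> = if (m <= k < n)%N then c k else 0.
Proof.
move=> one; transitivity (\sum_(m <= i < n | i == k) c i).
  rewrite hdot_suml [RHS]big_mkcond /=; apply: eq_bigr => i _; rewrite hdotZl one.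
  by case: eqP => [->|]; rewrite ?mulr1 ?mulr0.
by rewrite big_nat1_eq.
Qed.

Lemma sqr_norm_onsum e c m n : orthonormal e ->
  `|\sum_(m <= i < n) c i *: e i| ^+ 2 = \sum_(m <= i < n) c i ^+ 2.
Proof.
move=> one; rewrite sqr_normE [X in '<<_, X>>]big_nat hdot_sumr [RHS]big_nat.
by apply: eq_bigr => i i_n; rewrite hdotZr hdot_onsum// i_n expr2.
Qed.

Lemma bessel e x n : orthonormal e ->
  \sum_(0 <= i < n) '<<x, e i>> ^+ 2 <= `|x| ^+ 2.
Proof.
move=> one; set s := \sum_(0 <= i < n) '<<x, e i>> *: e i.
have h : '<<x, s>> = \sum_(0 <= i < n) '<<x, e i>> ^+ 2.
  by rewrite hdot_sumr; apply: eq_bigr => i _; rewrite hdotZr expr2.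
have : 0 <= `|x - s| ^+ 2 by rewrite sqr_ge0.
rewrite normBsqr h /s sqr_norm_onsum//; lra.
Qed.

Lemma bounded_nonneg_series_cvg (u : nat -> R) (M : R) : (forall n, 0 <= u n) ->
  (forall n, \sum_(0 <= i < n) u i <= M) -> cvgn (series u).
Proof.
move=> u0 uM; apply: nondecreasing_is_cvgn.
  by apply: nondecreasing_series => n _ _; exact: u0.
by exists M => _ [n _ <-]; exact: uM.
Qed.

(** Pythagoras turns the Cauchy criterion for the vector series into the one for the real series of
    squares, which is monotone and bounded. *)
Lemma riesz_fischer e c (M : R) : orthonormal e ->
  (forall n, \sum_(0 <= i < n) c i ^+ 2 <= M) ->
  cvgn (series (fun i => c i *: e i)).
Proof.
move=> one cM; apply/cauchy_cvgP/cauchy_seriesP => eps eps0.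
have : cvgn (series (fun i => c i ^+ 2)).
  by apply: (bounded_nonneg_series_cvg (M := M)) => // n; rewrite sqr_ge0.
move=> /cauchy_cvgP/cauchy_seriesP /(_ (eps ^+ 2)).
rewrite exprn_gt0// => /(_ isT); apply: filterS => -[m n] /=.
rewrite -(sqr_norm_onsum c m n one) ger0_norm ?sqr_ge0//.
by rewrite ltr_sqr ?nnegrE ?(ltW eps0).
Qed.

(** The Fourier series of [x] converges by Bessel, and its sum has the same coefficients as [x];
    totality identifies the two. *)
Lemma total_orthonormal_basis e : orthonormal e ->
  (forall z, (forall i, '<<z, e i>> = 0) -> z = 0) -> orthonormal_basis e.
Proof.
move=> one tot; split => // x.
have /cvg_ex[y sy] := riesz_fischer one (fun n => bessel x n one).
suff xy : x = y by rewrite {2}xy.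
apply/eqP; rewrite -subr_eq0; apply/eqP/tot => k; rewrite hdotBl.
apply/eqP; rewrite subr_eq0; apply/eqP.
have h1 := cvg_hdotl (e k) sy.
apply: (cvg_unique _ _ h1) => //.
apply/cvgrPdist_lt => eps eps0; near=> n.
rewrite /series /= hdot_onsum// ifT ?subrr ?normr0//.
by near: n; exists k.+1.
Unshelve. all: by end_near. Qed.

Lemma basis_on e : orthonormal_basis e -> orthonormal e.
Proof. by case. Qed.

Lemma parseval_dot e x y : orthonormal_basis e ->
  series (fun i => '<<x, e i>> * '<<y, e i>>) @ \oo --> ('<<x, y>> : R).
Proof.
move=> [_ /(_ x) sx]; rewrite (_ : series _ =
  (fun n => '<<series (fun i => '<<x, e i>> *: e i) n, y>>)).
  exact: cvg_hdotl.
apply/funext => n; rewrite /series /= hdot_suml.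
by apply: eq_bigr => i _; rewrite hdotZl (hdotC _ y).
Qed.

Lemma parseval e x : orthonormal_basis e ->
  series (fun i => '<<x, e i>> ^+ 2) @ \oo --> `|x| ^+ 2.
Proof.
by move=> be; rewrite sqr_normE; apply: parseval_dot.
Qed.

Lemma nneseries_cvg (u : nat -> R) (l : R) : (forall n, 0 <= u n) ->
  series u @ \oo --> l -> (\sum_(0 <= n <oo) (u n)%:E = l%:E)%E.
Proof.
move=> u0 ul; apply/cvg_lim => //.
under eq_fun do rewrite sumEFin.
by apply/cvg_EFin; [exact: nearW|exact: ul].
Qed.

Lemma nneseries_fin_cvg (u : nat -> R) : (forall n, 0 <= u n) ->
  (\sum_(0 <= n <oo) (u n)%:E < +oo)%E ->
  series u @ \oo --> fine (\sum_(0 <= n <oo) (u n)%:E).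
Proof.
move=> u0 su.
have c : cvgn (series u).
  apply: (bounded_nonneg_series_cvg (M := fine (\sum_(0 <= n <oo) (u n)%:E)%E)) => //.
  move=> n; rewrite -lee_fin fineK; last first.
    by rewrite ge0_fin_numE// nneseries_ge0// => k _ _; rewrite lee_fin.
  rewrite -sumEFin; apply: nneseries_lim_ge => k _ _; by rewrite lee_fin.
by have /cvg_ex[l ul] := c; rewrite (nneseries_cvg u0 ul).
Qed.

Lemma parseval_ereal e x : orthonormal_basis e ->
  (\sum_(0 <= n <oo) ('<<x, e n>> ^+ 2)%:E = (`|x| ^+ 2)%:E)%E.
Proof.
by move=> be; apply: nneseries_cvg; [move=> n; exact: sqr_ge0|exact: parseval].
Qed.

End orthonormal.
Arguments parseval_dot {R H e} x y.
Arguments parseval {R H e} x.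
Arguments parseval_ereal {R H e} x.

(** * Dense sequences, and Gram-Schmidt inside the range of an operator *)

Section dense_sequences.
Context {R : realType} {H : hilbertType R}.

Lemma separable_seq : separable H ->
  exists d : nat -> H, forall x (eps : R), 0 < eps -> exists n, `|x - d n| < eps.
Proof.
move=> [D cD dD].
have hD (x : H) (eps : R) : 0 < eps -> exists2 y, D y & `|x - y| < eps.
  move=> e0; have [||y [xy Dy]] := dD (ball x eps).
  - by exists x; exact: ballxx.
  - exact: ball_open.
  by exists y => //; move: xy; rewrite -ball_normE.
have [D0|[f]] := pfcard_geP cD.
  by have [y] := hD 0 1 ltr01; rewrite D0.
exists f => x eps /(hD x)[y Dy xy].
by have [n _ fn] := 'surj_f Dy; exists n; rewrite fn.
Qed.

Lemma dense_eq0 (d : nat -> H) (z : H) :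
  (forall x (eps : R), 0 < eps -> exists n, `|x - d n| < eps) ->
  (forall n, '<<z, d n>> = 0 :> R) -> z = 0.
Proof.
move=> dd zd; apply/eqP; rewrite -normr_le0; apply/ler_addgt0Pl => eps eps0.
rewrite addr0.
have [n hn] := dd z eps eps0.
have [z0|z0] := eqVneq z 0; first by rewrite z0 normr0 ltW.
have : `|z| ^+ 2 = '<<z, z - d n>> by rewrite sqr_normE hdotBr zd subr0.
have := CauchySchwarz z (z - d n) => + h.
rewrite -h ger0_norm ?sqr_ge0// expr2 ler_pM2l ?normr_gt0// => /le_trans; apply.
exact: ltW.
Qed.

End dense_sequences.

Section gram_schmidt.
Context {R : realType} {H : hilbertType R}.
Variables (T : H -> H) (d : nat -> H).
Hypothesis bT : bounded_op T.
Hypothesis Tinj : forall x, T x = 0 -> x = 0.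
Hypothesis dd : forall x (eps : R), 0 < eps -> exists n, `|x - d n| < eps.

Let lT : linear T := bounded_op_linear bT.

(** Gram-Schmidt for the inner product <<T x, T y>>, run on the vectors before [T] is applied: the
    orthonormal vectors are the [T h], and the preimages [h] remain available. A vector whose
    residual is annihilated by [T] is dropped. *)
Let res (l : seq H) x := x - \sum_(h <- l) '<<T x, T h>> *: h.
Let step (l : seq H) x :=
  if T (res l x) == 0 then l else rcons l (`|T (res l x)|^-1 *: res l x).
Let L n := foldl step [::] (mkseq d n).

Let LS n : L n.+1 = step (L n) (d n).
Proof. by rewrite /L /mkseq -(addn1 n) iotaD map_cat foldl_cat. Qed.

Let onl (l : seq H) := forall i j, (i < size l)%N -> (j < size l)%N ->
  '<<T (nth 0 l i), T (nth 0 l j)>> = (i == j)%:R :> R.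

Let proj l x : onl l -> forall k, (k < size l)%N ->
  '<<T (\sum_(h <- l) '<<T x, T h>> *: h), T (nth 0 l k)>> =
  '<<T x, T (nth 0 l k)>>.
Proof.
move=> ol k kl; rewrite linear_sum_// hdot_suml (big_nth 0) big_nat.
rewrite (eq_bigr (fun i => if i == k then '<<T x, T (nth 0 l k)>> else 0)).
  by rewrite -big_nat -big_mkcond big_nat1_eq kl.
move=> i /= il; rewrite linearZ_// hdotZl ol//.
by case: eqP => [->|]; rewrite ?mulr1 ?mulr0.
Qed.

Let step_on l x : onl l -> onl (step l x).
Proof.
move=> ol; rewrite /step; case: eqP => // /eqP r0.
set r := T (res l x) in r0 *.
have nr0 : `|r| != 0 by rewrite normr_eq0.
have h1 k : (k < size l)%N -> '<<r, T (nth 0 l k)>> = 0.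
  by move=> kl; rewrite /r /res linearB_// hdotBl proj// subrr.
have Tr : T (`|r|^-1 *: res l x) = `|r|^-1 *: r by rewrite linearZ_.
move=> i j; rewrite size_rcons !ltnS !nth_rcons => il jl.
move: il jl; rewrite leq_eqVlt => /predU1P[->|il];
  rewrite leq_eqVlt => /predU1P[->|jl]; rewrite ?ltnn ?il ?jl ?eqxx.
- by rewrite Tr hdotZl hdotZr -sqr_normE mulrA -expr2 -exprMn mulVf ?expr1n.
- by rewrite Tr hdotZl h1// mulr0 gtn_eqF.
- by rewrite Tr hdotZr hdotC h1// mulr0 ltn_eqF.
- exact: ol.
Qed.

Let L_on n : onl (L n).
Proof. by elim: n => [//|n ih]; rewrite LS; exact: step_on. Qed.

Let L_span n : T (d n) = \sum_(h <- L n.+1) '<<T (d n), T h>> *: T h.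
Proof.
rewrite LS /step; set r := res (L n) (d n).
have dr : d n = r + \sum_(h <- L n) '<<T (d n), T h>> *: h by rewrite /r subrK.
have Td : T (d n) = T r + \sum_(h <- L n) '<<T (d n), T h>> *: T h.
  rewrite {1}dr linearD_// linear_sum_//; congr (_ + _).
  by apply: eq_bigr => h _; rewrite linearZ_.
case: eqP => [r0|/eqP r0]; first by rewrite {1}Td r0 add0r.
rewrite -cats1 big_cat big_seq1 /= {1}Td addrC; congr (_ + _).
rewrite linearZ_// hdotZr.
have -> : '<<T (d n), T r>> = `|T r| ^+ 2.
  rewrite Td hdotDl -sqr_normE hdot_suml big1_seq ?addr0// => h /andP[_ hL].
  rewrite hdotZl -(nth_index 0 hL) (hdotC _ (T r)).
  rewrite /r /res linearB_// hdotBl proj ?subrr ?mulr0// ?index_mem//.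
rewrite scalerA.
have nr0 : `|T r| != 0 by rewrite normr_eq0.
rewrite (_ : _ * _ = 1) ?scale1r//; by field.
Qed.

Let L_prefix n m : (n <= m)%N -> prefix (L n) (L m).
Proof.
elim: m => [|m ih]; first by rewrite leqn0 => /eqP ->; exact: prefix_refl.
rewrite leq_eqVlt => /predU1P[->|]; first exact: prefix_refl.
rewrite ltnS => /ih h; rewrite LS /step; case: ifP => // _.
by apply: prefix_trans h _; exact: prefix_rcons.
Qed.

(** If the lists stopped growing, some [L N] would be final. Injectivity of [T] would put every
    [d n] in its span, and continuity of the residual map would extend this to all of [H]. *)
Let L_unbounded : infinite_dimensional H -> forall k, exists n, (k < size (L n))%N.
Proof.
move=> inf k; apply: contrapT => /forallNP hk.
have sk n : (size (L n) <= k)%N by rewrite leqNgt; exact/negP/hk.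
have [N hN] : exists N, forall n, (size (L n) <= size (L N))%N.
  elim: k {hk} sk => [|k ih] sk.
    by exists 0%N => n; rewrite (leq_trans (sk n)).
  have [h|] := pselect (forall n, (size (L n) <= k)%N).
    exact: ih.
  move=> /existsNP[N /negP]; rewrite -ltnNge => hN.
  by exists N => n; rewrite (leq_trans (sk n)).
have LN n : (N <= n)%N -> L n = L N.
  move=> Nn; have /prefixP[s Ls] := L_prefix Nn.
  have := hN n; rewrite Ls size_cat -[leqRHS]addn0 leq_add2l leqn0 size_eq0.
  by move=> /eqP ->; rewrite cats0.
have dN n : d n = \sum_(h <- L N) '<<T (d n), T h>> *: h.
  apply/eqP; rewrite -subr_eq0; apply/eqP/Tinj; rewrite linearB_//.
  apply/eqP; rewrite subr_eq0; apply/eqP.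
  rewrite {1}L_span linear_sum_//.
  have /prefixP[s Ls] : prefix (L N) (L (maxn N n.+1)).
    by apply: L_prefix; rewrite leq_maxl.
  have /prefixP[s' Ls'] : prefix (L n.+1) (L (maxn N n.+1)).
    by apply: L_prefix; rewrite leq_maxr.
  rewrite LN ?leq_maxl// in Ls Ls'.
  rewrite Ls' big_cat /= [X in _ = _ + X]big1_seq ?addr0.
    by apply: eq_bigr => h _; rewrite linearZ_.
  (* The members of [L N] that come after [L n.+1] are, once [T] is applied, orthogonal to the span
     that contains [T (d n)]. *)
  move=> h /andP[_ hs']; rewrite linearZ_//.
  suff -> : '<<T (d n), T h>> = 0 by rewrite scale0r.
  rewrite L_span hdot_suml big1_seq// => g /andP[_ gL]; rewrite hdotZl.
  have ig : (index g (L n.+1) < size (L n.+1))%N by rewrite index_mem.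
  have ih : (index h s' < size s')%N by rewrite index_mem.
  have := @L_on N (index g (L n.+1)) (size (L n.+1) + index h s')%N.
  have sF : (size (L n.+1) + index h s' < size (L n.+1))%N = false.
    by rewrite ltnNge leq_addr.
  rewrite Ls' size_cat !nth_cat ig ltn_add2l ih sF /= addKn.
  rewrite !nth_index// (leq_trans ig) ?leq_addr// => ->//.
  by rewrite ltn_eqF ?mulr0// (leq_trans ig) ?leq_addr.
have all_x x : x = \sum_(h <- L N) '<<T x, T h>> *: h.
  pose P y := y - \sum_(h <- L N) '<<T y, T h>> *: h.
  have bP : bounded_op P.
    apply: bounded_opB; first exact: bounded_op_id.
    elim: (L N) => [|h l ihl].
      rewrite (_ : (fun _ => _) = \0); first exact: bounded_op0.
      by apply/funext => y; rewrite big_nil.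
    rewrite (_ : (fun _ => _) = (fun y => '<<T y, T h>> *: h) \+
      (fun y => \sum_(h <- l) '<<T y, T h>> *: h)).
      apply: bounded_opD ihl.
      have /bounded_opP[_ [M M0 bM]] := bT.
      apply/bounded_opP; split.
        by move=> a u v; rewrite lT hdotDl hdotZl scalerDl scalerA.
      exists (M * `|T h| * `|h|); first by rewrite !mulr_ge0.
      move=> y; rewrite normrZ mulrAC ler_wpM2r// (le_trans (CauchySchwarz _ _))//.
      by rewrite mulrAC ler_wpM2r.
    by apply/funext => y; rewrite big_cons.
  suff : P x = 0 by move/eqP; rewrite subr_eq0 => /eqP.
  have Pd n : P (d n) = 0 by rewrite /P -dN subrr.
  have /bounded_opP[lP [M M0 bM]] := bP.
  apply/eqP; rewrite -normr_le0; apply/ler_addgt0Pl => eps eps0; rewrite addr0.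
  have [|n hn] := dd x (eps := eps / (M + 1)).
    by rewrite divr_gt0// ltr_wpDl.
  have -> : P x = P (x - d n) by rewrite linearB_// Pd subr0.
  apply: (le_trans (bM _)).
  rewrite ltr_pdivlMr ?ltr_wpDl// in hn.
  by rewrite (le_trans _ (ltW hn))// mulrC ler_wpM2l// lerDl.
have [x hx] := inf (size (L N)) (fun i => nth 0 (L N) i).
apply: (hx (fun i => '<<T x, T (nth 0 (L N) i)>>)).
by rewrite {1}(all_x x) (big_nth 0) big_mkord.
Qed.

(** The vector [h i] is the entry of index [i] in any list that is long enough; later lists extend
    earlier ones, so the choice of the list does not matter. *)
Lemma gram_schmidt_total : infinite_dimensional H -> exists h : nat -> H,
  orthonormal (T \o h) /\
  (forall z, (forall i, '<<z, T (h i)>> = 0) -> forall n, '<<z, T (d n)>> = 0).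
Proof.
move=> inf; have /choice[N hN] := L_unbounded inf.
pose h i := nth 0 (L (N i)) i.
have hE i m : (i < size (L m))%N -> nth 0 (L m) i = h i.
  move=> im; rewrite /h.
  have /orP[/L_prefix/prefixP[s ->]|/L_prefix/prefixP[s ->]] := leq_total m (N i).
    by rewrite nth_cat im.
  by rewrite nth_cat hN.
exists h; split.
  move=> i j /=.
  pose m := maxn (N i) (N j).
  have im : (i < size (L m))%N.
    apply: leq_trans (hN i) _; apply: size_prefix; apply: L_prefix.
    exact: leq_maxl.
  have jm : (j < size (L m))%N.
    apply: leq_trans (hN j) _; apply: size_prefix; apply: L_prefix.
    exact: leq_maxr.
  by rewrite -(hE i m)// -(hE j m)//; exact: L_on.
move=> z hz n; rewrite L_span hdot_sumr big1_seq// => g /andP[_ gL].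
have ig : (index g (L n.+1) < size (L n.+1))%N by rewrite index_mem.
by rewrite hdotZr -(nth_index 0 gL) hE// hz mulr0.
Qed.

End gram_schmidt.

Section bases.
Context {R : realType} {H : hilbertType R}.
Hypotheses (Hsep : separable H) (Hinf : infinite_dimensional H).

(** Symmetry and injectivity make the range of [T] dense: if [z] is orthogonal to all [T (d n)],
    then [T z] is orthogonal to a dense sequence. Gram-Schmidt inside the range thus reaches a basis
    of the whole space. *)
Lemma basis_in_range (T : H -> H) : bounded_op T ->
  (forall x y, '<<T x, y>> = '<<x, T y>>) -> (forall x, T x = 0 -> x = 0) ->
  exists h : nat -> H, orthonormal_basis (T \o h).
Proof.
move=> bT sT Tinj; have [d dd] := separable_seq Hsep.
have [h [oh th]] := gram_schmidt_total bT Tinj dd Hinf.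
exists h; apply: total_orthonormal_basis => // z hz.
apply: Tinj; apply: (dense_eq0 dd) => n; rewrite sT.
exact: th.
Qed.

Lemma basisP : orthonormal_basis (Defs.basis H).
Proof.
apply: xgetPex.
have [//|//|//|h oh] := @basis_in_range idfun.
  exact: bounded_op_id.
by exists h.
Qed.

End bases.

(** * Symmetric operators, square roots and inverses *)

Section limits.
Context {R : realType} {H : hilbertType R}.

Lemma cvg_hdot (u v : nat -> H) (x y : H) : u @ \oo --> x -> v @ \oo --> y ->
  (fun n => '<<u n, v n>>) @ \oo --> ('<<x, y>> : R).
Proof.
move=> ux vy.
have E (a b : H) : '<<a, b>> = 4^-1 * (`|a + b| ^+ 2 - `|a - b| ^+ 2).
  by rewrite normDsqr normBsqr; field.
rewrite E; under eq_fun do rewrite E.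
apply: cvgMr; apply: cvgB.
  rewrite expr2; under eq_fun do rewrite expr2.
  by apply: cvgM; apply: cvg_norm; apply: cvgD.
rewrite expr2; under eq_fun do rewrite expr2.
by apply: cvgM; apply: cvg_norm; apply: cvgB.
Qed.

Lemma cauchy_rate_cvg (V : completeNormedModType R) (u : nat -> V) (a : nat -> R) : a @ \oo --> (0 : R) ->
  (forall m n, (m <= n)%N -> `|u m - u n| <= a m) -> cvgn u.
Proof.
move=> a0 h; apply/cauchy_cvgP/cauchy_ballP => eps eps0; near_simpl.
have e2 : 0 < eps / 2 by rewrite divr_gt0.
have /cvgrPdist_lt /(_ _ e2) [N _ hN] := a0.
near=> p; rewrite -ball_normE /=.
have hp m : (N <= m)%N -> `|u N - u m| < eps / 2.
  move=> Nm; apply: le_lt_trans (h _ _ Nm) _.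
  by have := hN N (leqnn N); rewrite /= sub0r normrN; apply: le_lt_trans; exact: ler_norm.
rewrite (le_lt_trans (ler_distD (u N) _ _))// [ltRHS]splitr ltrD//.
  by rewrite distrC hp//; near: p; near_simpl;
    exists ([set n | N <= n]%N, [set n | N <= n]%N) => /=; [split; exists N|case=> ? ? []].
by rewrite hp//; near: p; near_simpl;
    exists ([set n | N <= n]%N, [set n | N <= n]%N) => /=; [split; exists N|case=> ? ? []].
Unshelve. all: by end_near. Qed.

End limits.

Section adjoints.
Context {R : realType} {H : hilbertType R}.
Implicit Types A B : H -> H.

Lemma adj_bounded A B : bounded_op A ->
  (forall x y, '<<A x, y>> = '<<x, B y>>) -> bounded_op B.
Proof.
move=> /bounded_opP[lA [M M0 bA]] AB; apply/bounded_opP; split.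
  move=> a x y; apply: hdot_inj => z.
  by rewrite hdotDl hdotZl !(hdotC _ z) -!AB hdotDr hdotZr.
exists M => // x; apply: norm_le_hdot => [|y]; first exact: mulr_ge0.
rewrite hdotC -AB (le_trans (CauchySchwarz _ _))//.
by rewrite mulrAC ler_wpM2r.
Qed.

(** Riesz representation through the basis: the adjoint at [y] is the sum of the <<A e_i, y>> e_i. A
    partial sum [s] satisfies |s|^2 = <<A s, y>> <= M |s| |y|, hence |s| <= M |y|, and Riesz-Fischer
    applies. *)
Lemma adjoint_exists (e : nat -> H) A : orthonormal_basis e -> bounded_op A ->
  exists B, bounded_op B /\ forall x y, '<<A x, y>> = '<<x, B y>>.
Proof.
move=> be bdA; have [lA [M M0 bA]] := (bounded_opP A).1 bdA.
have one := basis_on be.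
have h y : cvgn (series (fun i => '<<A (e i), y>> *: e i)).
  apply: (@riesz_fischer _ _ _ _ ((M * `|y|) ^+ 2)) => // n.
  set t := \sum_(_ <= _ < _) _.
  set s := \sum_(0 <= i < n) '<<A (e i), y>> *: e i.
  have ts : t = `|s| ^+ 2 by rewrite sqr_norm_onsum.
  have tA : t = '<<A s, y>>.
    rewrite /s linear_sum_// hdot_suml; apply: eq_bigr => i _.
    by rewrite linearZ_// hdotZl expr2.
  have : t <= M * `|s| * `|y|.
    rewrite tA (le_trans (ler_norm _))// (le_trans (CauchySchwarz _ _))//.
    by rewrite ler_wpM2r.
  rewrite ts ler_sqr ?nnegrE ?mulr_ge0// expr2 mulrAC.
  have [->|s0] := eqVneq s 0; first by rewrite normr0 mulr_ge0.
  by rewrite ler_pM2r// normr_gt0.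
pose B y := limn (series (fun i => '<<A (e i), y>> *: e i)).
have AB x y : '<<A x, y>> = '<<x, B y>>.
  have h1 := cvg_hdotr x (h y).
  apply: (cvg_unique _ _ h1) => //.
  rewrite (_ : (fun n => _) =
     (fun n => '<<A (series (fun i => '<<x, e i>> *: e i) n), y>>)).
    by apply: cvg_hdotl; apply: bounded_op_cvg => //; exact: be.2.
  apply/funext => n; rewrite /series /= linear_sum_// hdot_suml hdot_sumr.
  by apply: eq_bigr => i _; rewrite linearZ_// hdotZl hdotZr mulrC.
by exists B; split => //; exact: adj_bounded AB.
Qed.

Lemma adjoint_unique A B : bounded_op B ->
  (forall x y, '<<A x, y>> = '<<x, B y>>) -> adjoint A = B.
Proof.
move=> bB AB; rewrite /adjoint.
case: xgetP => [C _ [bC AC]|/(_ B)]; last by case.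
apply/funext => y; apply: hdot_inj => z.
by rewrite !(hdotC _ z) -AC AB.
Qed.

Lemma adjointP (e : nat -> H) A : orthonormal_basis e -> bounded_op A ->
  bounded_op (adjoint A) /\ forall x y, '<<A x, y>> = '<<x, adjoint A y>>.
Proof.
by move=> be bA; have [B [bB AB]] := adjoint_exists be bA; rewrite (adjoint_unique bB).
Qed.

Lemma adjoint_sym A : Sym A -> adjoint A = A.
Proof. by case=> bA sA; exact: adjoint_unique. Qed.

End adjoints.

Section symmetric_operators.
Context {R : realType} {H : hilbertType R}.
Implicit Types A B C W : H -> H.

Lemma SymD A B : Sym A -> Sym B -> Sym (A \+ B).
Proof.
move=> [bA sA] [bB sB]; split; first exact: bounded_opD.
by move=> x y /=; rewrite hdotDl hdotDr sA sB.
Qed.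

Lemma SymZ a A : Sym A -> Sym (a \*: A).
Proof.
move=> [bA sA]; split; first exact: bounded_opZ.
by move=> x y /=; rewrite hdotZl hdotZr sA.
Qed.

Lemma SymN A : Sym A -> Sym (\- A).
Proof.
move=> [bA sA]; split; first exact: bounded_opN.
by move=> x y /=; rewrite hdotNl hdotNr sA.
Qed.

Lemma SymB A B : Sym A -> Sym B -> Sym (A \- B).
Proof. by move=> sA /SymN sB; have := SymD sA sB. Qed.

Lemma Sym_id : Sym (idfun : H -> H).
Proof. by split=> //; exact: bounded_op_id. Qed.

Lemma Sym0 : Sym (\0 : H -> H).
Proof. by split=> [|x y /=]; [exact: bounded_op0|rewrite hdot0l hdot0r]. Qed.

Lemma Sym_conj A B : Sym A -> Sym B -> Sym (A \o B \o A).
Proof.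
move=> [bA sA] [bB sB]; split; first by do 2 apply: bounded_op_comp => //.
by move=> x y /=; rewrite sA sB sA.
Qed.

Lemma SymPos_conj A B : Sym A -> SymPos B -> SymPos (A \o B \o A).
Proof.
move=> sA [sB pB]; split; first exact: Sym_conj.
by move=> x /=; rewrite sA.2 pB.
Qed.

(** Cauchy-Schwarz for the form <<W x, y>> at [y = W x]: for a positive operator, a bound on the
    quadratic form bounds the norm. *)
Lemma SymPos_bnd W (q : R) : SymPos W -> 0 <= q ->
  (forall x, '<<W x, x>> <= q * `|x| ^+ 2) -> bnd W q.
Proof.
move=> [[bW sW] pW] q0 Wq x.
have [->|n0] := eqVneq (W x) 0; first by rewrite normr0 mulr_ge0.
have n_gt0 : 0 < `|W x| ^+ 2 by rewrite exprn_gt0// normr_gt0.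
rewrite -ler_sqr ?nnegrE ?mulr_ge0// exprMn -(ler_pM2r n_gt0).
have := psd_CauchySchwarz x (W x) (bounded_op_linear bW) sW pW.
rewrite -sqr_normE -expr2 => /le_trans; apply.
rewrite expr2 mulrACA; rewrite -mulrA mulrACA.
rewrite [leRHS](_ : _ = (q * `|x| ^+ 2) * (q * `|W x| ^+ 2)); last by ring.
by apply: ler_pM.
Qed.

Lemma psd_kernel A x : SymPos A -> '<<A x, x>> = 0 -> A x = 0.
Proof.
move=> [[bA sA] pA] Ax0; apply: hdot_inj => z; rewrite hdot0l.
have := psd_CauchySchwarz x z (bounded_op_linear bA) sA pA.
by rewrite Ax0 mul0r => h; apply/eqP; rewrite -sqrf_eq0 eq_le h sqr_ge0.
Qed.

End symmetric_operators.

(** * Square root of I - W for a positive contraction W *)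

Section square_root_contraction.
Context {R : realType} {H : hilbertType R}.
Variable W : H -> H.
Hypotheses (pW : SymPos W) (W1 : bnd W 1).

Let bW : bounded_op W := pW.1.1.
Let lW : linear W := bounded_op_linear bW.
Let sW x y : '<<W x, y>> = '<<x, W y>> := pW.1.2 x y.

(** The limit [Z] of this iteration solves 2 Z = W + Z^2, that is, (I - Z)^2 = I - W. The scalar
    sequence [y] is the same iteration with 1 in place of [W], and majorizes it. *)
Let Y := fix Y n := if n is m.+1 then 2^-1 \*: (W \+ (Y m \o Y m)) else \0 : H -> H.
Let y := fix y n := if n is m.+1 then 2^-1 * (1 + y m ^+ 2) else 0 : R.

Let YS n : Y n.+1 = 2^-1 \*: (W \+ (Y n \o Y n)). Proof. by []. Qed.

Let yS n : y n.+1 = 2^-1 * (1 + y n ^+ 2). Proof. by []. Qed.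

Let y01 n : 0 <= y n <= 1.
Proof.
elim: n => [|n /andP[y0 y1]]; first by rewrite /= lexx ler01.
rewrite yS; apply/andP; split; first by rewrite mulr_ge0// addr_ge0// sqr_ge0.
have : y n ^+ 2 <= 1 by rewrite expr_le1.
lra.
Qed.

Let y_incr n : y n <= y n.+1.
Proof.
rewrite -subr_ge0 yS (_ : _ - _ = 2^-1 * (1 - y n) ^+ 2); last by field.
by rewrite mulr_ge0// sqr_ge0.
Qed.

Let y_cvg : cvgn y.
Proof.
apply: nondecreasing_is_cvgn; first by apply/nondecreasing_seqP.
by exists 1 => _ [n _ <-]; have /andP[] := y01 n.
Qed.

Let sY n : Sym (Y n).
Proof.
elim: n => [|n ih]; first exact: Sym0.
rewrite YS; apply/SymZ/SymD; first exact: pW.1.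
have [bY sY] := ih; split; first exact: bounded_op_comp.
by move=> u v /=; rewrite !sY.
Qed.

Let lY n : linear (Y n). Proof. by have [[]] := sY n. Qed.

Let commY (C : H -> H) n : linear C -> C \o W = W \o C -> C \o Y n = Y n \o C.
Proof.
move=> lC CW; elim: n => [|n ih].
  by apply/funext => x /=; rewrite linear0_.
have CWx x : C (W x) = W (C x) by have /(congr1 (@^~ x)) := CW.
have CYx x : C (Y n x) = Y n (C x) by have /(congr1 (@^~ x)) := ih.
by apply/funext => x; rewrite YS /= linearZ_// linearD_// CWx !CYx.
Qed.

Let YW n : Y n \o W = W \o Y n.
Proof. by rewrite commY. Qed.

Let YY m n x : Y m (Y n x) = Y n (Y m x).
Proof. by have /(congr1 (@^~ x)) := commY n (lY m) (YW m). Qed.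

Let bY n : bnd (Y n) (y n).
Proof.
elim: n => [|n ih] x; first by rewrite /= mul0r normr0.
have /andP[y0 y1] := y01 n.
rewrite YS yS /= normrZ ger0_norm// -mulrA ler_wpM2l// (le_trans (ler_normD _ _))//.
rewrite mulrDl mul1r lerD//; first by rewrite (le_trans (W1 x))// mul1r.
by rewrite (le_trans (ih _))// expr2 -mulrA ler_wpM2l.
Qed.

(** The iterates commute, so Y_(n+2) - Y_(n+1) = (Y_(n+1) + Y_n) (Y_(n+1) - Y_n) / 2. The scalars
    obey the same identity, so the majorization is inductive and convergence reduces to that of a
    bounded monotone real sequence. *)
Let Ydist n x : `|Y n.+1 x - Y n x| <= (y n.+1 - y n) * `|x|.
Proof.
elim: n x => [|n ih] x.
  by rewrite !subr0 bY.
have -> : Y n.+2 x - Y n.+1 x = 2^-1 *: (Y n.+1 (Y n.+1 x - Y n x) + Y n (Y n.+1 x - Y n x)).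
  have YSx k z : Y k.+1 z = 2^-1 *: (W z + Y k (Y k z)) by [].
  rewrite (YSx n.+1 x) [X in _ - X](YSx n x) -scalerBr; congr (_ *: _).
  rewrite (linearB_ (lY n.+1)) (linearB_ (lY n)) (YY n n.+1) addrA subrK opprD addrACA subrr add0r//.
have /andP[y0 y1] := y01 n; have /andP[y0' y1'] := y01 n.+1.
rewrite normrZ ger0_norm//.
have h1 := bY n.+1 (Y n.+1 x - Y n x).
have h2 := bY n (Y n.+1 x - Y n x).
apply: (@le_trans _ _ (2^-1 * ((y n.+1 + y n) * ((y n.+1 - y n) * `|x|)))).
  rewrite ler_wpM2l// (le_trans (ler_normD _ _))//.
  apply: (@le_trans _ _ ((y n.+1 + y n) * `|Y n.+1 x - Y n x|)).
    by rewrite mulrDl lerD.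
  by rewrite ler_wpM2l// addr_ge0.
rewrite (yS n.+1) [y n.+1 in leRHS]yS.
rewrite le_eqVlt; apply/orP; left; apply/eqP.
by rewrite (yS n); field.
Qed.

Let Ydist2 m n x : (m <= n)%N -> `|Y m x - Y n x| <= (limn y - y m) * `|x|.
Proof.
move=> mn; apply: (@le_trans _ _ ((y n - y m) * `|x|)); last first.
  rewrite ler_wpM2r// lerD2r; apply: nondecreasing_cvgn_le => //.
  exact/nondecreasing_seqP.
elim: n mn => [|n ih].
  by rewrite leqn0 => /eqP ->; rewrite !subrr normr0 mul0r.
rewrite leq_eqVlt => /predU1P[->|/ih{}ih]; first by rewrite !subrr normr0 mul0r.
rewrite (le_trans (ler_distD (Y n x) _ _))//.
have -> : (y n.+1 - y m) * `|x| = (y n - y m) * `|x| + (y n.+1 - y n) * `|x| by ring.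
by rewrite lerD// distrC Ydist.
Qed.

Let Ycvg x : cvgn (Y ^~ x).
Proof.
apply: (@cauchy_rate_cvg _ _ _ (fun n => (limn y - y n) * `|x|)).
  rewrite -[X in _ --> X](mul0r `|x|) -(subrr (limn y)); apply: cvgMl.
  by apply: cvgB => //; exact: cvg_cst.
by move=> m n mn; exact: Ydist2.
Qed.

Let Z x := limn (Y ^~ x).

Let YZ x : Y ^~ x @ \oo --> Z x. Proof. exact: Ycvg. Qed.

Let lZ : linear Z.
Proof.
move=> a u v; apply/cvg_lim => //.
under eq_fun do rewrite lY.
by apply: cvgD => //; apply: cvgZr.
Qed.

Let bZ : bnd Z 1.
Proof.
move=> x; rewrite mul1r.
have h : (fun n => `|Y n x|) @ \oo --> `|Z x| by apply: cvg_norm.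
rewrite -(cvg_lim _ h)//; apply: limr_le; first by apply/cvg_ex; exists `|Z x|.
apply: nearW => n; rewrite (le_trans (bY n x))// ler_piMl//.
by have /andP[] := y01 n.
Qed.

Let symZ : Sym Z.
Proof.
split; first by apply/bounded_opP; split => //; exists 1.
move=> u v; have h1 := cvg_hdotl v (@YZ u); have h2 := cvg_hdotr u (@YZ v).
apply: (cvg_unique _ h1) => //; apply: cvg_trans h2; apply: near_eq_cvg.
by apply: nearW => n; rewrite (sY n).2.
Qed.

Let Zeq x : Z x = 2^-1 *: (W x + Z (Z x)).
Proof.
have h1 : (fun n => Y n.+1 x) @ \oo --> Z x by have := @YZ x; rewrite -cvg_shiftS.
apply: (cvg_unique _ h1) => //.
rewrite (_ : (fun n => _) = (fun n => 2^-1 *: (W x + Y n (Y n x)))); last first.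
  by apply/funext => n.
apply: cvgZr; apply: cvgD; first exact: cvg_cst.
rewrite (_ : (fun n => _) = (fun n => Y n (Y n x - Z x) + Y n (Z x))); last first.
  by apply/funext => n; rewrite linearB_// subrK.
rewrite -[X in _ --> X]add0r; apply: cvgD => //.
apply: norm_cvg0.
have h : (fun n => `|Y n x - Z x|) @ \oo --> (0 : R).
  rewrite -(@normr0 _ H) -(subrr (Z x)); apply: cvg_norm.
  by apply: cvgB => //; exact: cvg_cst.
apply: (squeeze_cvgr _ (cvg_cst _) h); apply: nearW => n; rewrite normr_ge0 /=.
rewrite (le_trans (bY n _))// ler_piMl//.
by have /andP[] := y01 n.
Qed.

(** The commutation clause passes from the iterates to the limit; it is the key to the uniqueness of
    the square root. *)
Lemma sqrt_contraction : exists X, [/\ SymPos X,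
  X \o X = idfun \- W &
  forall C, bounded_op C -> C \o W = W \o C -> C \o X = X \o C].
Proof.
exists (idfun \- Z); split.
- split; first by apply: SymB; [exact: Sym_id|exact: symZ].
  move=> x /=; rewrite hdotBl -sqr_normE subr_ge0 (le_trans (ler_norm _))//.
  rewrite (le_trans (CauchySchwarz _ _))// expr2 ler_wpM2r//.
  by rewrite (le_trans (bZ x))// mul1r.
- apply/funext => x /=; rewrite linearB_//.
  have : Z x + Z x = W x + Z (Z x).
    by rewrite {1 2}Zeq -scalerDl (_ : _ + _ = 1) ?scale1r//; field.
  move=> h; have -> : Z (Z x) = Z x + Z x - W x by rewrite h addrAC subrr add0r.
  by rewrite [- (Z x - _)]opprB [Z x + Z x - W x - Z x]addrAC addrK addrA subrK.
- move=> C bC CW; have lC := bounded_op_linear bC.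
  apply/funext => x /=; rewrite linearB_//; congr (_ - _).
  have h1 := bounded_op_cvg bC (@YZ x).
  apply: (cvg_unique _ h1) => //.
  apply: cvg_trans (@YZ (C x)); apply: near_eq_cvg; apply: nearW => n /=.
  by have /(congr1 (@^~ x)) := commY n lC CW.
Qed.

End square_root_contraction.

Section square_root.
Context {R : realType} {H : hilbertType R}.
Implicit Types A B C : H -> H.

Lemma sqrt_exists A : SymPos A -> exists X, [/\ SymPos X, X \o X = A &
  forall C, bounded_op C -> C \o A = A \o C -> C \o X = X \o C].
Proof.
move=> pA; have [[bA sA] p0] := pA; have [lA [M0 M0_ge0 bM0]] := (bounded_opP A).1 bA.
(* The bound [M0] may vanish; adding 1 allows division by [M]. *)
pose M := M0 + 1.
have M_gt0 : 0 < M by rewrite ltr_wpDl.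
have bM : bnd A M.
  by move=> x; rewrite (le_trans (bM0 x))// ler_wpM2r// lerDl.
pose W := idfun \- (M^-1 \*: A).
have WE x : '<<W x, x>> = `|x| ^+ 2 - M^-1 * '<<A x, x>>.
  by rewrite /= hdotBl hdotZl -sqr_normE.
have pW : SymPos W.
  split; first by apply: SymB; [exact: Sym_id|exact/SymZ].
  move=> x; rewrite WE subr_ge0 -ler_pdivlMl ?invr_gt0// invrK.
  rewrite (le_trans (ler_norm _))// (le_trans (CauchySchwarz _ _))//.
  by rewrite expr2 mulrA ler_wpM2r.
have W1 : bnd W 1.
  apply: SymPos_bnd => // x; rewrite WE mul1r gerBl.
  by rewrite mulr_ge0// invr_ge0 ltW.
have [X [pX XX cX]] := sqrt_contraction pW W1.
have lX := bounded_op_linear pX.1.1.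
exists (Num.sqrt M \*: X); split.
- split; first exact/SymZ/pX.1.
  by move=> x /=; rewrite hdotZl mulr_ge0 ?sqrtr_ge0// pX.2.
- apply/funext => x /=; rewrite linearZ_// scalerA -expr2 sqr_sqrtr ?ltW//.
  have /(congr1 (@^~ x)) /= -> := XX.
  by rewrite opprB addrCA subrr addr0 scalerA mulfV ?scale1r// gt_eqF.
- move=> C bC CA; have lC := bounded_op_linear bC.
  apply/funext => x /=; rewrite linearZ_//; congr (_ *: _).
  suff CW : C \o W = W \o C by have /(congr1 (@^~ x)) := cX _ bC CW.
  apply/funext => z /=; rewrite linearB_// linearZ_//.
  by have /(congr1 (@^~ z)) /= -> := CA.
Qed.

(** [C] commutes with its square [A], hence with [X]. Then [y = (C - X) x] is annihilated by
    [C + X], and positivity gives [C y = X y = 0], so that |y|^2 = <<x, (C - X) y>> = 0. *)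
Lemma sqrt_unique A X C : SymPos X -> SymPos C -> X \o X = A -> C \o C = A ->
  (forall C, bounded_op C -> C \o A = A \o C -> C \o X = X \o C) -> C = X.
Proof.
move=> pX pC XA CA cX.
have lX := bounded_op_linear pX.1.1; have lC := bounded_op_linear pC.1.1.
have CX : C \o X = X \o C by apply: cX; [exact: pC.1.1|rewrite -CA].
have CXx z : C (X z) = X (C z) by have /(congr1 (@^~ z)) := CX.
have XXx z : X (X z) = C (C z) by have /(congr1 (@^~ z)) : X \o X = C \o C by rewrite XA CA.
apply/funext => x; apply/eqP; rewrite -subr_eq0; apply/eqP.
set y := C x - X x.
have h : C y + X y = 0.
  by rewrite /y (linearB_ lC) (linearB_ lX) CXx XXx addrA subrK subrr.
have h2 : '<<C y, y>> + '<<X y, y>> = 0 by rewrite -hdotDl h hdot0l.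
have hC := pC.2 y; have hX := pX.2 y.
have Cy0 : C y = 0 by apply: psd_kernel => //; lra.
have Xy0 : X y = 0 by apply: psd_kernel => //; lra.
apply: hdot_eq0; rewrite {1}/y hdotBl pC.1.2 pX.1.2 Cy0 Xy0 !hdot0r subrr//.
Qed.

Lemma sqrt_opP A : SymPos A -> SymPos (sqrt_op A) /\ sqrt_op A \o sqrt_op A = A.
Proof.
move=> pA; have [X [pX XX _]] := sqrt_exists pA.
by apply: (@xgetPex _ _ [set B | SymPos B /\ B \o B = A]); exists X.
Qed.

Lemma sqrt_op_eq A B : SymPos A -> SymPos B -> B \o B = A -> sqrt_op A = B.
Proof.
move=> pA pB BB; have [X [pX XX cX]] := sqrt_exists pA.
have [pS SS] := sqrt_opP pA.
by rewrite (sqrt_unique pX pS XX SS cX) (sqrt_unique pX pB XX BB cX).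
Qed.

(** [Tr] is phrased through [abs_op]; for covariance operators this reduces it to the sum of the
    diagonal. *)
Lemma abs_op_pos A : SymPos A -> abs_op A = A.
Proof.
move=> pA; rewrite /abs_op adjoint_sym; last exact: pA.1.
apply: sqrt_op_eq => //; split; last first.
  by move=> x /=; rewrite pA.1.2 hdot_ge0.
split; first by apply: bounded_op_comp; exact: pA.1.1.
by move=> x y /=; rewrite !pA.1.2.
Qed.

End square_root.

(** * Coercive symmetric operators and their inverses *)

Section coercive_operators.
Context {R : realType} {H : hilbertType R}.
Implicit Types A B C : H -> H.

Definition coercive A (c : R) := forall x, c * `|x| ^+ 2 <= '<<A x, x>>.

Lemma coercive_inj A c x : 0 < c -> coercive A c -> A x = 0 -> x = 0.
Proof.
move=> c0 cA Ax; have := cA x; rewrite Ax hdot0l pmulr_rle0// => h.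
apply/eqP; rewrite -normr_eq0 -sqrf_eq0 eq_le h sqr_ge0//.
Qed.

(** Neumann series: [W = I - A / M] is positive with norm at most [q = 1 - c / M < 1], and the sum
    of the W^n (y / M) solves A x = y. The choice [M = M0 + c] keeps [q] nonnegative. *)
Lemma coercive_surj A c : 0 < c -> Sym A -> coercive A c ->
  forall y, exists x, A x = y.
Proof.
move=> c0 sA cA y; have [lA [M0 M0_ge0 bM0]] := (bounded_opP A).1 sA.1.
pose M := M0 + c.
have M_gt0 : 0 < M by rewrite ltr_wpDl.
have bM : bnd A M.
  by move=> x; rewrite (le_trans (bM0 x))// ler_wpM2r// lerDl ltW.
pose W := idfun \- (M^-1 \*: A).
have WE x : '<<W x, x>> = `|x| ^+ 2 - M^-1 * '<<A x, x>>.
  by rewrite /= hdotBl hdotZl -sqr_normE.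
have pW : SymPos W.
  split; first by apply: SymB; [exact: Sym_id|exact/SymZ].
  move=> x; rewrite WE subr_ge0 -ler_pdivlMl ?invr_gt0// invrK.
  rewrite (le_trans (ler_norm _))// (le_trans (CauchySchwarz _ _))//.
  by rewrite expr2 mulrA ler_wpM2r.
pose q := 1 - c / M.
have q0 : 0 <= q by rewrite subr_ge0 ler_pdivrMr// mul1r lerDr.
have q1 : `|q| < 1 by rewrite ger0_norm// ltrBlDr ltrDl divr_gt0.
have Wq : bnd W q.
  apply: SymPos_bnd => // x; rewrite WE /q mulrBl mul1r lerD2l lerN2.
  by rewrite (mulrC c) -mulrA ler_pM2l ?invr_gt0.
have lW := bounded_op_linear pW.1.1.
pose u n := iter n W (M^-1 *: y).
have un n : `|u n| <= `|M^-1 *: y| * q ^+ n.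
  elim: n => [|n ih]; first by rewrite expr0 mulr1.
  by rewrite (le_trans (Wq _))// exprS mulrCA ler_wpM2l.
have cu : cvgn (series u).
  apply: normed_cvg; apply: (@series_le_cvg _ _ (geometric `|M^-1 *: y| q)) => //.
  - by move=> n; exact: normr_ge0.
  - by move=> n; rewrite /geometric /= mulr_ge0// exprn_ge0.
  - exact: is_cvg_geometric_series.
have /cvg_ex[x sx] := cu; exists x.
have h1 := bounded_op_cvg pW.1.1 sx.
have h2 : W x = x - M^-1 *: y.
  apply: (cvg_unique _ h1) => //.
  rewrite (_ : _ \o _ = (fun n => series u n.+1 - M^-1 *: y)).
    apply: cvgB; last exact: cvg_cst.
    by rewrite cvg_shiftS.
  apply/funext => n; rewrite /series /= linear_sum_// [in RHS]big_nat_recl//=.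
  by rewrite addrC addKr.
have : M^-1 *: A x = M^-1 *: y.
  have : W x = x - M^-1 *: A x by [].
  by rewrite h2 => /addrI/oppr_inj.
by move=> /(congr1 (fun z => M *: z)); rewrite !scalerA mulfV ?gt_eqF// !scale1r.
Qed.

Lemma inv_opP A c : 0 < c -> Sym A -> coercive A c ->
  [/\ Sym (inv_op A), forall x, A (inv_op A x) = x, forall x, inv_op A (A x) = x,
      bnd (inv_op A) c^-1 & exists2 c', 0 < c' & coercive (inv_op A) c'].
Proof.
move=> c0 sA cA; have lA := bounded_op_linear sA.1.
have Ainj x y : A x = A y -> x = y.
  move=> Axy; apply/eqP; rewrite -subr_eq0; apply/eqP/(coercive_inj c0 cA).
  by rewrite linearB_// Axy subrr.
have /choice[B AB] := coercive_surj c0 sA cA.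
have BA x : B (A x) = x by apply: Ainj; rewrite AB.
have lB : linear B by move=> a x y; apply: Ainj; rewrite lA !AB.
have bB : bnd B c^-1.
  move=> y; have := cA (B y); rewrite AB => h.
  have [->|n0] := eqVneq (B y) 0; first by rewrite normr0 mulr_ge0// invr_ge0 ltW.
  have : c * `|B y| ^+ 2 <= `|y| * `|B y|.
    by rewrite (le_trans h)// (le_trans (ler_norm _))// CauchySchwarz.
  rewrite expr2 mulrA ler_pM2r ?normr_gt0// => h2.
  by rewrite -ler_pdivrMl ?invr_gt0// invrK.
have bdB : bounded_op B.
  by apply/bounded_opP; split => //; exists c^-1; rewrite ?invr_ge0 ?ltW.
have sB : Sym B by split=> // x y; rewrite -{1}(AB y) -sA.2 AB.
have -> : inv_op A = B.
  rewrite /inv_op; case: xgetP => [C _ [bC AC CA]|/(_ B) h].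
    apply/funext => x; apply: Ainj; rewrite AB.
    by have /(congr1 (@^~ x)) := AC.
  by exfalso; apply: h; split => //; apply/funext => x /=; rewrite ?AB ?BA.
split => //.
have [_ [M0 M0_ge0 bM0]] := (bounded_opP A).1 sA.1.
(* From <<B y, y>> >= c |B y|^2 and |y| = |A (B y)| <= (M0 + 1) |B y|. *)
exists (c / (M0 + 1) ^+ 2); first by rewrite divr_gt0// exprn_gt0// ltr_wpDl.
move=> y; have := cA (B y); rewrite AB (hdotC y) => h; apply: le_trans h.
rewrite mulrAC -mulrA ler_pM2l// mulrC ler_pdivrMl ?exprn_gt0 ?ltr_wpDl//.
rewrite -exprMn ler_sqr ?nnegrE ?mulr_ge0 ?addr_ge0//.
by rewrite -{1}(AB y) (le_trans (bM0 _))// ler_wpM2r// lerDl.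
Qed.

End coercive_operators.

(** * From strict positivity to a uniform lower bound *)

Section strict_positivity.
Context {R : realType} {H : hilbertType R}.
Variables (e : nat -> H) (A : H -> H).
Hypotheses (be : orthonormal_basis e) (pA : strictly_positive A).

Let bA : bounded_op A := pA.1.1.
Let lA : linear A := bounded_op_linear bA.
Let sA x y : '<<A x, y>> = '<<x, A y>> := pA.1.2 x y.
Let F x := '<<A x, x>>.

Let F_ge0 x : 0 <= F x.
Proof.
have [->|x0] := eqVneq x 0; first by rewrite /F hdot0r.
by rewrite /F hdotC ltW// pA.2.
Qed.

Let FD x y : F (x + y) <= 2 * F x + 2 * F y.
Proof.
have := F_ge0 (x - y); rewrite /F linearB_// linearD_// !hdotDl !hdotDr !hdotNl !hdotNr.
by rewrite -(hdotC x) (sA x y) => h; lra.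
Qed.

Let FZ a x : F (a *: x) = a ^+ 2 * F x.
Proof. by rewrite /F linearZ_// hdotZl hdotZr mulrA. Qed.

Let G m x := forall i, (i < m)%N -> '<<x, e i>> = 0.

(** A positive distance, measured by [F], from [e m] to the closed subspace [G m.+1]. Otherwise some
    [g k] in the subspace have [F (e m - g k)] tending to 0. The lower bound on the subspace makes
    them Cauchy, and by strict positivity their limit is [e m], to which it is orthogonal. *)
Let gap m c : 0 < c -> (forall x, G m.+1 x -> c * `|x| ^+ 2 <= F x) ->
  exists2 dl, 0 < dl & forall g, G m.+1 g -> dl <= F (e m - g).
Proof.
move=> c0 hc; apply: contrapT => hn.
have hk k : exists g, G m.+1 g /\ F (e m - g) < k.+1%:R^-1.
  apply: contrapT => /forallNP hg; apply: hn; exists k.+1%:R^-1 => // g Gg.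
  by rewrite leNgt; apply/negP => h; apply: (hg g).
have /choice[g hg] := hk.
have gc : cvgn g.
  (* For k <= l, c |g k - g l|^2 <= F (g k - g l) <= 2 / (k + 1) + 2 / (l + 1) <= 4 / (k + 1). *)
  apply: (@cauchy_rate_cvg _ _ _ (fun k => Num.sqrt (4 / c * k.+1%:R^-1))).
    rewrite -[X in _ --> X]sqrtr0.
    apply: (@continuous_cvg _ _ _ _ _ _ Num.sqrt); first exact: sqrt_continuous.
    rewrite -(mulr0 (4 / c)); apply: cvgMr; exact: cvg_harmonic.
  move=> k l kl.
  rewrite -(ger0_norm (normr_ge0 _)) -sqrtr_sqr ler_wsqrtr//.
  rewrite mulrAC ler_pdivlMr// mulrC.
  have Gd : G m.+1 (g k - g l).
    by move=> i im; rewrite hdotBl (hg k).1// (hg l).1// subrr.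
  apply: le_trans (hc _ Gd) _.
  have -> : g k - g l = - (e m - g k) + (e m - g l).
    by rewrite opprB addrA subrK.
  apply: le_trans (FD _ _) _.
  have -> : F (- (e m - g k)) = F (e m - g k).
    by rewrite -scaleN1r FZ sqrrN expr1n mul1r.
  have h1 := (hg k).2; have h2 := (hg l).2.
  have h3 : l.+1%:R^-1 <= k.+1%:R^-1 :> R.
    by rewrite lef_pV2 ?posrE// ler_nat.
  move: h1 h2 h3; set a := k.+1%:R^-1; set b := l.+1%:R^-1; lra.
have /cvg_ex[g0 gg0] := gc.
have h1 : (fun k => F (e m - g k)) @ \oo --> F (e m - g0).
  apply: cvg_hdot.
    apply: bounded_op_cvg => //.
    by apply: cvgB => //; exact: cvg_cst.
  by apply: cvgB => //; exact: cvg_cst.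
have F0 : F (e m - g0) = 0.
  apply: (cvg_unique _ h1) => //.
  apply: (squeeze_cvgr _ (cvg_cst _) (@cvg_harmonic R)); apply: nearW => k.
  by rewrite F_ge0 /= ltW// (hg k).2.
have : e m - g0 = 0.
  apply/eqP/negPn/negP => n0; have := pA.2 _ n0.
  by rewrite hdotC -/(F _) F0 ltxx.
move/eqP; rewrite subr_eq0 => /eqP eg.
have h2 := cvg_hdotl (e m) gg0.
have : '<<g0, e m>> = 0.
  rewrite -(cvg_lim _ h2)//; apply/cvg_lim => //.
  by rewrite (_ : (fun _ => _) = cst 0); [exact: cvg_cst|apply/funext => k; rewrite (hg k).1].
by rewrite -eg (basis_on be) eqxx => /eqP; rewrite oner_eq0.
Qed.

Let descend m : (exists2 c, 0 < c & forall x, G m.+1 x -> c * `|x| ^+ 2 <= F x) ->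
  exists2 c, 0 < c & forall x, G m x -> c * `|x| ^+ 2 <= F x.
Proof.
move=> [c c0 hc]; have [dl dl0 hdl] := gap c0 hc.
(* Write x = g + t e_m with [g] in [G m.+1]. The gap gives t^2 <= F x / dl, and the bound on the
   subspace gives c |g|^2 <= 2 F x + 2 t^2 F (e m); hence |x|^2 = |g|^2 + t^2 <= K F x. *)
pose K := 2 / c + (2 * F (e m) / c + 1) / dl.
have Fe0 := F_ge0 (e m).
have K0 : 0 < K.
  by rewrite addr_gt0 ?divr_gt0// ltr_wpDl// divr_ge0 ?mulr_ge0// ltW.
exists K^-1; first by rewrite invr_gt0.
move=> x Gx; rewrite ler_pdivrMl//.
pose t := '<<x, e m>>; pose g := x - t *: e m.
have one := basis_on be.
have Gg : G m.+1 g.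
  move=> i; rewrite ltnS leq_eqVlt => /predU1P[->|im].
    by rewrite /g hdotBl hdotZl one eqxx mulr1 subrr.
  by rewrite /g hdotBl hdotZl one Gx// gtn_eqF// mulr0 subrr.
have xg : x = g + t *: e m by rewrite subrK.
have nx : `|x| ^+ 2 = `|g| ^+ 2 + t ^+ 2.
  rewrite xg normDsqr hdotZr Gg// !mulr0 addr0 normrZ exprMn real_normK ?num_real//.
  by rewrite (sqr_normE (e m)) one eqxx mulr1.
have h1 : t ^+ 2 * dl <= F x.
  have [t0|t0] := eqVneq t 0; first by rewrite t0 expr0n mul0r.
  have -> : x = t *: (e m - (- t^-1) *: g).
    by rewrite scaleNr opprK scalerDr scalerA mulfV// scale1r addrC.
  rewrite FZ ler_wpM2l ?sqr_ge0// hdl// => i im.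
  by rewrite hdotZl Gg// mulr0.
have h2 : c * `|g| ^+ 2 <= 2 * F x + 2 * (t ^+ 2 * F (e m)).
  apply: le_trans (hc _ Gg) _.
  apply: le_trans (FD _ _) _.
  by rewrite -scaleNr FZ sqrrN.
have h3 : t ^+ 2 <= F x / dl by rewrite ler_pdivlMr.
have h4 : `|g| ^+ 2 <= (2 * F x + 2 * (t ^+ 2 * F (e m))) / c.
  by rewrite ler_pdivlMr// mulrC.
rewrite nx; apply: le_trans (lerD h4 (lexx _)) _.
have -> : (2 * F x + 2 * (t ^+ 2 * F (e m))) / c + t ^+ 2 =
  2 / c * F x + (2 * F (e m) / c + 1) * t ^+ 2 by field; rewrite gt_eqF.
rewrite /K [leRHS]mulrDl lerD2l -[leRHS]mulrA ler_wpM2l//.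
  by rewrite addr_ge0// divr_ge0 ?mulr_ge0// ltW.
by rewrite mulrC.
Qed.

Lemma strictly_positive_coercive N c : 0 < c ->
  (forall x, (forall i, (i < N)%N -> '<<x, e i>> = 0) -> c * `|x| ^+ 2 <= '<<A x, x>>) ->
  exists2 c, 0 < c & coercive A c.
Proof.
move=> c0 hc; have : exists2 c, 0 < c & forall x, G N x -> c * `|x| ^+ 2 <= F x.
  by exists c.
elim: N {hc} => [[c' c'0 h]|n ih]; last by move=> /descend/ih.
by exists c' => // x; exact: h.
Qed.

End strict_positivity.

Section SymHS_ltI_coercive.
Context {R : realType} {H : hilbertType R}.
Hypotheses (Hsep : separable H) (Hinf : infinite_dimensional H).

(** Beyond some [N] the Hilbert-Schmidt sum of [S] is at most 1/4, so that <<S x, x>> <= |x|^2 / 2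
    on the orthogonal of the first [N] basis vectors. Strict positivity takes care of the finitely
    many remaining directions. *)
Lemma SymHS_ltI_coercive (S : H -> H) : SymHS_ltI S ->
  exists2 c, 0 < c & coercive (idfun \- S) c.
Proof.
move=> [[sS [_ hS]] pS].
have be := basisP Hsep Hinf; set e := Defs.basis H in be hS *.
have cS : cvgn (series (fun n => `|S (e n)| ^+ 2)).
  by apply/cvg_ex; eexists; apply: nneseries_fin_cvg => // n; rewrite sqr_ge0.
have /cauchy_cvgP/cauchy_seriesP /(_ (4^-1) _) [//|[P Q] /= [[N1 _ hN1] [N2 _ hN2]] h] := cS.
pose N := maxn N1 N2.
have tail K : (N <= K)%N -> \sum_(N <= i < K) `|S (e i)| ^+ 2 <= 4^-1.
  move=> NK; have := h (N, K); rewrite /= => hh.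
  rewrite (le_trans (ler_norm _))// ltW// hh//; split.
    by apply: hN1; exact: leq_maxl.
  by apply: hN2 => /=; rewrite (leq_trans _ NK)// leq_maxr.
apply: (@strictly_positive_coercive _ _ e _ be pS N 2^-1) => // x hx.
have sub : '<<S x, x>> <= 2^-1 * `|x| ^+ 2.
  have hp := parseval_dot (S x) x be.
  rewrite -(cvg_lim _ hp)//; apply: limr_le; first by apply/cvg_ex; eexists; exact: hp.
  near=> K; rewrite /series /= (@big_cat_nat _ _ _ N) //=; last by near: K; exists N.
  rewrite big_nat big1 ?add0r; last by move=> i iN; rewrite (hx i)// mulr0.
  (* Each term is at most a s b <= a^2 s^2 + b^2 / 4 with a = |x|, s = |S e_i|, b = |<<x, e_i>>|;
     the two resulting sums contribute at most |x|^2 / 4 each. *)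
  apply: (@le_trans _ _ (\sum_(N <= i < K) (`|S (e i)| ^+ 2 * `|x| ^+ 2 +
      4^-1 * '<<x, e i>> ^+ 2))).
    apply: ler_sum => i _.
    have h1 : `|'<<S x, e i>>| <= `|x| * `|S (e i)|.
      by rewrite sS.2; exact: CauchySchwarz.
    apply: (@le_trans _ _ ((`|x| * `|S (e i)|) * `|'<<x, e i>>|)).
      by rewrite (le_trans (ler_norm _))// normrM ler_wpM2r.
    rewrite -[X in _ <= _ + _ * X](real_normK (num_real _)).
    have : 0 <= (`|x| * `|S (e i)| - 2^-1 * `|'<<x, e i>>|) ^+ 2 by exact: sqr_ge0.
    set a := `|x|; set s := `|S _|; set b := `|_|; nra.
  rewrite big_split /= -mulr_suml -mulr_sumr.
  have h2 : \sum_(N <= i < K) '<<x, e i>> ^+ 2 <= `|x| ^+ 2.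
    apply: le_trans (bessel x K (basis_on be)).
    rewrite [leRHS](@big_cat_nat _ _ _ N) //=; last by near: K; exists N.
    by rewrite lerDr sumr_ge0// => i _; exact: sqr_ge0.
  have h3 : (\sum_(N <= i < K) `|S (e i)| ^+ 2) * `|x| ^+ 2 <= 4^-1 * `|x| ^+ 2.
    by rewrite ler_wpM2r ?sqr_ge0// tail//; near: K; exists N.
  by lra.
rewrite /= hdotBl -sqr_normE; lra.
Unshelve. all: by end_near. Qed.

End SymHS_ltI_coercive.

(** * Hilbert-Schmidt operators *)

Section hilbert_schmidt.
Context {R : realType} {H : hilbertType R}.
Hypotheses (Hsep : separable H) (Hinf : infinite_dimensional H).
Implicit Types (A B C M V : H -> H) (b : nat -> H).

Let be : orthonormal_basis (Defs.basis H) := basisP Hsep Hinf.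

(** Extended-valued and relative to a basis, so that independence of the basis can be proved before
    finiteness is known. *)
Definition hsN b A : \bar R := (\sum_(0 <= n <oo) (`|A (b n)| ^+ 2)%:E)%E.
Definition hs2 A : R := fine (hsN (Defs.basis H) A).
(** The inner product by polarization: invariance under change of basis and under adjoints is
    inherited from [hs2], and [hs_cvg] recovers the series in any basis. *)
Definition hs A B : R := 4^-1 * (hs2 (A \+ B) - hs2 (A \- B)).
Definition hsn A : R := Num.sqrt (hs2 A).

(** Parseval in [b'] for each [A (b i)], then interchange of two nonnegative sums. With two
    unrelated bases in the statement, a second application gives independence of the basis. *)
Lemma hsN_adj b b' A B : orthonormal_basis b -> orthonormal_basis b' ->
  (forall x y, '<<A x, y>> = '<<x, B y>>) -> hsN b A = hsN b' B.
Proof.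
move=> bb bb' AB; rewrite /hsN.
under eq_eseriesr do rewrite -(parseval_ereal _ bb').
rewrite nneseries_interchange; last by move=> i j; rewrite lee_fin sqr_ge0.
apply: eq_eseriesr => j _; rewrite -(parseval_ereal _ bb).
by apply: eq_eseriesr => i _; rewrite AB hdotC.
Qed.

Lemma hsN_basis b b' A : orthonormal_basis b -> orthonormal_basis b' ->
  bounded_op A -> hsN b A = hsN b' A.
Proof.
move=> bb bb' bA; have [bA' AA'] := adjointP bb bA.
by rewrite (hsN_adj bb bb AA'); apply/esym/hsN_adj.
Qed.

Lemma hsN_ge0 b A : (0 <= hsN b A)%E.
Proof. by apply: nneseries_ge0 => n _ _; rewrite lee_fin sqr_ge0. Qed.

Lemma hs2_ge0 A : 0 <= hs2 A.
Proof. by rewrite fine_ge0// hsN_ge0. Qed.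

Lemma hsn_ge0 A : 0 <= hsn A. Proof. exact: sqrtr_ge0. Qed.

Lemma sqr_hsn A : hsn A ^+ 2 = hs2 A.
Proof. by rewrite sqr_sqrtr// hs2_ge0. Qed.

Lemma HS_bounded A : HS A -> bounded_op A. Proof. by case. Qed.

Lemma HS_linear A : HS A -> linear A. Proof. by case=> [[]]. Qed.

Lemma hs2_cvg b A : orthonormal_basis b -> HS A ->
  series (fun n => `|A (b n)| ^+ 2) @ \oo --> hs2 A.
Proof.
move=> bb [bA hA]; rewrite /hs2 (hsN_basis be bb bA).
apply: nneseries_fin_cvg => [n|]; first exact: sqr_ge0.
by rewrite -/(hsN b A) (hsN_basis bb be bA).
Qed.

Lemma HS_of_cvg b A (M : R) : orthonormal_basis b -> bounded_op A ->
  (forall n, \sum_(0 <= i < n) `|A (b i)| ^+ 2 <= M) -> HS A /\ hs2 A <= M.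
Proof.
move=> bb bA AM; have hM : (hsN (Defs.basis H) A <= M%:E)%E.
  rewrite (hsN_basis be bb bA) /hsN; apply: lime_le.
    by apply: is_cvg_nneseries => n _ _; rewrite lee_fin sqr_ge0.
  by apply: nearW => n; rewrite sumEFin lee_fin AM.
split; first by split => //; rewrite (le_lt_trans hM)// ltry.
by rewrite -lee_fin fineK// ge0_fin_numE ?hsN_ge0// (le_lt_trans hM)// ltry.
Qed.

Lemma hs2_partial b A n : orthonormal_basis b -> HS A ->
  \sum_(0 <= i < n) `|A (b i)| ^+ 2 <= hs2 A.
Proof.
move=> bb hA; have h := hs2_cvg bb hA.
rewrite -(cvg_lim _ h)//; apply: (nondecreasing_cvgn_le _ (u_ := series _)).
  by apply: nondecreasing_series => k _ _; exact: sqr_ge0.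
by apply/cvg_ex; eexists; exact: h.
Qed.

Lemma HSZ a A : HS A -> HS (a \*: A) /\ hs2 (a \*: A) <= a ^+ 2 * hs2 A.
Proof.
move=> hA; apply: (HS_of_cvg be); first exact/bounded_opZ/HS_bounded.
move=> n; under eq_bigr do rewrite /= normrZ exprMn real_normK ?num_real//.
by rewrite -mulr_sumr ler_wpM2l ?sqr_ge0// hs2_partial.
Qed.

Lemma HSD A B : HS A -> HS B -> HS (A \+ B).
Proof.
move=> hA hB; have [] // := @HS_of_cvg _ (A \+ B) (2 * hs2 A + 2 * hs2 B) be.
  by apply: bounded_opD; exact: HS_bounded.
move=> n; rewrite /=.
apply: (@le_trans _ _ (\sum_(0 <= i < n) (2 * `|A (Defs.basis H i)| ^+ 2 +
  2 * `|B (Defs.basis H i)| ^+ 2))).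
  apply: ler_sum => i _; set x := A _; set y := B _.
  have := sqr_ge0 `|x - y|; rewrite normBsqr normDsqr; lra.
by rewrite big_split /= -!mulr_sumr lerD// ler_wpM2l// hs2_partial.
Qed.

Lemma HSN A : HS A -> HS (\- A).
Proof.
move=> /(HSZ (-1))[h _]; suff <- : -1 \*: A = \- A by [].
by apply/funext => x /=; rewrite scaleN1r.
Qed.

Lemma HSB A B : HS A -> HS B -> HS (A \- B).
Proof. by move=> hA /HSN hB; have := HSD hA hB. Qed.

Lemma HS0 : HS (\0 : H -> H).
Proof.
by have [] // := @HS_of_cvg _ \0 0 be bounded_op0; move=> n; rewrite big1// => i _; rewrite normr0 expr0n.
Qed.

Lemma hs_cvg b A B : orthonormal_basis b -> HS A -> HS B ->
  series (fun n => '<<A (b n), B (b n)>>) @ \oo --> hs A B.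
Proof.
move=> bb hA hB; have h1 := hs2_cvg bb (HSD hA hB); have h2 := hs2_cvg bb (HSB hA hB).
rewrite (_ : series _ = (fun n => 4^-1 * (series (fun n => `|(A \+ B) (b n)| ^+ 2) n -
  series (fun n => `|(A \- B) (b n)| ^+ 2) n))).
  by apply: cvgMr; exact: cvgB.
apply/funext => n; rewrite /series /= -sumrB mulr_sumr; apply: eq_bigr => i _ /=.
by rewrite normDsqr normBsqr; field.
Qed.

Lemma hs_lim b A B (l : R) : orthonormal_basis b -> HS A -> HS B ->
  series (fun n => '<<A (b n), B (b n)>>) @ \oo --> l -> hs A B = l.
Proof. by move=> bb hA hB h; apply: (cvg_unique _ (hs_cvg bb hA hB) h). Qed.

Lemma hs_eq A B C D : HS A -> HS B -> HS C -> HS D ->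
  (forall x, '<<A x, B x>> = '<<C x, D x>>) -> hs A B = hs C D.
Proof.
move=> hA hB hC hD h; apply: (hs_lim be) => //.
by under eq_fun do rewrite h; exact: hs_cvg.
Qed.

Lemma hsC A B : HS A -> HS B -> hs A B = hs B A.
Proof. by move=> hA hB; apply: hs_eq => // x; rewrite hdotC. Qed.

Lemma hsDl A B C : HS A -> HS B -> HS C -> hs (A \+ B) C = hs A C + hs B C.
Proof.
move=> hA hB hC; apply: (hs_lim be) => //; first exact: HSD.
rewrite (_ : series _ = series (fun n => '<<A (Defs.basis H n), C (Defs.basis H n)>>) \+
  series (fun n => '<<B (Defs.basis H n), C (Defs.basis H n)>>)).
  by apply: cvgD; exact: hs_cvg.
apply/funext => n; rewrite /series /= -big_split; apply: eq_bigr => i _ /=.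
exact: hdotDl.
Qed.

Lemma hsZl a A C : HS A -> HS C -> hs (a \*: A) C = a * hs A C.
Proof.
move=> hA hC; apply: (hs_lim be) => //; first exact: (HSZ a hA).1.
rewrite (_ : series _ = (fun n => a * series (fun n => '<<A (Defs.basis H n), C (Defs.basis H n)>>) n)).
  by apply: cvgMr; exact: hs_cvg.
apply/funext => n; rewrite /series /= mulr_sumr; apply: eq_bigr => i _ /=.
exact: hdotZl.
Qed.

Lemma hsNl A C : HS A -> HS C -> hs (\- A) C = - hs A C.
Proof.
move=> hA hC; have -> : \- A = -1 \*: A.
  by apply/funext => x /=; rewrite scaleN1r.
by rewrite hsZl// mulN1r.
Qed.

Lemma hsBl A B C : HS A -> HS B -> HS C -> hs (A \- B) C = hs A C - hs B C.
Proof. by move=> hA hB hC; rewrite -hsNl// -hsDl//; exact: HSN. Qed.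

Lemma hsDr A B C : HS A -> HS B -> HS C -> hs C (A \+ B) = hs C A + hs C B.
Proof. by move=> hA hB hC; rewrite !(hsC hC)// ?hsDl//; exact: HSD. Qed.

Lemma hsZr a A C : HS A -> HS C -> hs C (a \*: A) = a * hs C A.
Proof. by move=> hA hC; rewrite !(hsC hC)// ?hsZl//; exact: (HSZ a hA).1. Qed.

Lemma hsBr A B C : HS A -> HS B -> HS C -> hs C (A \- B) = hs C A - hs C B.
Proof. by move=> hA hB hC; rewrite !(hsC hC)// ?hsBl//; exact: HSB. Qed.

Lemma hs_self A : HS A -> hs A A = hs2 A.
Proof.
move=> hA; apply: (hs_lim be) => //.
by under eq_fun do rewrite -sqr_normE; exact: hs2_cvg.
Qed.

Lemma hs_CauchySchwarz A B : HS A -> HS B -> `|hs A B| <= hsn A * hsn B.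
Proof.
move=> hA hB; rewrite -ler_sqr ?nnegrE ?mulr_ge0 ?hsn_ge0//.
rewrite exprMn !sqr_hsn real_normK ?num_real//; apply: discriminant_le.
  exact: hs2_ge0.
move=> t; have htB := (HSZ t hB).1.
have := hs2_ge0 (A \+ t \*: B); rewrite -hs_self; last exact: HSD.
rewrite hsDl ?hsDr//; try exact: HSD.
rewrite hsZl ?hsZr// ?hsZl// (hsC hB hA) !hs_self//.
by congr (_ <= _); ring.
Qed.

Lemma hsnD A B : HS A -> HS B -> hsn (A \+ B) <= hsn A + hsn B.
Proof.
move=> hA hB; rewrite -ler_sqr ?nnegrE ?addr_ge0 ?hsn_ge0//.
have hAB := HSD hA hB.
rewrite sqr_hsn -hs_self// hsDl// !hsDr// (hsC hB hA) !hs_self// sqrrD !sqr_hsn.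
have := le_trans (ler_norm _) (hs_CauchySchwarz hA hB).
lra.
Qed.

Lemma hsnZ a A : HS A -> hsn (a \*: A) = `|a| * hsn A.
Proof.
move=> hA; have haA := (HSZ a hA).1.
rewrite /hsn -hs_self// hsZl// hsZr// hs_self// mulrA -expr2.
by rewrite sqrtrM ?sqr_ge0// sqrtr_sqr.
Qed.

Lemma hsnN A : HS A -> hsn (\- A) = hsn A.
Proof.
move=> hA; rewrite -[RHS]mul1r -(normrN1 R) -hsnZ//; congr hsn.
by apply/funext => x /=; rewrite scaleN1r.
Qed.

Lemma hsnB A B : HS A -> HS B -> hsn (A \- B) <= hsn A + hsn B.
Proof. by move=> hA hB; rewrite -(hsnN hB); apply: hsnD => //; exact: HSN. Qed.

Lemma HS_adj A B : HS A -> (forall x y, '<<A x, y>> = '<<x, B y>>) ->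
  HS B /\ hs2 B = hs2 A.
Proof.
move=> hA AB; have h := hsN_adj be be AB; split; last by rewrite /hs2 h.
split; first exact: (adj_bounded (HS_bounded hA) AB).
by have [_] := hA; rewrite -/(hsN _ A) h.
Qed.

Lemma hs_adj A A' B B' : HS A -> HS B ->
  (forall x y, '<<A x, y>> = '<<x, A' y>>) ->
  (forall x y, '<<B x, y>> = '<<x, B' y>>) -> hs A B = hs A' B'.
Proof.
move=> hA hB AA' BB'; rewrite /hs.
have h1 x y : '<<(A \+ B) x, y>> = '<<x, (A' \+ B') y>>.
  by rewrite /= hdotDl hdotDr AA' BB'.
have h2 x y : '<<(A \- B) x, y>> = '<<x, (A' \- B') y>>.
  by rewrite /= hdotBl hdotBr AA' BB'.
by rewrite (HS_adj (HSD hA hB) h1).2 (HS_adj (HSB hA hB) h2).2.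
Qed.

Lemma bnd_adj A B (m : R) : 0 <= m -> bnd A m ->
  (forall x y, '<<A x, y>> = '<<x, B y>>) -> bnd B m.
Proof.
move=> m0 bA AB x; apply: norm_le_hdot => [|y]; first exact: mulr_ge0.
rewrite hdotC -AB (le_trans (CauchySchwarz _ _))//.
by rewrite mulrAC ler_wpM2r.
Qed.

Lemma HS_compl M A (m : R) : 0 <= m -> bounded_op M -> bnd M m -> HS A ->
  HS (M \o A) /\ hsn (M \o A) <= m * hsn A.
Proof.
move=> m0 bM Mm hA.
have [||h1 h2] := @HS_of_cvg _ (M \o A) (m ^+ 2 * hs2 A) be.
- by apply: bounded_op_comp => //; exact: HS_bounded.
- move=> n; apply: (@le_trans _ _ (\sum_(0 <= i < n) m ^+ 2 * `|A (Defs.basis H i)| ^+ 2)).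
    apply: ler_sum => i _ /=; rewrite -exprMn ler_sqr ?nnegrE ?mulr_ge0//.
  by rewrite -mulr_sumr ler_wpM2l ?sqr_ge0// hs2_partial.
split => //; rewrite -ler_sqr ?nnegrE ?mulr_ge0 ?hsn_ge0//.
by rewrite exprMn !sqr_hsn.
Qed.

(** Passing to adjoints turns composition on the right into composition on the left. *)
Lemma HS_compr M A (m : R) : 0 <= m -> bounded_op M -> bnd M m -> HS A ->
  HS (A \o M) /\ hsn (A \o M) <= m * hsn A.
Proof.
move=> m0 bM Mm hA.
have [bM' MM'] := adjointP be bM; have [bA' AA'] := adjointP be (HS_bounded hA).
have [hA' nA'] := HS_adj hA AA'.
have [h1 h2] := HS_compl m0 bM' (bnd_adj m0 Mm MM') hA'.
have adj x y : '<<(adjoint M \o adjoint A) x, y>> = '<<x, (A \o M) y>>.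
  by rewrite /= hdotC -MM' -AA' hdotC.
have [h3 h4] := HS_adj h1 adj.
by split => //; rewrite /hsn h4 -nA'.
Qed.

Lemma hs_movel M M' A B : bounded_op M -> bounded_op M' ->
  (forall x y, '<<M x, y>> = '<<x, M' y>>) -> HS A -> HS B ->
  hs (M \o A) B = hs A (M' \o B).
Proof.
move=> bM bM' MM' hA hB.
have [_ [m m0 Mm]] := (bounded_opP M).1 bM.
have [_ [m' m'0 Mm']] := (bounded_opP M').1 bM'.
apply: hs_eq => //; first exact: (HS_compl m0 bM Mm hA).1.
  exact: (HS_compl m'0 bM' Mm' hB).1.
by move=> x /=.
Qed.

Lemma hs_mover M M' A B : bounded_op M -> bounded_op M' ->
  (forall x y, '<<M x, y>> = '<<x, M' y>>) -> HS A -> HS B ->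
  hs (A \o M) B = hs A (B \o M').
Proof.
move=> bM bM' MM' hA hB.
have [_ [m m0 Mm]] := (bounded_opP M).1 bM.
have [_ [m' m'0 Mm']] := (bounded_opP M').1 bM'.
have [bA1 AA1] := adjointP be (HS_bounded hA).
have [bB1 BB1] := adjointP be (HS_bounded hB).
have hA1 := (HS_adj hA AA1).1; have hB1 := (HS_adj hB BB1).1.
rewrite (@hs_adj _ (M' \o adjoint A) B (adjoint B))//; last 2 first.
- exact: (HS_compr m0 bM Mm hA).1.
- by move=> x y /=; rewrite AA1 MM'.
rewrite (@hs_movel M' M)//; last by move=> x y; rewrite hdotC -MM' hdotC.
apply/esym/hs_adj => //; first exact: (HS_compr m'0 bM' Mm' hB).1.
by move=> x y /=; rewrite BB1 hdotC -MM' hdotC.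
Qed.

Lemma HS_bnd A : HS A -> bnd A (hsn A).
Proof.
move=> hA x; have [bA' AA'] := adjointP be (HS_bounded hA).
have [hA' nA'] := HS_adj hA AA'.
rewrite -ler_sqr ?nnegrE ?mulr_ge0 ?hsn_ge0// exprMn sqr_hsn -nA'.
have h := parseval (A x) be; rewrite -(cvg_lim _ h)//.
apply: limr_le; first by apply/cvg_ex; eexists; exact: h.
apply: nearW => n; rewrite /series /=.
apply: (@le_trans _ _ (\sum_(0 <= i < n) `|adjoint A (Defs.basis H i)| ^+ 2 * `|x| ^+ 2)).
  apply: ler_sum => i _; rewrite AA' -exprMn -(real_normK (num_real _)).
  by rewrite ler_sqr ?nnegrE ?mulr_ge0// mulrC CauchySchwarz.
by rewrite -mulr_suml ler_wpM2r ?sqr_ge0// hs2_partial.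
Qed.

Lemma trace_hs A B : Sym A -> HS A -> HS B -> trace (A \o B) = hs A B.
Proof.
move=> sA hA hB; have h := hs_cvg be hB hA; rewrite hsC//.
rewrite /trace (_ : (fun n => _) =
  (fun n => '<<B (Defs.basis H n), A (Defs.basis H n)>>)); first exact/cvg_lim.
by apply/funext => n /=; rewrite sA.2.
Qed.

Lemma hs_dotE A B : HS A -> HS B -> hs_dot A B = hs A B.
Proof.
move=> hA hB; have h := hs_cvg be hB hA; rewrite hsC//.
have [bA' AA'] := adjointP be (HS_bounded hA).
rewrite /hs_dot /trace (_ : (fun n => _) =
  (fun n => '<<B (Defs.basis H n), A (Defs.basis H n)>>)); first exact/cvg_lim.
by apply/funext => n /=; rewrite hdotC -AA' hdotC.
Qed.

Lemma hs_normE A : HS A -> hs_norm A = hsn A.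
Proof. by move=> hA; rewrite /hs_norm hs_dotE// hs_self. Qed.

End hilbert_schmidt.

(** * Finite-rank operators carried by the range of T, and their density *)

Section finite_rank.
Context {R : realType} {H : hilbertType R}.
Hypotheses (Hsep : separable H) (Hinf : infinite_dimensional H).
Variable (T : H -> H).
Implicit Types (l : seq (R * H)) (A V : H -> H).

Let be : orthonormal_basis (Defs.basis H) := basisP Hsep Hinf.

Definition rank_op l x : H := \sum_(p <- l) (p.1 * '<<x, T p.2>>) *: T p.2.

Lemma rank_op_cat l l' : rank_op (l ++ l') = rank_op l \+ rank_op l'.
Proof. by apply/funext => x; rewrite /rank_op big_cat. Qed.

Lemma rank_op_cons p l x :
  rank_op (p :: l) x = (p.1 * '<<x, T p.2>>) *: T p.2 + rank_op l x.
Proof. by rewrite /rank_op big_cons. Qed.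

Lemma rank_op_nil : rank_op [::] = \0.
Proof. by apply/funext => x; rewrite /rank_op big_nil. Qed.

Lemma rank_op_dot l x y :
  '<<rank_op l x, y>> = \sum_(p <- l) p.1 * '<<x, T p.2>> * '<<T p.2, y>>.
Proof. by rewrite /rank_op hdot_suml; apply: eq_bigr => p _; rewrite hdotZl. Qed.

Let hs_rank1 a v A : HS A ->
  HS (fun x => (a * '<<x, v>>) *: v) /\
  hs (fun x => (a * '<<x, v>>) *: v) A = a * '<<A v, v>>.
Proof.
move=> hA; have h : HS (fun x => (a * '<<x, v>>) *: v).
  have [] // := @HS_of_cvg _ _ Hsep Hinf _ (fun x => (a * '<<x, v>>) *: v)
    (a ^+ 2 * `|v| ^+ 2 * `|v| ^+ 2) be.
    apply/bounded_opP; split.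
      by move=> c x y; rewrite hdotDl hdotZl mulrDr scalerDl scalerA mulrCA.
    exists (`|a| * `|v| * `|v|); first by rewrite !mulr_ge0.
    move=> x; rewrite normrZ normrM.
    have := CauchySchwarz x v => h.
    rewrite -!mulrA ler_wpM2l// mulrC ler_wpM2l// mulrC //.
  move=> n; rewrite (eq_bigr (fun i => a ^+ 2 * `|v| ^+ 2 * '<<v, Defs.basis H i>> ^+ 2)).
    rewrite -mulr_sumr; apply: ler_wpM2l; first by rewrite mulr_ge0 ?sqr_ge0.
    exact: bessel (basis_on be).
  move=> i _; rewrite normrZ !exprMn (hdotC v) real_normK ?num_real// exprMn.
  by rewrite mulrAC.
split => //; have [bA' AA'] := adjointP be (HS_bounded hA).
apply: (hs_lim Hsep Hinf be) => //.
rewrite AA'; have h1 := parseval_dot v (adjoint A v) be.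
rewrite (_ : series _ = (fun n => a * series (fun i =>
  '<<v, Defs.basis H i>> * '<<adjoint A v, Defs.basis H i>>) n)).
  exact: cvgMr.
apply/funext => n; rewrite /series /= mulr_sumr; apply: eq_bigr => i _.
by rewrite hdotZl (hdotC (adjoint A v)) -AA' (hdotC _ v) (hdotC v (A _)) mulrA (hdotC v).
Qed.

Lemma rank_op_HS l : HS (rank_op l).
Proof.
elim: l => [|p l ih]; first by rewrite rank_op_nil; exact: HS0.
have [h _] := hs_rank1 p.1 (T p.2) ih.
suff -> : rank_op (p :: l) = (fun x => (p.1 * '<<x, T p.2>>) *: T p.2) \+ rank_op l.
  exact: HSD.
by apply/funext => x; rewrite rank_op_cons.
Qed.

Lemma hs_rank_op l A : HS A ->
  hs (rank_op l) A = \sum_(p <- l) p.1 * '<<A (T p.2), T p.2>>.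
Proof.
move=> hA; elim: l => [|p l ih].
  have -> : rank_op [::] = 0 \*: A.
    by apply/funext => x; rewrite rank_op_nil /= scale0r.
  by rewrite big_nil hsZl// mul0r.
have [h hh] := hs_rank1 p.1 (T p.2) hA.
have -> : rank_op (p :: l) = (fun x => (p.1 * '<<x, T p.2>>) *: T p.2) \+ rank_op l.
  by apply/funext => x; rewrite rank_op_cons.
by rewrite big_cons -ih -hh hsDl//; exact: rank_op_HS.
Qed.

Lemma rank_op_Sym l : Sym (rank_op l).
Proof.
split; first exact/HS_bounded/rank_op_HS.
move=> x y; rewrite rank_op_dot hdotC rank_op_dot; apply: eq_bigr => p _.
by rewrite mulrAC (hdotC _ y) (hdotC x).
Qed.

(** The right-hand side is the sum of squared covariances that Wick's formula produces for a product
    of two Gaussian quadratic forms. *)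
Lemma hs_rank_op_conj G l l' : Sym G ->
  hs (rank_op l) (G \o rank_op l' \o G) =
  \sum_(p <- l) \sum_(p' <- l') p.1 * p'.1 * '<<G (T p.2), T p'.2>> ^+ 2.
Proof.
move=> sG; have [_ [m m0 Gm]] := (bounded_opP G).1 sG.1.
have h1 := (HS_compl Hsep Hinf m0 sG.1 Gm (rank_op_HS l')).1.
rewrite hs_rank_op; last exact: (HS_compr Hsep Hinf m0 sG.1 Gm h1).1.
apply: eq_bigr => p _ /=; rewrite sG.2 rank_op_dot mulr_sumr.
apply: eq_bigr => p' _; rewrite (hdotC (T p'.2)); ring.
Qed.

End finite_rank.

Section finite_rank_approximation.
Context {R : realType} {H : hilbertType R}.
Hypotheses (Hsep : separable H) (Hinf : infinite_dimensional H).
Variables (T : H -> H) (h : nat -> H).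
Hypotheses (lT : linear T) (bh : orthonormal_basis (T \o h)).

Let b := T \o h.
Let Vij (V : H -> H) i j := '<<V (b i), b j>>.
(** The compression of [V] to the first [n] vectors of [b], written with squares only: by
    polarization, V_ij (b_i (x) b_j + b_j (x) b_i) / 2 is V_ij / 4 times the difference of the
    tensor squares of b_i + b_j and b_i - b_j. *)
Let ln V n : seq (R * H) :=
  [seq (4^-1 * Vij V p.1 p.2, h p.1 + h p.2) | p <- [seq (i, j) | i <- iota 0 n, j <- iota 0 n]] ++
  [seq (- (4^-1 * Vij V p.1 p.2), h p.1 - h p.2) | p <- [seq (i, j) | i <- iota 0 n, j <- iota 0 n]].

Let ln_sum (F : R -> H -> R) V n : \sum_(p <- ln V n) F p.1 p.2 =
  \sum_(0 <= i < n) \sum_(0 <= j < n) (F (4^-1 * Vij V i j) (h i + h j) +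
     F (- (4^-1 * Vij V i j)) (h i - h j)).
Proof.
rewrite /ln big_cat /= !big_map /= !big_allpairs /= -big_split /= /index_iota subn0.
by apply: eq_bigr => i _; rewrite -big_split.
Qed.

Let hs_ln V A n : Sym A -> HS A ->
  hs (rank_op T (ln V n)) A = \sum_(0 <= i < n) \sum_(0 <= j < n) Vij V i j * Vij A i j.
Proof.
move=> sA hA; rewrite hs_rank_op// (ln_sum (fun a g => a * '<<A (T g), T g>>)).
have lA := HS_linear hA.
apply: eq_bigr => i _; apply: eq_bigr => j _.
rewrite /Vij /b /= (linearD_ lT) (linearB_ lT) (linearD_ lA) (linearB_ lA).
rewrite !hdotDl !hdotDr !hdotNl !hdotNr.
by rewrite (sA.2 (T (h j)) (T (h i))) (hdotC (T (h j))); field.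
Qed.

Let ln_ij V n i j : Sym V -> (i < n)%N -> (j < n)%N ->
  Vij (rank_op T (ln V n)) i j = Vij V i j.
Proof.
move=> sV il jl; rewrite {1}/Vij rank_op_dot.
rewrite (ln_sum (fun a g => a * '<<b i, T g>> * '<<T g, b j>>)).
have on := basis_on bh.
rewrite (eq_bigr (fun k => \sum_(0 <= l < n) 2^-1 * Vij V k l *
    ((i == k)%:R * (l == j)%:R + (i == l)%:R * (k == j)%:R))); last first.
  move=> k _; apply: eq_bigr => l _.
  rewrite (linearD_ lT) (linearB_ lT) !hdotDl !hdotDr !hdotNl !hdotNr.
  rewrite -!/((T \o h) _) !on; by field.
rewrite (eq_bigr (fun k => 2^-1 * ((i == k)%:R * Vij V k j + (k == j)%:R * Vij V k i))).
  rewrite -mulr_sumr big_split /=.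
  rewrite [X in _ * (X + _)](eq_bigr (fun k => if k == i then Vij V i j else 0)); last first.
    by move=> k _; rewrite eq_sym; case: eqP => [->|]; rewrite ?mul1r ?mul0r.
  rewrite [X in _ * (_ + X)](eq_bigr (fun k => if k == j then Vij V j i else 0)); last first.
    by move=> k _; case: eqP => [->|]; rewrite ?mul1r ?mul0r.
  rewrite -!big_mkcond !big_nat1_eq il jl /=.
  by rewrite {2}/Vij sV.2 hdotC -/(Vij V i j); field.
move=> k _.
rewrite (eq_bigr (fun l => 2^-1 * ((if l == j then (i == k)%:R * Vij V k j else 0) +
   (if l == i then (k == j)%:R * Vij V k i else 0)))).
  by rewrite -mulr_sumr big_split /= -!big_mkcond !big_nat1_eq il jl.
move=> l _; rewrite (eq_sym i l); case: (eqVneq l j) => [->|_]; case: (eqVneq _ i) => [->|_];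
  rewrite ?eqxx /=; ring.
Qed.

(** Compression is an orthogonal projection for the Hilbert-Schmidt inner product, so |V - V_n|^2 is
    |V|^2 minus the sum of the V_ij^2 over i, j < n. [K] rows exhaust the norm up to half the error,
    and enough columns for these rows exhaust the other half. *)
Lemma finite_rank_approx V (eps : R) : SymHS V -> 0 < eps ->
  exists l, hsn (V \- rank_op T l) <= eps.
Proof.
move=> [sV hV] eps0.
pose sq n := \sum_(0 <= i < n) \sum_(0 <= j < n) Vij V i j ^+ 2.
have h2 n : hs2 (V \- rank_op T (ln V n)) = hs2 V - sq n.
  have hl := rank_op_HS Hsep Hinf T (ln V n).
  rewrite -hs_self//; last exact: HSB.
  rewrite hsBl// ?hsBr//; try exact: HSB.
  rewrite (hsC _ _ hV hl)// !hs_self// -(hs_self _ _ hl)//.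
  rewrite hs_ln//.
  have -> : hs (rank_op T (ln V n)) (rank_op T (ln V n)) = sq n.
    rewrite hs_ln//; last exact: rank_op_Sym.
    rewrite /sq big_nat [RHS]big_nat; apply: eq_bigr => i /= il.
    rewrite big_nat [RHS]big_nat; apply: eq_bigr => j /= jl.
    by rewrite ln_ij.
  by rewrite /sq; under eq_bigr do under eq_bigr do rewrite -expr2; ring.
suff [n hn] : exists n, hs2 V - sq n <= eps ^+ 2.
  exists (ln V n); rewrite -ler_sqr ?nnegrE ?hsn_ge0 ?(ltW eps0)//.
  by rewrite sqr_hsn h2.
have := hs2_cvg Hsep Hinf bh hV; have e2 : 0 < eps ^+ 2 / 2 by rewrite divr_gt0// exprn_gt0.
move=> /cvgrPdist_lt /(_ _ e2) [K _ /(_ K (leqnn K)) hK].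
have c2 : (fun n => \sum_(0 <= i < K) \sum_(0 <= j < n) Vij V i j ^+ 2) @ \oo -->
   \sum_(0 <= i < K) `|V (b i)| ^+ 2.
  rewrite [X in X @ _](_ : _ = \sum_(0 <= i < K) (fun n => \sum_(0 <= j < n) Vij V i j ^+ 2)).
    elim: K {hK} => [|K ih]; first by rewrite !big_geq//; exact: cvg_cst.
    rewrite !big_nat_recr//=; apply: cvgD => //.
    exact: (parseval (V (b K)) bh).
  by apply/funext => n; rewrite fct_sumE.
move: c2 => /cvgrPdist_lt /(_ _ e2) [N _ hN].
exists (maxn K N).
have := hN (maxn K N) (leq_maxr _ _).
move: hK; rewrite /series /= => /ltr_normlW hK /ltr_normlW hN'.
have : \sum_(0 <= i < K) \sum_(0 <= j < maxn K N) Vij V i j ^+ 2 <= sq (maxn K N).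
  rewrite /sq [leRHS](@big_cat_nat _ _ _ K) //= ?leq_maxl//.
  rewrite lerDl; apply: sumr_ge0 => i _; apply: sumr_ge0 => j _; exact: sqr_ge0.
move: hK hN'; rewrite -/b.
set x := \sum_(0 <= i < K) `|_| ^+ 2; set y := \sum_(0 <= i < K) _; set z := sq _.
lra.
Qed.

End finite_rank_approximation.

(** * Integration and normal laws on the real line *)

Section density.
Context d (T : measurableType d) {R : realType}.
Variables (nu : {finite_measure set T -> \bar R})
          (mu : {sigma_finite_measure set T -> \bar R}) (f : T -> R).
Hypotheses (mf : measurable_fun [set: T] f) (f0 : forall x, 0 <= f x).
Hypothesis nuE : forall A, measurable A -> nu A = (\int[mu]_(x in A) (f x)%:E)%E.
Local Open Scope ereal_scope.

Let nu_mu : nu `<< mu.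
Proof.
apply/null_content_dominatesP => A mA muA; rewrite nuE//.
apply: null_set_integral => //.
exact/measurable_funTS/measurable_EFinP.
Qed.

Let f_rn : ae_eq mu setT (Radon_Nikodym_SigmaFinite.f nu mu) (EFin \o f).
Proof.
apply: integral_ae_eq => //.
- exact: Radon_Nikodym_SigmaFinite.f_integrable nu_mu.
- exact/measurable_EFinP.
- by move=> E _ mE; rewrite -Radon_Nikodym_SigmaFinite.f_integral// nuE.
Qed.

(** The explicit density [f] agrees almost everywhere with the Radon-Nikodym derivative, for which
    the change of variables is known. *)
Lemma ge0_integral_density (g : T -> \bar R) : measurable_fun setT g ->
  (forall x, 0 <= g x) -> \int[nu]_x g x = \int[mu]_x (g x * (f x)%:E).
Proof.
move=> mg g0; rewrite -(Radon_Nikodym_SigmaFinite.change_of_variables nu_mu)//.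
apply: ae_eq_integral => //.
- apply: emeasurable_funM => //.
  by apply: measurable_int (Radon_Nikodym_SigmaFinite.f_integrable nu_mu).
- by apply: emeasurable_funM => //; exact/measurable_EFinP.
- by apply: filterS f_rn => x h _; rewrite h.
Qed.

Lemma integrable_density (g : T -> R) : measurable_fun setT g ->
  nu.-integrable setT (EFin \o g) <-> mu.-integrable setT (EFin \o (g \* f)%R).
Proof.
move=> mg.
have E : \int[nu]_x `|(EFin \o g) x| = \int[mu]_x `|(EFin \o (g \* f)%R) x|.
  rewrite ge0_integral_density//.
    by apply: eq_integral => x _ /=; rewrite normrM (ger0_norm (f0 x)) EFinM.
  by apply/measurable_EFinP; exact: measurableT_comp.
split=> /integrableP[_ h]; apply/integrableP; split.
- by apply/measurable_EFinP; exact: measurable_funM.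
- by rewrite -E.
- exact/measurable_EFinP.
- by rewrite E.
Qed.

Lemma integral_density (g : T -> R) : measurable_fun setT g ->
  \int[nu]_x (g x)%:E = \int[mu]_x (g x * f x)%:E.
Proof.
move=> mg; rewrite [LHS]integralE [RHS]integralE.
have mg' : measurable_fun setT (EFin \o g) by exact/measurable_EFinP.
rewrite !ge0_integral_density//; [|exact: measurable_funeneg|exact: measurable_funepos].
congr (_ - _); apply: eq_integral => x _; rewrite ?funeposE ?funenegE.
  rewrite maxe_pMl ?lee_fin ?f0//.
  by rewrite mul0e EFinM.
rewrite maxe_pMl ?lee_fin ?f0//.
by rewrite mul0e EFinM mulNe.
Qed.

Lemma Rintegral_density (g : T -> R) : measurable_fun setT g ->
  (\int[nu]_x g x = \int[mu]_x (g x * f x))%R.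
Proof. by move=> mg; rewrite /Rintegral integral_density. Qed.

End density.

(** * Differentiation under the integral and elementary integrability *)

Section derivation_under_integral.
Context d (Y : measurableType d) {R : realType}.
Variables (mu : {measure set Y -> \bar R}) (f f' : R -> Y -> R) (G : Y -> R).
Variables (a u v : R).

Lemma is_derive_under_integral : u < a < v ->
  (forall x, u < x < v -> mu.-integrable setT (EFin \o f x)) ->
  (forall x y, u < x < v -> is_derive x 1 (f ^~ y) (f' x y)) ->
  (forall x y, u < x < v -> `|f' x y| <= G y) ->
  mu.-integrable setT (EFin \o G) ->
  is_derive a 1 (fun x => \int[mu]_y f x y) (\int[mu]_y f' a y).
Proof.
move=> uav intf df bf iG.
have d1E x y : u < x < v -> partial1of2 f x y = f' x y.
  by move=> uxv; rewrite partial1of2E (@derive_val _ _ _ _ _ _ _ (df x y uxv)).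
have G0 y : 0 <= G y by apply: le_trans (bf a y uav).
have mI (x : R) : [set` `]u, v[] x -> u < x < v by rewrite /= in_itv.
have Ia : [set` `]u, v[] a by rewrite /= in_itv.
have h1 x : [set` `]u, v[] x -> mu.-integrable setT (EFin \o f x) by move=> /mI; exact: intf.
have h2 (x : R) (y : Y) : [set` `]u, v[] x -> [set: Y] y -> derivable (f ^~ y) x 1.
  by move=> /mI uxv _; have [] := df x y uxv.
have h3 (x : R) (y : Y) : [set` `]u, v[] x -> [set: Y] y -> `|partial1of2 f x y| <= G y.
  by move=> /mI uxv _; rewrite d1E// bf.
apply: DeriveDef.
  exact: (derivable_under_integral measurableT Ia h1 h2 G0 iG h3).
rewrite -derive1E (differentiation_under_integral measurableT Ia h1 h2 G0 iG h3).
by apply: eq_Rintegral => y _; rewrite d1E.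
Qed.

End derivation_under_integral.

Section real_integrable.
Context d (T : measurableType d) {R : realType}.
Variable mu : {measure set T -> \bar R}.
Implicit Types f g : T -> R.

Lemma Rintegrable_le f g : measurable_fun setT f -> (forall x, `|f x| <= g x) ->
  mu.-integrable setT (EFin \o g) -> mu.-integrable setT (EFin \o f).
Proof.
move=> mf fg ig; apply: (@le_integrable _ _ _ mu _ measurableT _ (EFin \o g)) => //.
- exact/measurable_EFinP.
- by move=> x _ /=; rewrite lee_fin (le_trans (fg x))// ler_norm.
Qed.

Lemma RintegrableD f g : mu.-integrable setT (EFin \o f) ->
  mu.-integrable setT (EFin \o g) -> mu.-integrable setT (EFin \o (fun x => f x + g x)).
Proof.
move=> h1 h2; have := integrableD measurableT h1 h2.
by congr (mu.-integrable _ _); apply/funext.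
Qed.

Lemma RintegrableZ (k : R) f : mu.-integrable setT (EFin \o f) ->
  mu.-integrable setT (EFin \o (fun x => k * f x)).
Proof.
move=> h1; have := integrableZl measurableT k h1.
by congr (mu.-integrable _ _); apply/funext.
Qed.

Lemma RintegrableN f : mu.-integrable setT (EFin \o f) ->
  mu.-integrable setT (EFin \o (fun x => - f x)).
Proof.
move=> /(RintegrableZ (-1)); congr (mu.-integrable _ (EFin \o _)).
by apply/funext => x; rewrite mulN1r.
Qed.

Lemma RintegrableB f g : mu.-integrable setT (EFin \o f) ->
  mu.-integrable setT (EFin \o g) -> mu.-integrable setT (EFin \o (fun x => f x - g x)).
Proof. by move=> h1 /RintegrableN h2; exact: RintegrableD. Qed.

Lemma Rintegrable_abs f : mu.-integrable setT (EFin \o f) ->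
  mu.-integrable setT (EFin \o (fun x => `|f x|)).
Proof.
move=> h; have /integrableP[/measurable_EFinP mf _] := h.
apply/integrableP; split; first by apply/measurable_EFinP; exact: measurableT_comp.
by have /integrableP[_] := h; under [in X in _ -> X]eq_integral do rewrite /= normr_id.
Qed.

Lemma Rintegral_cst_prob (P : probability T R) (r : R) : \int[P]_x r = r.
Proof.
rewrite Rintegral_cst//; have := @probability_setT _ _ _ P.
by rewrite /= => ->; rewrite mulr1.
Qed.

End real_integrable.

Section lebesgue_shift.
Context {R : realType}.
Notation leb := (@lebesgue_measure R).

Lemma lebesgue_shift (a : R) (A : set R) : measurable A ->
  leb A = leb ((fun x => x + a) @^-1` A).
Proof.
move=> mA.
have ms : @measurable_fun _ _ (measurableTypeR R) (measurableTypeR R) setT (fun x => x + a).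
  exact: measurable_funD.
pose mm := isMeasurableFun.Build _ _ _ _ _ ms.
pose phi : {mfun (measurableTypeR R) >-> (measurableTypeR R)} := MeasurableFun.Pack (MeasurableFun.Class mm).
rewrite -[RHS]/(pushforward leb phi A).
apply: lebesgue_measure_unique => // _ [[b c] _ <-] /=.
rewrite /pushforward (_ : _ @^-1` _ = `]b - a, c - a]%classic).
  rewrite !lebesgue_measure_itv /= !lte_fin ltrD2r; case: ifP => // _.
  by rewrite -!EFinB opprB addrA subrK.
by apply/seteqP; split=> x /=; rewrite !in_itv /= ltrBlDr lerBrDr.
Qed.

Lemma integral_shift (a : R) (g : R -> R) : measurable_fun setT g ->
  leb.-integrable setT (EFin \o (fun x => g (x + a))) ->
  (\int[leb]_x (g x)%:E = \int[leb]_x (g (x + a))%:E)%E.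
Proof.
move=> mg ig.
have ms : @measurable_fun _ _ (measurableTypeR R) (measurableTypeR R) setT (fun x => x + a).
  exact: measurable_funD.
have mg' : @measurable_fun _ _ (measurableTypeR R) _ setT (EFin \o g).
  exact/measurable_EFinP.
have := @integral_pushforward _ _ _ _ _ _ ms leb setT (EFin \o g) mg' ig measurableT.
rewrite preimage_setT => <-; apply: eq_measure_integral => A mA _.
exact: (lebesgue_shift a mA).
Qed.

End lebesgue_shift.

Section real_bounds.
Context {R : realType}.
Implicit Types x c : R.

Lemma is_derive_add (f g : R -> R) (df dg x : R) : is_derive x 1 f df ->
  is_derive x 1 g dg -> is_derive x 1 (fun x => f x + g x) (df + dg).
Proof. by move=> h1 h2; exact: is_deriveD. Qed.

Lemma is_derive_mul (f g : R -> R) (df dg x : R) : is_derive x 1 f df ->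
  is_derive x 1 g dg -> is_derive x 1 (fun x => f x * g x) (f x * dg + g x * df).
Proof. by move=> h1 h2; exact: is_deriveM. Qed.

Lemma is_derive_mull (k : R) (f : R -> R) (df x : R) : is_derive x 1 f df ->
  is_derive x 1 (fun x => k * f x) (k * df).
Proof. by move=> h1; exact: is_deriveZ. Qed.

Lemma is_derive_pow n (x : R) : is_derive x 1 (fun x : R => x ^+ n) (n%:R * x ^+ n.-1).
Proof.
have h := @is_deriveX R R id n x 1 1 (is_derive_id _ _).
rewrite (_ : (fun x : R => _) = id ^+ n); last by apply/funext => y; rewrite exprfctE.
by move: h; rewrite -[_%:A]/(_ * 1) mulr1.
Qed.

Lemma is_derive_affine_comp (g : R -> R) (dg t c x : R) :
  is_derive (t * x + c) 1 g dg -> is_derive x 1 (fun x => g (t * x + c)) (t * dg).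
Proof.
move=> hg.
have h1 : is_derive x 1 (fun x : R => t * x + c) (t * 1 + 0).
  by apply: is_derive_add; apply: is_derive_mull.
rewrite addr0 mulr1 in h1; rewrite mulrC.
exact: (@is_derive1_comp _ g (fun x : R => t * x + c)).
Qed.

(** Reduces domination by exponentials of |x| to exponential moments, which are explicit for the
    normal law. *)
Lemma expR_abs_le c x : expR (c * `|x|) <= expR (c * x) + expR (- c * x).
Proof.
have [x0|x0] := leP 0 x.
  by rewrite ger0_norm// lerDl expR_ge0.
by rewrite ltr0_norm// mulrN mulNr lerDr expR_ge0.
Qed.

Lemma abs_le_expR x : `|x| <= expR `|x|.
Proof. by apply: le_trans (expR_ge1Dx _); rewrite lerDr. Qed.

Lemma expR_abs_ge1 x : 1 <= expR `|x|.
Proof. by rewrite -expR0 ler_expR. Qed.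

Lemma sqr_le_expR x : x ^+ 2 <= 4 * expR `|x|.
Proof.
have h : `|x| / 2 <= expR (`|x| / 2).
  by apply: le_trans (expR_ge1Dx _); rewrite lerDr.
have : (`|x| / 2) ^+ 2 <= expR (`|x| / 2) ^+ 2 by rewrite ler_sqr ?nnegrE ?expR_ge0.
rewrite -expRM_natr divfK// exprMn real_normK ?num_real//; lra.
Qed.

Lemma cube_le_expR x : `|x ^+ 3| <= 27 * expR `|x|.
Proof.
have h : `|x| / 3 <= expR (`|x| / 3).
  by apply: le_trans (expR_ge1Dx _); rewrite lerDr.
have : (`|x| / 3) ^+ 3 <= expR (`|x| / 3) ^+ 3 by rewrite lerXn2r ?nnegrE ?expR_ge0.
rewrite -expRM_natr divfK// exprMn normrX; lra.
Qed.

Lemma cos_norm_le1 x : `|cos x| <= 1.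
Proof. by rewrite ler_norml cos_geN1 cos_le1. Qed.

Lemma sin_norm_le1 x : `|sin x| <= 1.
Proof. by rewrite ler_norml sin_geN1 sin_le1. Qed.

End real_bounds.

(** * Stein's identity, moments and transforms of the normal law *)

Section normal.
Context {R : realType}.
Notation leb := (@lebesgue_measure R).
Notation RM := (measurableTypeR R).
Variable s : R.
Hypothesis s0 : 0 < s.
Local Notation N := (normal_prob 0 s).
Local Notation mf1 g := (@measurable_fun _ _ RM RM setT g).
Local Notation p := (normal_pdf 0 s).

Let sN0 : s != 0. Proof. by rewrite gt_eqF. Qed.

Let mp : mf1 p.
Proof. exact: measurable_normal_pdf. Qed.

Let NE A : measurable A -> N A = (\int[leb]_(x in A) (p x)%:E)%E.
Proof. by []. Qed.

Let p0 x : 0 <= p x. Proof. exact: normal_pdf_ge0. Qed.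

Lemma integral_normal_prob (g : R -> R) : mf1 g ->
  \int[N]_x g x = \int[leb]_x (g x * p x).
Proof. by move=> mg; exact: (Rintegral_density mp p0 NE). Qed.

Lemma integrable_normal_prob (g : R -> R) : mf1 g ->
  N.-integrable setT (EFin \o g) <-> leb.-integrable setT (EFin \o (g \* p)).
Proof. by move=> mg; exact: (integrable_density mp p0 NE). Qed.

Lemma measurable_affine (t c : R) : mf1 (fun x => t * x + c).
Proof. by apply: measurable_funD => //; exact: measurable_funM. Qed.

Lemma measurable_expR_lin (t : R) : mf1 (fun x => expR (t * x)).
Proof. by apply: measurableT_comp => //; exact: measurable_funM. Qed.

Lemma measurable_expR_abs (t : R) : mf1 (fun x => expR (t * `|x|)).
Proof.
by apply: measurableT_comp => //; apply: measurable_funM.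
Qed.

Lemma expR_normal_pdf (b x : R) :
  expR (b * x) * p x = expR (b ^+ 2 * s ^+ 2 / 2) * normal_pdf (s ^+ 2 * b) s x.
Proof.
rewrite !normal_pdfE// [LHS]mulrCA [RHS]mulrCA; congr (_ * _).
rewrite /normal_fun -!expRD; congr expR.
by rewrite -(mulr_natl (s ^+ 2)); field.
Qed.

Lemma integral_normal_expR (b : R) :
  (\int[N]_x (expR (b * x))%:E = (expR (b ^+ 2 * s ^+ 2 / 2))%:E)%E.
Proof.
rewrite (ge0_integral_density mp NE); last 2 first.
- by apply/measurable_EFinP; exact: measurable_expR_lin.
- by move=> x; rewrite lee_fin expR_ge0.
under eq_integral do rewrite -EFinM expR_normal_pdf EFinM.
rewrite ge0_integralZl//; try by [apply/measurable_EFinP; exact: measurable_normal_pdf|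
  move=> x _; rewrite lee_fin normal_pdf_ge0|rewrite lee_fin expR_ge0].
by rewrite integral_normal_pdf mule1.
Qed.

Lemma integrable_normal_expR_abs (c : R) :
  N.-integrable setT (EFin \o (fun x => expR (c * `|x|))).
Proof.
have h b : N.-integrable setT (EFin \o (fun x => expR (b * x))).
  apply/integrableP; split.
    by apply/measurable_EFinP; exact: measurable_expR_lin.
  under eq_integral do rewrite /= ger0_norm ?expR_ge0//.
  by rewrite integral_normal_expR ltry.
apply: (@Rintegrable_le _ RM R N _ (fun x : R => expR (c * x) + expR (- c * x))).
- exact: measurable_expR_abs.
- by move=> x; rewrite ger0_norm ?expR_ge0// expR_abs_le.
- by apply: RintegrableD; exact: h.
Qed.

Lemma integrable_normal_dom (g : R -> R) (C c : R) : mf1 g ->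
  (forall x, `|g x| <= C * expR (c * `|x|)) -> N.-integrable setT (EFin \o g).
Proof.
move=> mg gC; apply: (@Rintegrable_le _ RM R N _ (fun x : R => C * expR (c * `|x|))) => //.
by apply: RintegrableZ; exact: integrable_normal_expR_abs.
Qed.

(** The Cameron-Martin formula on the line; the growth bound on [g] makes the shifted function
    integrable. *)
Lemma integral_normal_shift (g : R -> R) (a C c : R) : mf1 g ->
  0 <= C -> 0 <= c -> (forall x, `|g x| <= C * expR (c * `|x|)) ->
  \int[N]_x g (x + a) = \int[N]_x (g x * expR ((a * x - a ^+ 2 / 2) / s ^+ 2)).
Proof.
move=> mg C0 c0 gC.
have ma : mf1 (fun x => x + a) by exact: measurable_funD.
have ma' : mf1 (fun x => x - a) by exact: measurable_funB.
have mga : mf1 (fun x => g (x + a)) by exact: measurableT_comp.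
have me : mf1 (fun x => expR ((a * x - a ^+ 2 / 2) / s ^+ 2)).
  apply: measurableT_comp => //; apply: measurable_funM => //.
  by apply: measurable_funB => //; exact: measurable_funM.
rewrite !integral_normal_prob//; last exact: measurable_funM.
have pa x : p (x - a) = expR ((a * x - a ^+ 2 / 2) / s ^+ 2) * p x.
  rewrite !normal_pdfE// [RHS]mulrCA; congr (_ * _).
  rewrite /normal_fun -!expRD; congr expR.
  by rewrite -(mulr_natl (s ^+ 2)); field.
rewrite /Rintegral; congr fine.
rewrite [RHS](_ : _ = \int[leb]_x (g x * p (x - a))%:E)%E; last first.
  by apply: eq_integral => x _; rewrite pa mulrA.
have mpa : mf1 (fun x => p (x - a)) by exact: measurableT_comp.
rewrite (integral_shift (a := a) (g := fun x => g x * p (x - a))).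
- by apply: eq_integral => x _; rewrite addrK.
- exact: measurable_funM.
- rewrite (_ : EFin \o _ = EFin \o ((fun x => g (x + a)) \* p)); last first.
    by apply/funext => x /=; rewrite addrK.
  apply/(integrable_normal_prob mga).
  apply: (integrable_normal_dom (C := C * expR (c * `|a|)) (c := c)) => // x.
  rewrite (le_trans (gC _))// -mulrA ler_wpM2l// -expRD ler_expR -mulrDr ler_wpM2l//.
  by rewrite addrC ler_normD.
Qed.

(** Stein's identity, obtained by differentiating both sides of the shift formula at [a = 0], so
    that no boundary terms arise. The moments and the characteristic function both follow from
    it. *)
Lemma normal_stein (g g' : R -> R) (C : R) :
  (forall x : R, is_derive x 1 g (g' x)) -> mf1 g -> mf1 g' ->
  0 <= C -> (forall x, `|g x| <= C * expR `|x|) -> (forall x, `|g' x| <= C * expR `|x|) ->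
  \int[N]_x (x * g x) = s ^+ 2 * \int[N]_x g' x.
Proof.
move=> dg mg mg' C0 gC g'C.
have gC1 x : `|g x| <= C * expR (1 * `|x|) by rewrite mul1r.
have s2 : 0 < s ^+ 2 by rewrite exprn_gt0.
have ma (a : R) : mf1 (fun x => x + a) by exact: measurable_funD.
have me (a : R) : mf1 (fun x => expR ((a * x - a ^+ 2 / 2) / s ^+ 2)).
  apply: measurableT_comp => //; apply: measurable_funM => //.
  by apply: measurable_funB => //; exact: measurable_funM.
have D1 : is_derive (0 : R) 1 (fun a : R => \int[N]_x g (x + a)) (\int[N]_x g' (x + 0)).
  apply: (@is_derive_under_integral _ RM R N (fun a x => g (x + a)) (fun a x => g' (x + a))
    (fun x => C * expR 1 * expR (1 * `|x|)) 0 (-1) 1).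
  - by rewrite ltrN10 ltr01.
  - move=> a _; apply: (integrable_normal_dom (C := C * expR `|a|) (c := 1)).
      by apply: measurableT_comp mg (ma a).
    move=> x; rewrite (le_trans (gC _))// -mulrA ler_wpM2l// -expRD ler_expR mul1r.
    by rewrite addrC ler_normD.
  - move=> a x _.
    have := is_derive_affine_comp (g := g) (t := 1) (c := x) (x := a) (dg (1 * a + x)).
    rewrite mul1r; under eq_fun do rewrite mul1r addrC.
    by rewrite mul1r addrC.
  - move=> a x /andP[a1 a2]; rewrite (le_trans (g'C _))// -mulrA ler_wpM2l//.
    rewrite -expRD ler_expR mul1r (le_trans (ler_normD _ _))// addrC lerD2r.
    by rewrite ler_norml !ltW.
  - apply: (integrable_normal_dom (C := C * expR 1) (c := 1)).
      by apply: measurable_funM => //; exact: measurable_expR_abs.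
    by move=> x; rewrite ger0_norm// !mulr_ge0 ?expR_ge0.
pose E (a x : R) := expR ((a * x - a ^+ 2 / 2) / s ^+ 2).
have dE (a x : R) : is_derive a 1 (E ^~ x) ((x - a) / s ^+ 2 * E a x).
  rewrite /E; have h : is_derive a 1 (fun a : R => (a * x - a ^+ 2 / 2) / s ^+ 2) ((x - a) / s ^+ 2).
    rewrite (_ : (fun a : R => _) = (fun a => x / s ^+ 2 * a + - (2 * s ^+ 2)^-1 * a ^+ 2)); last first.
      by apply/funext => y; field.
    have := is_derive_add (is_derive_mull (x / s ^+ 2) (is_derive_id a 1))
      (is_derive_mull (- (2 * s ^+ 2)^-1) (is_derive_pow 2 a)).
    move=> /is_derive_eq; apply; by field.
  by rewrite mulrC; exact: (@is_derive1_comp _ expR _ a _ _ (is_derive_expR _) h).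
(* For |a| < s^2 the factors |g x|, [E a x] and |x - a| are at most C, 1 and 1 + s^2 times the
   exponential of |x|, whence the exponent 3 in the dominating function. *)
have D2 : is_derive (0 : R) 1 (fun a : R => \int[N]_x (g x * E a x))
    (\int[N]_x (g x * ((x - 0) / s ^+ 2 * E 0 x))).
  apply: (@is_derive_under_integral _ RM R N (fun a x => g x * E a x)
    (fun a x => g x * ((x - a) / s ^+ 2 * E a x))
    (fun x => C * (1 + s ^+ 2) / s ^+ 2 * expR (3 * `|x|)) 0 (- s ^+ 2) (s ^+ 2)).
  - by rewrite oppr_lt0 s2.
  - move=> a _; apply: (integrable_normal_dom (C := C) (c := 1 + `|a| / s ^+ 2)).
      by apply: measurable_funM => //; exact: me.
    move=> x; rewrite normrM mulrDl mul1r expRD mulrA ler_pM// ger0_norm ?expR_ge0//.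
    rewrite /E ler_expR [leRHS]mulrAC ler_wpM2r ?invr_ge0 ?(ltW s2)// -normrM.
    by rewrite (le_trans _ (ler_norm _))// gerBl divr_ge0 ?sqr_ge0.
  - move=> a x /andP[a1 a2].
    have aa : `|a| <= s ^+ 2 by rewrite ler_norml !ltW.
    have E1 : E a x <= expR `|x|.
      rewrite /E ler_expR ler_pdivrMr//.
      have : a * x <= `|x| * s ^+ 2.
        by rewrite (le_trans (ler_norm _))// normrM mulrC ler_wpM2l.
      by have := sqr_ge0 a; lra.
    rewrite !normrM [`|E a x|]ger0_norm ?expR_ge0// normfV [`|s ^+ 2|]gtr0_norm//.
    rewrite (_ : 3 * `|x| = `|x| + (`|x| + `|x|)); last by ring.
    rewrite 2!expRD.
    have h1 : `|x - a| <= expR `|x| * (1 + s ^+ 2).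
      rewrite (le_trans (ler_normB _ _))// mulrDr mulr1 lerD ?abs_le_expR//.
      by rewrite (le_trans aa)// ler_peMl ?(ltW s2)// expR_abs_ge1.
    apply: (@le_trans _ _ ((C * expR `|x|) * (expR `|x| * (1 + s ^+ 2) / s ^+ 2 * expR `|x|))).
      apply: ler_pM => //; first by rewrite mulr_ge0 ?divr_ge0 ?expR_ge0 ?(ltW s2).
      apply: ler_pM => //; rewrite ?expR_ge0 ?divr_ge0 ?(ltW s2)//.
      by rewrite ler_wpM2r ?invr_ge0 ?(ltW s2).
    by rewrite le_eqVlt; apply/orP; left; apply/eqP; ring.
  - apply: (integrable_normal_dom (C := C * (1 + s ^+ 2) / s ^+ 2) (c := 3)).
      by apply: measurable_funM => //; exact: measurable_expR_abs.
    move=> x; rewrite ger0_norm// mulr_ge0 ?expR_ge0// divr_ge0 ?(ltW s2)//.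
    by rewrite mulr_ge0// addr_ge0 ?(ltW s2).
have E12 : (fun a : R => \int[N]_x g (x + a)) = (fun a : R => \int[N]_x (g x * E a x)).
  by apply/funext => a; exact: (integral_normal_shift a mg C0 ler01 gC1).
have : \int[N]_x g' (x + 0) = \int[N]_x (g x * ((x - 0) / s ^+ 2 * E 0 x)).
  rewrite -(@derive_val _ _ _ _ _ _ _ D2) -E12; exact/esym/(@derive_val _ _ _ _ _ _ _ D1).
under eq_Rintegral do rewrite addr0; move=> ->.
rewrite -RintegralZl//.
  apply: eq_Rintegral => x _; rewrite /E subr0 mul0r expr0n /= mul0r subr0 mul0r expR0 mulr1.
  by field; rewrite gt_eqF.
apply: (integrable_normal_dom (C := C / s ^+ 2) (c := 2)).
  apply: measurable_funM => //; apply: measurable_funM; last exact: me.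
  by apply: measurable_funM => //; exact: measurable_funB.
move=> x; rewrite /E subr0 mul0r expr0n /= mul0r subr0 mul0r expR0 mulr1.
rewrite !normrM normfV [`|s ^+ 2|]gtr0_norm// (_ : 2 * `|x| = `|x| + `|x|); last by ring.
rewrite expRD mulrA [leRHS](_ : _ = C * expR `|x| * expR `|x| / s ^+ 2); last by ring.
by rewrite ler_wpM2r ?invr_ge0 ?(ltW s2)// ler_pM// abs_le_expR.
Qed.

Lemma normal_moment2 : \int[N]_x (x ^+ 2) = s ^+ 2.
Proof.
have := @normal_stein id (cst 1) 1.
under eq_Rintegral do rewrite -expr2.
move=> ->//.
- have -> : \int[N]_x cst 1 x = 1 by exact: Rintegral_cst_prob.
  by rewrite mulr1.
- by move=> x; rewrite mul1r; exact: abs_le_expR.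
- by move=> x; rewrite mul1r normr1; exact: expR_abs_ge1.
Qed.

Lemma normal_moment4 : \int[N]_x (x ^+ 4) = 3 * s ^+ 4.
Proof.
have h := @normal_stein (fun x => x ^+ 3) (fun x => 3 * x ^+ 2) 27.
rewrite (_ : \int[N]_x (x ^+ 4) = \int[N]_x (x * x ^+ 3)); last first.
  by apply: eq_Rintegral => x _; rewrite -exprS.
have -> : \int[N]_x (x * x ^+ 3) = s ^+ 2 * \int[N]_x (3 * x ^+ 2).
  apply: h => //.
  - by move=> x; exact: is_derive_pow.
  - by apply: measurable_funM => //; exact: measurable_funX.
  - exact: cube_le_expR.
  - move=> x; rewrite normrM normr_nat (ger0_norm (sqr_ge0 x)).
    by have := sqr_le_expR x; have := expR_ge0 `|x|; lra.
rewrite RintegralZl//.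
  by rewrite normal_moment2; ring.
apply: (integrable_normal_dom (C := 4) (c := 1)) => [|x].
  exact: measurable_funX.
by rewrite ger0_norm ?sqr_ge0// mul1r sqr_le_expR.
Qed.

Let measurable_cosa (t c : R) : mf1 (fun x => cos (t * x + c)).
Proof. by apply: measurableT_comp (measurable_affine _ _); apply: continuous_measurable_fun; exact: continuous_cos. Qed.

Let measurable_sina (t c : R) : mf1 (fun x => sin (t * x + c)).
Proof. by apply: measurableT_comp (measurable_affine _ _); apply: continuous_measurable_fun; exact: continuous_sin. Qed.

(** Stein's identity turns differentiation in the frequency into phi'(v) = - s^2 v phi(v), so phi
    times the exponential of s^2 v^2 / 2 is constant. The phase [c] treats cosines and sines
    together. *)
Lemma normal_cos (t c : R) :
  \int[N]_x cos (t * x + c) = cos c * expR (- (t ^+ 2 * s ^+ 2 / 2)).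
Proof.
pose phi (u : R) := \int[N]_x cos (u * x + c).
have icos (u : R) : N.-integrable setT (EFin \o (fun x => cos (u * x + c))).
  apply: (integrable_normal_dom (C := 1) (c := 0)); first exact: measurable_cosa.
  by move=> x; rewrite mul0r expR0 mulr1 cos_norm_le1.
have dphi (v : R) : is_derive v 1 phi (- (s ^+ 2 * v) * phi v).
  have D : is_derive v 1 phi (\int[N]_x (- (x * sin (v * x + c)))).
    apply: (@is_derive_under_integral _ RM R N (fun v x => cos (v * x + c))
      (fun v x => - (x * sin (v * x + c))) (fun x => `|x|) v (v - 1) (v + 1)).
    - by rewrite ltrBlDr !ltrDl ltr01.
    - by move=> a _; exact: icos.
    - move=> a x _.
      have := is_derive_affine_comp (g := cos) (t := x) (c := c) (x := a) (is_derive_cos _).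
      by rewrite mulrN (mulrC x a); under eq_fun do rewrite mulrC.
    - by move=> a x _; rewrite normrN normrM ler_piMr// sin_norm_le1.
    - apply: (integrable_normal_dom (C := 1) (c := 1)) => [|x].
        exact: measurableT_comp.
      by rewrite normr_id !mul1r abs_le_expR.
  apply: is_derive_eq D _.
  have mxs : mf1 (fun x => x * sin (v * x + c)).
    by apply: measurable_funM => //; exact: measurable_sina.
  have ixs : N.-integrable setT (EFin \o (fun x => x * sin (v * x + c))).
    apply: (integrable_normal_dom (C := 1) (c := 1)) => // x.
    by rewrite normrM !mul1r (le_trans _ (abs_le_expR x))// ler_piMr// sin_norm_le1.
  under eq_Rintegral do rewrite -mulN1r.
  rewrite RintegralZl//.
  have -> : \int[N]_x (x * sin (v * x + c)) = s ^+ 2 * \int[N]_x (v * cos (v * x + c)).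
    apply: (@normal_stein (fun x => sin (v * x + c)) (fun x => v * cos (v * x + c)) (1 + `|v|)).
    - by move=> x; apply: is_derive_affine_comp.
    - exact: measurable_sina.
    - by apply: measurable_funM => //; exact: measurable_cosa.
    - by rewrite addr_ge0.
    - move=> x; rewrite -[leLHS]mulr1 ler_pM// ?(le_trans (sin_norm_le1 _)) ?lerDl//.
      exact: expR_abs_ge1.
    - move=> x; rewrite normrM -[leLHS]mulr1 ler_pM ?mulr_ge0 ?expR_abs_ge1//.
      by rewrite (le_trans (ler_piMr _ (cos_norm_le1 _)))// lerDr.
  by rewrite RintegralZl// /phi; ring.
pose psi (u : R) := phi u * expR (s ^+ 2 / 2 * u ^+ 2).
have dpsi (u : R) : is_derive (u : R) 1 psi 0.
  have h := is_derive_mull (s ^+ 2 / 2) (is_derive_pow 2 u).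
  have h2 := @is_derive1_comp _ expR _ u _ _ (is_derive_expR _) h.
  apply: is_derive_eq (is_derive_mul (dphi u) h2) _.
  by rewrite /=; field.
have := is_derive_0_is_cst t 0 dpsi.
rewrite /psi expr0n /= mulr0 expR0 mulr1.
have -> : phi 0 = cos c.
  rewrite /phi; under eq_Rintegral do rewrite mul0r add0r.
  exact: Rintegral_cst_prob.
move=> <-; rewrite -[RHS]mulrA -expRD (_ : _ + _ = 0) ?expR0 ?mulr1//; by field.
Qed.

(** Completing the square: the integrand times the density is a multiple of a normal density of
    variance v = s^2 / (1 + g s^2) and mean v b. The ratio [Z] of the two peaks does not depend on
    [b]. *)
Lemma normal_quadratic (g : R) : 0 <= g -> exists2 Z : R, 0 < Z &
  forall b, (\int[N]_x (expR (b * x - g * x ^+ 2 / 2))%:E =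
    (Z * expR (2^-1 * b ^+ 2 * (s ^+ 2 / (1 + g * s ^+ 2))))%:E)%E.
Proof.
move=> g0; have s2 : 0 < s ^+ 2 by rewrite exprn_gt0.
have d0 : 0 < 1 + g * s ^+ 2 by rewrite ltr_pwDl// mulr_ge0// ltW.
pose v := s ^+ 2 / (1 + g * s ^+ 2); pose s' := Num.sqrt v.
have v0 : 0 < v by rewrite divr_gt0.
have s'0 : 0 < s' by rewrite sqrtr_gt0.
have s'N0 : s' != 0 by rewrite gt_eqF.
have s'2 : s' ^+ 2 = v by rewrite sqr_sqrtr// ltW.
exists (normal_peak s / normal_peak s'); first by rewrite divr_gt0// normal_peak_gt0.
move=> b; have mb : mf1 (fun x => expR (b * x - g * x ^+ 2 / 2)).
  apply: measurableT_comp => //; apply: measurable_funB; first exact: measurable_funM.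
  apply: measurable_funM => //; apply: measurable_funM => //; exact: measurable_funX.
rewrite (ge0_integral_density mp NE); last 2 first.
- exact/measurable_EFinP.
- by move=> x; rewrite lee_fin expR_ge0.
have E x : expR (b * x - g * x ^+ 2 / 2) * p x = (normal_peak s / normal_peak s' *
    expR (2^-1 * b ^+ 2 * v)) * normal_pdf (v * b) s' x.
  have pk : normal_peak s' != 0 by rewrite gt_eqF// normal_peak_gt0.
  rewrite !normal_pdfE// [LHS]mulrCA [RHS](_ : _ = normal_peak s * (expR (2^-1 * b ^+ 2 * v) *
    normal_fun (v * b) s' x)); last by field.
  congr (_ * _); rewrite /normal_fun -!expRD s'2 /v; congr expR.
  rewrite !mulr2n; field.
  by rewrite ?mulf_neq0 ?gt_eqF//= ?mulr2n ?addr_gt0.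
under eq_integral do rewrite -EFinM E EFinM.
rewrite ge0_integralZl//; try by [apply/measurable_EFinP; exact: measurable_normal_pdf|
  move=> x _; rewrite lee_fin normal_pdf_ge0|
  rewrite lee_fin !mulr_ge0 ?invr_ge0 ?expR_ge0 ?normal_peak_ge0].
by rewrite integral_normal_pdf mule1.
Qed.

End normal.

(** * Random variables with a centered normal law, degenerate case included *)

Section centered_normal_law.
Context d (T : measurableType d) {R : realType}.
Notation RM := (measurableTypeR R).
Variables (P : probability T R) (X : T -> RM) (v : R).
Hypotheses (mX : measurable_fun setT X) (v0 : 0 <= v).
Hypothesis XP : forall A : set R, measurable A -> P (X @^-1` A) = centered_normal v A.
Local Notation mf1 g := (@measurable_fun _ _ RM RM setT g).

Let ge0_law (g : R -> R) : mf1 g -> (forall x, 0 <= g x) ->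
  (\int[P]_x (g (X x))%:E =
  if v == 0%R then (g 0%R)%:E
  else \int[normal_prob 0%R (Num.sqrt v)]_x (g x)%:E)%E.
Proof.
move=> mg g0.
have mg' : @measurable_fun _ _ RM _ setT (EFin \o g) by exact/measurable_EFinP.
have h := @ge0_integral_pushforward _ _ _ _ _ _ mX P setT (EFin \o g) measurableT mg'.
rewrite preimage_setT in h; rewrite -[LHS]h; last by move=> y _ /=; rewrite lee_fin.
have [v00|vN0] := eqVneq v 0.
  rewrite (eq_measure_integral (\d_(0 : RM))); last first.
    by move=> A mA _; rewrite -[LHS]/(P (X @^-1` A)) XP// /centered_normal v00 eqxx.
  by rewrite integral_dirac// diracT mul1e.
by apply: eq_measure_integral => A mA _; rewrite -[LHS]/(P (X @^-1` A)) XP// /centered_normal (negbTE vN0).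
Qed.

Lemma centered_normal_integral (g : R -> R) : mf1 g ->
  P.-integrable setT (EFin \o (g \o X)) ->
  \int[P]_x g (X x) = if v == 0 then g 0 else \int[normal_prob 0 (Num.sqrt v)]_x g x.
Proof.
move=> mg ig.
have mg' : @measurable_fun _ _ RM _ setT (EFin \o g) by exact/measurable_EFinP.
have h := @integral_pushforward _ _ _ _ _ _ mX P setT (EFin \o g) mg' ig measurableT.
rewrite preimage_setT in h; rewrite /Rintegral -[X in fine X = _]h.
have [v00|vN0] := eqVneq v 0.
  rewrite (eq_measure_integral (\d_(0 : RM))); last first.
    by move=> A mA _; rewrite -[LHS]/(P (X @^-1` A)) XP// /centered_normal v00 eqxx.
  by rewrite integral_dirac// diracT mul1e.
congr fine.
by apply: eq_measure_integral => A mA _; rewrite -[LHS]/(P (X @^-1` A)) XP// /centered_normal (negbTE vN0).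
Qed.

Let sv : v != 0 -> 0 < Num.sqrt v.
Proof. by move=> vN0; rewrite sqrtr_gt0 lt_neqAle eq_sym vN0. Qed.

Let integrable_law (g : R -> R) : mf1 g -> (forall x, 0 <= g x) ->
  (v != 0 -> (normal_prob 0 (Num.sqrt v)).-integrable setT (EFin \o g)) ->
  P.-integrable setT (EFin \o (g \o X)).
Proof.
move=> mg g0 ig; apply/integrableP; split.
  by apply/measurable_EFinP; exact: measurableT_comp.
under eq_integral do rewrite /= ger0_norm//.
rewrite ge0_law//; case: eqP => [_|/eqP vN0]; first by rewrite ltry.
have /integrableP[_] := ig vN0.
by under eq_integral do rewrite /= ger0_norm//.
Qed.

Lemma centered_normal_cos (c : R) : \int[P]_x cos (X x + c) = cos c * expR (- (v / 2)).
Proof.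
have mc : mf1 (fun x => cos (x + c)).
  apply: continuous_measurable_fun => x.
  apply: continuous_comp; last exact: continuous_cos.
  by apply: cvgD; [exact: cvg_id|exact: cvg_cst].
rewrite (centered_normal_integral mc); last first.
  apply: (Rintegrable_le (g := cst 1)).
  - exact: measurableT_comp.
  - by move=> x /=; exact: cos_norm_le1.
  - exact: finite_measure_integrable_cst.
have [->|vN0] := eqVneq v 0; first by rewrite mul0r oppr0 expR0 mulr1 add0r.
have := normal_cos (sv vN0) 1 c; rewrite expr1n mul1r sqr_sqrtr// => <-.
by apply: eq_Rintegral => x _; rewrite mul1r.
Qed.

Lemma centered_normal_integrable4 : P.-integrable setT (EFin \o (fun x => X x ^+ 4)).
Proof.
apply: (@integrable_law (fun x => x ^+ 4)); first exact: measurable_funX.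
  by move=> x; rewrite (exprM x 2 2) sqr_ge0.
move=> vN0; apply: (integrable_normal_dom (sv vN0) (C := 16) (c := 2)).
  exact: measurable_funX.
move=> x; rewrite ger0_norm (exprM x 2 2) ?sqr_ge0// (_ : 2 * `|x| = `|x| + `|x|); last by ring.
rewrite expRD (_ : 16 * _ = (4 * expR `|x|) ^+ 2); last by ring.
by rewrite ler_sqr ?nnegrE ?sqr_ge0 ?mulr_ge0 ?expR_ge0// sqr_le_expR.
Qed.

Lemma centered_normal_integrable2 : P.-integrable setT (EFin \o (fun x => X x ^+ 2)).
Proof.
apply: (@integrable_law (fun x => x ^+ 2)); first exact: measurable_funX.
  by move=> x; rewrite sqr_ge0.
move=> vN0; apply: (integrable_normal_dom (sv vN0) (C := 4) (c := 1)).
  exact: measurable_funX.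
by move=> x; rewrite ger0_norm ?sqr_ge0// mul1r sqr_le_expR.
Qed.

Lemma centered_normal_moment2 : \int[P]_x (X x ^+ 2) = v.
Proof.
rewrite (@centered_normal_integral (fun x => x ^+ 2)); last 2 first.
- exact: measurable_funX.
- exact: centered_normal_integrable2.
have [->|vN0] := eqVneq v 0; first by rewrite expr0n.
by rewrite normal_moment2 ?sv// sqr_sqrtr.
Qed.

Lemma centered_normal_moment4 : \int[P]_x (X x ^+ 4) = 3 * v ^+ 2.
Proof.
rewrite (@centered_normal_integral (fun x => x ^+ 4)); last 2 first.
- exact: measurable_funX.
- exact: centered_normal_integrable4.
have [->|vN0] := eqVneq v 0; first by rewrite !expr0n mulr0.
by rewrite normal_moment4 ?sv// (exprM _ 2 2) sqr_sqrtr.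
Qed.

End centered_normal_law.

(** * Square-integrable functions *)

Section almost_everywhere.
Context d (T : measurableType d) {R : realType} (mu : {measure set T -> \bar R}).
Implicit Types P Q W : T -> Prop.

Lemma ae_mono P Q : (forall x, P x -> Q x) ->
  {ae mu, forall x, P x} -> {ae mu, forall x, Q x}.
Proof. by move=> PQ; apply: filterS. Qed.

Lemma ae_mono2 P Q W : (forall x, P x -> Q x -> W x) ->
  {ae mu, forall x, P x} -> {ae mu, forall x, Q x} -> {ae mu, forall x, W x}.
Proof. by move=> PQ; apply: filterS2. Qed.

End almost_everywhere.
Arguments ae_mono {d T R} mu P Q.
Arguments ae_mono2 {d T R} mu P Q W.

Section square_integrable.
Context d (T : measurableType d) {R : realType}.
Variable P : probability T R.
Implicit Types (f g : T -> R).

(** Square integrability and its norm as plain real integrals; [Lfun_sqint] and [L2norm_l2] connect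
    them to the L^2 space and norm in the definition of the derivative. *)
Definition sqint f := measurable_fun setT f /\
  P.-integrable setT (EFin \o (fun x => f x ^+ 2)).

Definition l2 f : R := Num.sqrt (\int[P]_x (f x ^+ 2)).

Lemma l2_ge0 f : 0 <= l2 f. Proof. exact: sqrtr_ge0. Qed.

Lemma sqr_l2 f : l2 f ^+ 2 = \int[P]_x (f x ^+ 2).
Proof. by rewrite sqr_sqrtr// Rintegral_ge0// => x _; exact: sqr_ge0. Qed.

Lemma sqint_cst (k : R) : sqint (cst k).
Proof. by split => //; exact: (finite_measure_integrable_cst P (k ^+ 2)). Qed.

Lemma sqint_mul f g : sqint f -> sqint g ->
  P.-integrable setT (EFin \o (fun x => f x * g x)).
Proof.
move=> [mf f2] [mg g2]; apply: (Rintegrable_le (g := fun x => f x ^+ 2 + g x ^+ 2)).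
- exact: measurable_funM.
- move=> x; rewrite normrM -(real_normK (num_real (f x))) -(real_normK (num_real (g x))).
  have := sqr_ge0 (`|f x| - `|g x|); have := normr_ge0 (f x); have := normr_ge0 (g x).
  by rewrite sqrrB; nra.
- exact: RintegrableD.
Qed.

Lemma sqint_integrable f : sqint f -> P.-integrable setT (EFin \o f).
Proof.
move=> h; have := sqint_mul h (sqint_cst 1); congr (P.-integrable _ (EFin \o _)).
by apply/funext => x /=; rewrite mulr1.
Qed.

Lemma sqintZ (k : R) f : sqint f -> sqint (fun x => k * f x).
Proof.
move=> [mf f2]; split; first exact: measurable_funM.
have := RintegrableZ (k ^+ 2) f2; congr (P.-integrable _ (EFin \o _)).
by apply/funext => x /=; rewrite exprMn.
Qed.

Lemma sqintD f g : sqint f -> sqint g -> sqint (fun x => f x + g x).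
Proof.
move=> hf hg; split; first exact: measurable_funD hf.1 hg.1.
have := RintegrableD (RintegrableD hf.2 hg.2) (RintegrableZ 2 (sqint_mul hf hg)).
congr (P.-integrable _ (EFin \o _)).
by apply/funext => x /=; ring.
Qed.

Lemma sqintN f : sqint f -> sqint (fun x => - f x).
Proof.
by move=> /(sqintZ (-1)); congr sqint; apply/funext => x; rewrite mulN1r.
Qed.

Lemma sqintB f g : sqint f -> sqint g -> sqint (fun x => f x - g x).
Proof. by move=> hf /sqintN; exact: sqintD. Qed.

Lemma integral_sqrD f g (t : R) : sqint f -> sqint g ->
  \int[P]_x ((f x + t * g x) ^+ 2) =
  l2 f ^+ 2 + 2 * t * (\int[P]_x (f x * g x)) + t ^+ 2 * l2 g ^+ 2.
Proof.
move=> hf hg; have hfg := sqint_mul hf hg; rewrite !sqr_l2.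
rewrite -[2 * t * _]RintegralZl// -[t ^+ 2 * _]RintegralZl//; last exact: hg.2.
rewrite -RintegralD//; [|exact: hf.2|exact: RintegrableZ].
rewrite -RintegralD//; last 2 first.
- by apply: RintegrableD; [exact: hf.2|exact: RintegrableZ].
- by apply: RintegrableZ; exact: hg.2.
by apply: eq_Rintegral => x _; ring.
Qed.

Lemma l2_CauchySchwarz f g : sqint f -> sqint g -> `|\int[P]_x (f x * g x)| <= l2 f * l2 g.
Proof.
move=> hf hg; rewrite -ler_sqr ?nnegrE ?mulr_ge0 ?l2_ge0//.
rewrite exprMn real_normK ?num_real//; apply: discriminant_le; first exact: sqr_ge0.
move=> t; rewrite -integral_sqrD//; apply: Rintegral_ge0 => x _; exact: sqr_ge0.
Qed.

Lemma l2D f g : sqint f -> sqint g -> l2 (fun x => f x + g x) <= l2 f + l2 g.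
Proof.
move=> hf hg; rewrite -ler_sqr ?nnegrE ?addr_ge0 ?l2_ge0//.
rewrite [leLHS]sqr_l2.
have := integral_sqrD 1 hf hg; under eq_Rintegral do rewrite mul1r; move=> ->.
have := l2_CauchySchwarz hf hg; rewrite ler_norml => /andP[_]; nra.
Qed.

Lemma l2Z (k : R) f : sqint f -> l2 (fun x => k * f x) = `|k| * l2 f.
Proof.
move=> hf; rewrite /l2 -sqrtr_sqr -sqrtrM ?sqr_ge0// -RintegralZl//; last exact: hf.2.
by congr Num.sqrt; apply: eq_Rintegral => x _; rewrite exprMn.
Qed.

Lemma l2N f : l2 (fun x => - f x) = l2 f.
Proof. by congr Num.sqrt; apply: eq_Rintegral => x _; rewrite sqrrN. Qed.

Lemma l2B f g : sqint f -> sqint g -> l2 (fun x => f x - g x) <= l2 f + l2 g.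
Proof. by move=> hf hg; rewrite -(l2N g); apply: l2D => //; exact: sqintN. Qed.

Lemma l2_cst (k : R) : l2 (cst k) = `|k|.
Proof. by rewrite /l2 (Rintegral_cst_prob P (k ^+ 2)) sqrtr_sqr. Qed.

Lemma mean_le_l2 f : sqint f -> `|\int[P]_x f x| <= l2 f.
Proof.
move=> hf; have := l2_CauchySchwarz hf (sqint_cst 1).
by rewrite l2_cst normr1 mulr1; under eq_Rintegral do rewrite /= mulr1.
Qed.

Lemma sqint_abs f : sqint f -> sqint (fun x => `|f x|).
Proof.
move=> [mf f2]; split; first exact: measurableT_comp.
by move: f2; congr (P.-integrable _ (EFin \o _)); apply/funext => x; rewrite real_normK// num_real.
Qed.

Lemma l2_abs f : l2 (fun x => `|f x|) = l2 f.
Proof. by congr Num.sqrt; apply: eq_Rintegral => x _; rewrite real_normK// num_real. Qed.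

Lemma abs_mean_le_l2 f : sqint f -> \int[P]_x `|f x| <= l2 f.
Proof.
move=> /sqint_abs /mean_le_l2; rewrite l2_abs; apply: le_trans; exact: ler_norm.
Qed.

Lemma l2_center f : sqint f ->
  l2 (fun x => f x - \int[P]_y f y) ^+ 2 = \int[P]_x (f x ^+ 2) - (\int[P]_x f x) ^+ 2.
Proof.
move=> hf; set m := \int[P]_x f x.
rewrite sqr_l2; have := integral_sqrD (- m) hf (sqint_cst 1).
rewrite l2_cst normr1 expr1n; under eq_Rintegral do rewrite /= mulr1.
under [in X in _ = X -> _]eq_Rintegral do rewrite /= mulr1.
by rewrite -/m sqr_l2 => ->; ring.
Qed.

Lemma ae_eq_Rintegral f g : measurable_fun setT f -> measurable_fun setT g ->
  {ae P, forall x, f x = g x} -> \int[P]_x f x = \int[P]_x g x.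
Proof.
move=> mf mg fg; rewrite /Rintegral; congr fine; apply: ae_eq_integral => //; [exact/measurable_EFinP|exact/measurable_EFinP|].
by apply: filterS fg => x /= ->.
Qed.

Lemma l2_ae_eq f g : measurable_fun setT f -> measurable_fun setT g ->
  {ae P, forall x, f x = g x} -> l2 f = l2 g.
Proof.
move=> mf mg fg; congr Num.sqrt; apply: ae_eq_Rintegral; try exact: measurable_funX.
by apply: filterS fg => x ->.
Qed.

Lemma sqint_ae_eq f g : sqint f -> measurable_fun setT g ->
  {ae P, forall x, f x = g x} -> sqint g.
Proof.
move=> [mf f2] mg fg; split => //.
have /integrableP[m2 i2] := f2; apply/integrableP; split.
  by apply/measurable_EFinP; exact: measurable_funX.
rewrite (ae_eq_integral (fun x => `|(f x ^+ 2)%:E|%E))//.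
- by apply: measurableT_comp => //; apply/measurable_EFinP; exact: measurable_funX.
- exact: measurableT_comp.
- by apply: filterS fg => x /= ->.
Qed.

Lemma l2_eq0 f : sqint f -> l2 f = 0 -> {ae P, forall x, f x = 0}.
Proof.
move=> hf l0; have : (\int[P]_x `|(f x ^+ 2)%:E| = 0)%E.
  rewrite (eq_integral (fun x => (f x ^+ 2)%:E)); last first.
    by move=> x _; rewrite gee0_abs// lee_fin sqr_ge0.
  have := sqr_l2 f; rewrite l0 expr0n /= /Rintegral => h.
  by rewrite -[LHS]fineK; [rewrite -h|exact: integrable_fin_num hf.2].
move=> /(ae_eq_integral_abs _ measurableT (f := fun x => (f x ^+ 2)%:E)) h.
have {}h := h (measurable_int _ hf.2).
apply: filterS h => x /(_ I) [] /eqP; by rewrite sqrf_eq0 => /eqP.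
Qed.

Lemma Lfun_sqint f : f \in Lfun P 2%:E <-> sqint f.
Proof.
split=> [hf|[mf f2]].
  split; last exact: Lfun2_integrable_sqr.
  by move: hf; rewrite inE => /andP[]; rewrite inE.
rewrite inE; apply/andP; split; rewrite inE//= /finite_norm unlock.
rewrite poweR_lty//; have /integrableP[_] := f2.
apply: le_lt_trans; rewrite le_eqVlt; apply/orP; left; apply/eqP.
by apply: eq_integral => x _ /=; rewrite powR_mulrn// normrX.
Qed.

Lemma L2norm_l2 f : sqint f -> fine ('N[P]_2%:E [EFin \o f])%E = l2 f.
Proof.
move=> [mf f2]; rewrite unlock /l2 /Rintegral.
have -> : (\int[P]_x `|(EFin \o f) x| `^ 2 = \int[P]_x (f x ^+ 2)%:E)%E.
  by apply: eq_integral => x _ /=; rewrite powR_mulrn// real_normK// num_real.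
have := integrable_fin_num measurableT f2; rewrite /comp => /fineK <-.
rewrite poweR12_sqrt ?lee_fin//.
by apply: fine_ge0; apply: integral_ge0 => x _; rewrite lee_fin sqr_ge0.
Qed.

End square_integrable.

(** * Almost sure and L^2 limits of fast Cauchy sequences *)

Section limits_of_integrals.
Context d (T : measurableType d) {R : realType}.
Variable P : probability T R.
Implicit Types (u : nat -> T -> R) (f g : T -> R).

Lemma fatou_le u f (K : R) : (forall n, measurable_fun setT (u n)) ->
  measurable_fun setT f -> (forall n x, 0 <= u n x) -> (forall x, 0 <= f x) ->
  {ae P, forall x, u ^~ x @ \oo --> f x} ->
  (forall n, P.-integrable setT (EFin \o u n)) ->
  (\forall n \near \oo, \int[P]_x u n x <= K) ->
  P.-integrable setT (EFin \o f) /\ \int[P]_x f x <= K.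
Proof.
move=> mu mf u0 f0 uf ui [N _ uK].
have h : (\int[P]_x (f x)%:E <= K%:E)%E.
  (* The shift by [N] discards the indices at which the bound [K] may fail. *)
  have mue n : measurable_fun setT (fun x => (u (n + N)%N x)%:E) by exact/measurable_EFinP.
  have := @fatou _ _ _ P setT measurableT (fun n x => (u (n + N)%N x)%:E) mue (fun n x _ => u0 _ _).
  rewrite (@ae_eq_integral _ _ _ P setT (fun x => (f x)%:E)) => //.
  - move=> /le_trans; apply; rewrite limn_einf_lim; apply: lime_le; first exact: is_cvg_einfs.
    apply: nearW => n; apply: (@le_trans _ _ (\int[P]_x (u (n + N)%N x)%:E)%E).
      by apply: ereal_inf_lbound; exists n => /=.
    have := integrable_fin_num measurableT (ui (n + N)%N); rewrite /comp => /fineK <-.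
    by rewrite lee_fin; apply: uK; rewrite /= leq_addl.
  - have -> : (fun x => limn_einf (fun n => (u (n + N)%N x)%:E)) =
        (fun x => - limn_esup (-%E \o (fun n => (u (n + N)%N x)%:E)))%E.
      by apply/funext => x; rewrite limn_esupN oppeK.
    apply: measurableT_comp => //; apply: measurable_fun_limn_esup => n.
    exact: measurableT_comp.
  - exact/measurable_EFinP.
  - apply: filterS uf => x hx _.
    have : (fun n => (u (n + N)%N x)%:E) @ \oo --> (f x)%:E.
      by apply: cvg_EFin; [exact: nearW|rewrite (cvg_shiftn N (u ^~ x))].
    by move=> /cvg_limn_einf_sup[].
have fi : P.-integrable setT (EFin \o f).
  apply/integrableP; split; first exact/measurable_EFinP.
  under eq_integral do rewrite /= ger0_norm//.
  by rewrite (le_lt_trans h)// ltry.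
split => //; rewrite -lee_fin /Rintegral fineK//.
exact: (integrable_fin_num measurableT fi).
Qed.

(** A measurable, everywhere defined limit: the upper limit made real, equal to the limit wherever
    the sequence converges. It does not refer to [P], so one function can serve several measures. *)
Definition mlim u (x : T) : R := fine (limn_esup (fun n => (u n x)%:E)).

Lemma measurable_mlim u : (forall n, measurable_fun setT (u n)) ->
  measurable_fun setT (mlim u).
Proof.
move=> mu; apply: (@measurableT_comp _ _ _ _ _ _ fine) => //.
by apply: measurable_fun_limn_esup => n; apply/measurable_EFinP.
Qed.

Lemma mlimE u x l : u ^~ x @ \oo --> l -> mlim u x = l.
Proof.
move=> h; have : (fun n => (u n x)%:E) @ \oo --> l%:E by apply: cvg_EFin => //; exact: nearW.
by move=> /cvg_limn_einf_sup[_]; rewrite /mlim => ->.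
Qed.

Lemma geometric_bound (K : R) n : 0 <= K -> \sum_(0 <= i < n) K * 2^-1 ^+ i <= 2 * K.
Proof.
move=> K0; have e : \sum_(0 <= i < n) K * 2^-1 ^+ i = 2 * K * (1 - 2^-1 ^+ n).
  elim: n => [|n ih]; first by rewrite big_geq// expr0; ring.
  by rewrite big_nat_recr//= ih exprS; field.
rewrite e ler_piMr// ?mulr_ge0// gerBl exprn_ge0//.
Qed.

(** The L^2 norms dominate the L^1 norms, so the sum of the |u_(n+1) - u_n| has finite integral; it
    is therefore finite almost everywhere. *)
Lemma ae_cvg_geometric u (K : R) : 0 <= K -> (forall n, sqint P (u n)) ->
  (forall n, l2 P (fun x => u n.+1 x - u n x) <= K * 2^-1 ^+ n) ->
  {ae P, forall x, u ^~ x @ \oo --> mlim u x}.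
Proof.
move=> K0 hu hd.
pose D n x : R := `|u n.+1 x - u n x|.
have hD n : sqint P (D n) by apply: sqint_abs; exact: sqintB.
have mD n : measurable_fun setT (fun x => (D n x)%:E) by apply/measurable_EFinP; exact: (hD n).1.
have D0 n x : (0 <= (D n x)%:E)%E by rewrite lee_fin normr_ge0.
have iD n : (\int[P]_x (D n x)%:E <= (K * 2^-1 ^+ n)%:E)%E.
  have := integrable_fin_num measurableT (sqint_integrable (hD n)); rewrite /comp => /fineK <-.
  rewrite lee_fin; apply: le_trans (hd n); apply: abs_mean_le_l2; exact: sqintB.
have sD : (\int[P]_x (\sum_(0 <= n <oo) (D n x)%:E) < +oo)%E.
  rewrite integral_nneseries//.
  apply: (@le_lt_trans _ _ (2 * K)%:E); last by rewrite ltry.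
  apply: lime_le; first by apply: is_cvg_nneseries => n _ _; exact: integral_ge0.
  apply: nearW => n; apply: (@le_trans _ _ (\sum_(0 <= i < n) (K * 2^-1 ^+ i)%:E)%E).
    by apply: lee_sum => i _.
  by rewrite sumEFin lee_fin geometric_bound.
have mS : measurable_fun setT (fun x => (\sum_(0 <= n <oo) (D n x)%:E)%E).
  exact: ge0_emeasurable_sum.
have iS : P.-integrable setT (fun x => (\sum_(0 <= n <oo) (D n x)%:E)%E).
  apply/integrableP; split => //.
  by under eq_integral do rewrite gee0_abs ?nneseries_ge0//.
apply: filterS (integrable_ae measurableT iS) => x /(_ I) fx.
have cD : cvgn (series (fun n => D n x)).
  apply: nondecreasing_is_cvgn.
    by apply: nondecreasing_series => n _ _; exact: normr_ge0.
  exists (fine (\sum_(0 <= n <oo) (D n x)%:E)%E) => _ [n _ <-].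
  rewrite -lee_fin fineK// /series /= -sumEFin; apply: nneseries_lim_ge => i _ _.
  exact: D0.
have cu : cvgn (u ^~ x).
  have : cvgn (series (fun n => u n.+1 x - u n x)) by exact: normed_cvg.
  have -> : series (fun n => u n.+1 x - u n x) = (fun n => u n x - u 0%N x).
    by apply/funext => n; rewrite /series /= telescope_sumr.
  move=> /(is_cvgD (is_cvg_cst (u 0%N x))).
  by rewrite (_ : _ + _ = u ^~ x)//; apply/funext => n; rewrite fctE addrC subrK.
have /cvg_ex[l ul] := cu.
by rewrite (mlimE ul).
Qed.

Lemma l2_telescope u (K : R) n m : 0 <= K -> (forall n, sqint P (u n)) ->
  (forall n, l2 P (fun x => u n.+1 x - u n x) <= K * 2^-1 ^+ n) ->
  l2 P (fun x => u (n + m)%N x - u n x) <= 2 * K * 2^-1 ^+ n.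
Proof.
move=> K0 hu hd.
suff : l2 P (fun x => u (n + m)%N x - u n x) <= \sum_(0 <= i < m) (K * 2^-1 ^+ n) * 2^-1 ^+ i.
  move=> /le_trans; apply; rewrite -mulrA; apply: geometric_bound.
  by rewrite mulr_ge0// exprn_ge0.
elim: m => [|m ih].
  rewrite big_geq// addn0; under [X in l2 P X]eq_fun do rewrite subrr.
  by rewrite (l2_cst P 0) normr0.
rewrite big_nat_recr//= addrC.
have -> : (fun x => u (n + m.+1)%N x - u n x) =
    (fun x => (u (n + m).+1 x - u (n + m)%N x) + (u (n + m)%N x - u n x)).
  by apply/funext => x; rewrite addnS; ring.
apply: le_trans (l2D _ _) _; [exact: sqintB|exact: sqintB|].
by apply: lerD => //; rewrite -mulrA -exprD.
Qed.

(** Fatou in [m] for the squares of [u (n + m) - u n], whose norms are bounded by telescoping. *)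
Lemma mlim_l2 u (K : R) : 0 <= K -> (forall n, sqint P (u n)) ->
  (forall n, l2 P (fun x => u n.+1 x - u n x) <= K * 2^-1 ^+ n) ->
  sqint P (mlim u) /\ forall n, l2 P (fun x => mlim u x - u n x) <= 2 * K * 2^-1 ^+ n.
Proof.
move=> K0 hu hd; have ul := ae_cvg_geometric K0 hu hd.
have mm : measurable_fun setT (mlim u) by apply: measurable_mlim => n; exact: (hu n).1.
have h n : sqint P (fun x => mlim u x - u n x) /\ l2 P (fun x => mlim u x - u n x) <= 2 * K * 2^-1 ^+ n.
  have B0 : 0 <= 2 * K * 2^-1 ^+ n by rewrite !mulr_ge0// exprn_ge0.
  have [] := @fatou_le (fun m x => (u (n + m)%N x - u n x) ^+ 2) (fun x => (mlim u x - u n x) ^+ 2)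
    ((2 * K * 2^-1 ^+ n) ^+ 2).
  - by move=> m; exact/measurable_funX/(sqintB (hu _) (hu _)).1.
  - by apply/measurable_funX/measurable_funB => //; exact: (hu n).1.
  - by move=> m x; exact: sqr_ge0.
  - by move=> x; exact: sqr_ge0.
  - apply: filterS ul => x hx.
    have h1 : (fun m => u (n + m)%N x - u n x) @ \oo --> mlim u x - u n x.
      apply: cvgB; last exact: cvg_cst.
      rewrite (_ : (fun m => u (n + m)%N x) = (fun m => u (m + n)%N x)); last first.
        by apply/funext => m; rewrite addnC.
      by rewrite (cvg_shiftn n (u ^~ x)).
    by rewrite expr2; under eq_fun do rewrite expr2; exact: cvgM.
  - by move=> m; exact: (sqintB (hu _) (hu _)).2.
  - apply: nearW => m; rewrite -sqr_l2 ler_sqr ?nnegrE ?l2_ge0//; exact: l2_telescope.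
  move=> i2 le2; split.
    by split => //; apply: measurable_funB => //; exact: (hu n).1.
  by rewrite -ler_sqr ?nnegrE ?l2_ge0// sqr_l2.
split => [|n]; last exact: (h n).2.
have := sqintD (h 0%N).1 (hu 0%N); congr sqint.
by apply/funext => x; rewrite subrK.
Qed.

End limits_of_integrals.

(** * Log-densities and trigonometric polynomials *)

Section log_densities.
Context d (T : measurableType d) {R : realType}.
Implicit Types (P Q W : probability T R) (f g : T -> R).

(** The density is an exponential, hence never zero: [P] and [Q] are then equivalent, exponents add
    along a chain of measures and change sign when the two measures are exchanged. *)
Definition is_log_density P Q f := measurable_fun setT f /\
  forall A, measurable A -> Q A = (\int[P]_(x in A) (expR (f x))%:E)%E.

Lemma measurable_expR_comp f : measurable_fun setT f ->
  measurable_fun setT (fun x => expR (f x)).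
Proof. by move=> mf; exact: measurableT_comp. Qed.

Lemma log_density_ge0_integral P Q f (g : T -> \bar R) : is_log_density P Q f ->
  measurable_fun setT g -> (forall x, (0 <= g x)%E) ->
  (\int[Q]_x g x = \int[P]_x (g x * (expR (f x))%:E))%E.
Proof.
move=> [mf QE] mg g0.
exact: (ge0_integral_density (measurable_expR_comp mf) QE).
Qed.

Lemma log_density_integrable P Q f g : is_log_density P Q f -> measurable_fun setT g ->
  Q.-integrable setT (EFin \o g) <->
  P.-integrable setT (EFin \o (fun x => g x * expR (f x))).
Proof.
move=> [mf QE] mg; exact: (integrable_density (measurable_expR_comp mf) (fun x => expR_ge0 (f x)) QE).
Qed.

Lemma log_density_Rintegral P Q f g : is_log_density P Q f -> measurable_fun setT g ->
  \int[Q]_x g x = \int[P]_x (g x * expR (f x)).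
Proof.
move=> [mf QE] mg; exact: (Rintegral_density (measurable_expR_comp mf) (fun x => expR_ge0 (f x)) QE).
Qed.

Lemma log_density_dominates P Q f : is_log_density P Q f -> Q `<< P.
Proof.
move=> [mf QE]; apply/null_content_dominatesP => A mA PA; rewrite QE//.
apply: null_set_integral => //; apply/measurable_funTS/measurable_EFinP.
exact: measurable_expR_comp.
Qed.

Lemma log_density_trans P Q W f g : is_log_density P Q f -> is_log_density Q W g ->
  is_log_density P W (fun x => f x + g x).
Proof.
move=> dPQ [mg WE]; have [mf QE] := dPQ; split; first exact: measurable_funD.
move=> A mA; rewrite WE// integral_mkcond (log_density_ge0_integral dPQ).
- rewrite [RHS]integral_mkcond; apply: eq_integral => x _; rewrite !patchE.
  case: ifP => _; last by rewrite mul0e.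
  by rewrite -EFinM -expRD addrC.
- apply/(measurable_restrictT _ mA)/measurable_funTS/measurable_EFinP.
  exact: measurable_expR_comp.
- by move=> x; rewrite patchE; case: ifP => _ //; rewrite lee_fin expR_ge0.
Qed.

Lemma log_density_sym P Q f : is_log_density P Q f -> is_log_density Q P (fun x => - f x).
Proof.
move=> dPQ; have [mf QE] := dPQ.
have mNf : measurable_fun setT (fun x => - f x) by exact: measurableT_comp.
split => // A mA; rewrite integral_mkcond (log_density_ge0_integral dPQ).
- transitivity (\int[P]_x (\1_A x)%:E)%E; first by rewrite integral_indic// setIT.
  apply: eq_integral => x _; rewrite patchE indicE; case: ifP => _; last by rewrite mul0e.
  by rewrite -EFinM -expRD addNr expR0.
- apply/(measurable_restrictT _ mA)/measurable_funTS/measurable_EFinP.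
  exact: measurable_expR_comp.
- by move=> x; rewrite patchE; case: ifP => _ //; rewrite lee_fin expR_ge0.
Qed.

Lemma log_density_refl P : is_log_density P P (fun=> 0).
Proof.
split => // A mA; rewrite expR0 integral_cst// mul1e//.
Qed.

Lemma log_density_eq P Q f g : is_log_density P Q f -> f =1 g -> is_log_density P Q g.
Proof. by move=> + fg; suff -> : f = g by []; apply/funext. Qed.

Lemma log_density_expR_integrable P Q f : is_log_density P Q f ->
  P.-integrable setT (EFin \o (fun x => expR (f x))).
Proof.
move=> [mf QE]; apply/integrableP; split; first exact/measurable_EFinP/measurable_expR_comp.
under eq_integral do rewrite /= ger0_norm ?expR_ge0//.
by rewrite -QE// (le_lt_trans (probability_le1 _ _))// ltry.
Qed.

(** Jensen's inequality in the form 1 + f <= exp f, integrated against [P], where exp f has integral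
    1. *)
Lemma log_density_mean_le0 P Q f : is_log_density P Q f ->
  P.-integrable setT (EFin \o f) -> \int[P]_x f x <= 0.
Proof.
move=> [mf QE] fi.
have ie := log_density_expR_integrable (conj mf QE).
have e1 : \int[P]_x expR (f x) = 1.
  rewrite /Rintegral -QE//; have := @probability_setT _ _ _ Q.
  by rewrite /= => ->.
have i1 : P.-integrable setT (EFin \o (fun x => 1 + f x)).
  by apply: RintegrableD => //; exact: finite_measure_integrable_cst.
have : \int[P]_x (1 + f x) <= \int[P]_x expR (f x).
  by apply: le_Rintegral => // x _; exact: expR_ge1Dx.
rewrite RintegralD//; last exact: finite_measure_integrable_cst.
by rewrite e1 Rintegral_cst_prob gerDl.
Qed.

End log_densities.

Section density_measure.
Context d (T : measurableType d) {R : realType}.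
Variables (mu : {measure set T -> \bar R}) (f : T -> R).
Hypothesis mf : measurable_fun setT f.

Definition exp_density_measure of measurable_fun setT f :=
  fun A => (\int[mu]_(x in A) (expR (f x))%:E)%E.

Local Notation nu := (exp_density_measure mf).

Let nu0 : nu set0 = 0%E.
Proof. by rewrite /exp_density_measure integral_set0. Qed.

Let nu_ge0 A : (0 <= nu A)%E.
Proof. by apply: integral_ge0 => x _; rewrite lee_fin expR_ge0. Qed.

Let nu_sigma_additive : semi_sigma_additive nu.
Proof.
move=> /= F mF tF mUF; rewrite /exp_density_measure ge0_integral_bigcup//; last first.
  by apply/measurable_funTS/measurable_EFinP; exact: measurable_expR_comp.
by apply: is_cvg_ereal_nneg_natsum_cond => n _ _; exact: nu_ge0.
Qed.

HB.instance Definition _ := isMeasure.Build _ _ _ nu nu0 nu_ge0 nu_sigma_additive.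

End density_measure.

(** * Trigonometric polynomials determine finite Borel measures *)

Section trigonometric_polynomials.
Context {R : realType} {H : hilbertType R}.
Implicit Types (g : H -> R) (l : seq (R * H * R)).

(** Entries are coefficient, frequency, phase. With phases, cosines alone span an algebra:
    product-to-sum formulas give cosines again. *)
Definition trig l (x : H) : R := \sum_(p <- l) p.1.1 * cos ('<<x, p.1.2>> + p.2).

Definition is_trig g := exists l, g =1 trig l.

Lemma is_trig_ext g g' : is_trig g -> g =1 g' -> is_trig g'.
Proof. by move=> [l gl] gg'; exists l => x; rewrite -gg'. Qed.

Lemma is_trig_cos h c : is_trig (fun x => cos ('<<x, h>> + c)).
Proof. by exists [:: (1, h, c)] => x; rewrite /trig big_seq1 mul1r. Qed.

Lemma is_trigD g g' : is_trig g -> is_trig g' -> is_trig (fun x => g x + g' x).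
Proof.
by move=> [l gl] [l' gl']; exists (l ++ l') => x; rewrite gl gl' /trig big_cat.
Qed.

Lemma is_trigZ (a : R) g : is_trig g -> is_trig (fun x => a * g x).
Proof.
move=> [l gl]; exists [seq (a * p.1.1, p.1.2, p.2) | p <- l] => x.
by rewrite gl /trig big_map mulr_sumr; apply: eq_bigr => p _ /=; rewrite mulrA.
Qed.

Lemma is_trig_cst (a : R) : is_trig (fun=> a).
Proof.
apply: is_trig_ext (is_trigZ a (is_trig_cos 0 0)) _ => x.
by rewrite hdot0r addr0 cos0 mulr1.
Qed.

Lemma is_trig_sum I (r : seq I) (F : I -> H -> R) : (forall i, is_trig (F i)) ->
  is_trig (fun x => \sum_(i <- r) F i x).
Proof.
move=> hF; elim: r => [|i r ih].
  by apply: is_trig_ext (is_trig_cst 0) _ => x; rewrite big_nil.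
by apply: is_trig_ext (is_trigD (hF i) ih) _ => x; rewrite big_cons.
Qed.

Lemma is_trigM g g' : is_trig g -> is_trig g' -> is_trig (fun x => g x * g' x).
Proof.
move=> [l gl] [l' gl'].
apply: (@is_trig_ext (fun x => \sum_(p <- l) \sum_(q <- l') (p.1.1 * q.1.1 * 2^-1) *
   (cos ('<<x, p.1.2 + q.1.2>> + (p.2 + q.2)) + cos ('<<x, p.1.2 - q.1.2>> + (p.2 - q.2))))).
  apply: is_trig_sum => p; apply: is_trig_sum => q; apply: is_trigZ.
  by apply: is_trigD; exact: is_trig_cos.
move=> x; rewrite gl gl' /trig mulr_suml; apply: eq_bigr => p _.
rewrite mulr_sumr; apply: eq_bigr => q _.
rewrite hdotDr hdotBr.
set a := '<<x, p.1.2>>; set b := '<<x, q.1.2>>.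
rewrite (_ : a + b + _ = (a + p.2) + (b + q.2)); last by ring.
rewrite (_ : a - b + _ = (a + p.2) - (b + q.2)); last by ring.
rewrite cosD cosB; by field.
Qed.

Lemma is_trigX g n : is_trig g -> is_trig (fun x => g x ^+ n).
Proof.
move=> tg; elim: n => [|n ih].
  by apply: is_trig_ext (is_trig_cst 1) _ => x; rewrite expr0.
by apply: is_trig_ext (is_trigM tg ih) _ => x; rewrite exprS.
Qed.

End trigonometric_polynomials.

Section bernoulli_cutoff.
Context {R : realType}.

(** Polynomials tending to the indicator of t < 1/2 on [0, 1], as in elementary proofs of the
    Stone-Weierstrass theorem. The exponent n 2^n makes n (2 t)^n appear in Bernoulli's inequality;
    it tends to 0 for t < 1/2 and is at least n otherwise. *)
Definition cutoff (n : nat) (t : R) : R := (1 - t ^+ n) ^+ (n * 2 ^ n).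

Lemma cutoff01 n t : 0 <= t <= 1 -> 0 <= cutoff n t <= 1.
Proof.
move=> /andP[t0 t1]; have h : 0 <= 1 - t ^+ n <= 1.
  by rewrite subr_ge0 exprn_ile1//= gerBl exprn_ge0.
move: h => /andP[h0 h1]; rewrite /cutoff exprn_ge0//= exprn_ile1//.
Qed.

Lemma bernoulli_ge (a : R) m : -1 <= a -> 1 + m%:R * a <= (1 + a) ^+ m.
Proof.
move=> a1; elim: m => [|m ih]; first by rewrite mul0r addr0 expr0.
rewrite exprS; apply: (@le_trans _ _ ((1 + a) * (1 + m%:R * a))).
  have : 0 <= m%:R * a ^+ 2 :> R by rewrite mulr_ge0 ?sqr_ge0.
  rewrite -natr1; nra.
by rewrite ler_wpM2l//; lra.
Qed.

Lemma nat_geometric_cvg0 (r : R) : 0 <= r < 1 -> (fun n => n%:R * r ^+ n) @ \oo --> (0 : R).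
Proof.
move=> /andP[r0 r1].
have [->|rN0] := eqVneq r 0.
  apply: (@cvg_trans _ ((fun=> 0 : R) @ \oo)); last exact: cvg_cst.
  apply: near_eq_cvg; near=> n.
  by rewrite expr0n gtn_eqF ?mulr0//; near: n; exists 1%N.
(* n r^n = (n q^n) q^n, and n q^n is bounded by Bernoulli's inequality for 1 / q. *)
pose q := Num.sqrt r.
have q0 : 0 < q by rewrite sqrtr_gt0 lt_neqAle eq_sym rN0.
have qq : r = q * q by rewrite -expr2 sqr_sqrtr.
have q1 : q < 1 by nra.
have nq n : n%:R * q ^+ n <= q / (1 - q).
  have qn : 0 < q ^+ n by rewrite exprn_gt0.
  have h : -1 <= q^-1 - 1 by rewrite lerBrDr addNr invr_ge0 ltW.
  have := bernoulli_ge n h; rewrite [1 + (_ - _)]addrC subrK exprVn => {}h.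
  have : n%:R * (q^-1 - 1) <= (q ^+ n)^-1 by lra.
  rewrite -(ler_pM2r qn) mulVf ?gt_eqF// => {}h.
  rewrite ler_pdivlMr ?subr_gt0//.
  have : q * (n%:R * (q^-1 - 1) * q ^+ n) <= q * 1 by rewrite ler_pM2l.
  by rewrite mulr1; apply: le_trans; rewrite le_eqVlt; apply/orP; left; apply/eqP; field; rewrite gt_eqF.
have : (fun n => q / (1 - q) * q ^+ n) @ \oo --> (q / (1 - q) * 0 : R).
  by apply: cvgMr; apply: cvg_expr; rewrite ger0_norm// ltW.
rewrite mulr0; apply: (@squeeze_cvgr _ _ _ _ (fun=> 0)); last exact: cvg_cst.
apply: nearW => n; rewrite mulr_ge0 ?exprn_ge0//= qq exprMn mulrA.
by rewrite ler_wpM2r ?exprn_ge0 ?(ltW q0).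
Unshelve. all: by end_near. Qed.

Lemma cutoff_cvg (t : R) : 0 <= t <= 1 ->
  (fun n => cutoff n t) @ \oo --> (if t < 2^-1 then 1 else 0 : R).
Proof.
move=> /andP[t0 t1]; case: ifPn => [t2|].
  have h : (fun n => 1 - n%:R * (2 * t) ^+ n) @ \oo --> (1 - 0 : R).
    apply: cvgB; first exact: cvg_cst.
    by apply: nat_geometric_cvg0; apply/andP; split; lra.
  rewrite subr0 in h; apply: squeeze_cvgr h (cvg_cst (1 : R)); apply: nearW => n.
  have /andP[_ ->] : 0 <= cutoff n t <= 1 by apply: cutoff01; rewrite t0.
  rewrite andbT /cutoff; apply: le_trans (bernoulli_ge _ _).
    by rewrite exprMn natrM natrX mulrN mulrA.
  by rewrite lerN2 exprn_ile1.
rewrite -leNgt => t2.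
have h : (fun n : nat => n.+1%:R^-1 : R) @ \oo --> (0 : R) by exact: cvg_harmonic.
apply: squeeze_cvgr (cvg_cst (0 : R)) h; apply: nearW => n.
have /andP[-> _] : 0 <= cutoff n t <= 1 by apply: cutoff01; rewrite t0.
rewrite /= /cutoff; set m := (n * 2 ^ n)%N.
have tn0 : 0 <= t ^+ n by rewrite exprn_ge0.
have tn1 : t ^+ n <= 1 by rewrite exprn_ile1.
(* Since (1 - t^n)^m (1 + t^n)^m <= 1, it suffices that the second factor is at least 1 + n (2 t)^n
   >= n + 1. *)
have hb : n.+1%:R <= (1 + t ^+ n) ^+ m.
  apply: le_trans (bernoulli_ge _ _); last by lra.
  rewrite -natr1 addrC lerD2l /m natrM natrX -mulrA -exprMn ler_peMr//.
  by rewrite exprn_ege1//; lra.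
have : (1 - t ^+ n) ^+ m * (1 + t ^+ n) ^+ m <= 1.
  rewrite -exprMn exprn_ile1//; nra.
move=> h1; rewrite -[n.+1%:R^-1]mul1r ler_pdivlMr//; apply: le_trans h1.
by rewrite ler_wpM2l// exprn_ge0// subr_ge0.
Qed.

End bernoulli_cutoff.

Lemma sin_scaled_cvg {R : realType} (x : R) :
  (fun n : nat => n.+1%:R * sin (x * n.+1%:R^-1)) @ \oo --> x.
Proof.
have hd : is_derive (0 : R) 1 (fun t => sin (x * t + 0)) (x * cos (x * 0 + 0)).
  exact: is_derive_affine_comp.
have [dd dv] := hd.
have h0 : (fun n : nat => n.+1%:R^-1 : R) @ \oo --> (0 : R)^'.
  move=> A hA.
  have h1 : \forall n \near \oo, (n.+1%:R^-1 : R) != 0 -> A n.+1%:R^-1 := @cvg_harmonic R _ hA.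
  by apply: filterS h1 => n; apply; rewrite invr_neq0.
have := cvg_comp _ _ h0 dd; rewrite -[lim _]/(derive _ _ _) dv mulr0 addr0 cos0 mulr1.
move=> hc; have e : (fun n : nat => n.+1%:R * sin (x * n.+1%:R^-1)) =
   (fun h : R => h^-1 *: (((fun t => sin (x * t + 0)) \o shift 0) h%:A - sin 0)) \o (fun n : nat => n.+1%:R^-1).
  apply/funext => n /=.
  by rewrite !addr0 sin0 subr0 invrK -[_%:A]/(_ * 1) mulr1.
by rewrite e.
Qed.

Section borel_measurability.
Context {R : realType} {H : hilbertType R}.
Notation RM := (measurableTypeR R).
Implicit Types (g : H -> R).
Local Notation mfH g := (@measurable_fun _ _ (borel H) RM setT g).

Lemma continuous_borel g : continuous g -> mfH g.
Proof.
move=> /continuousP cg; apply: (measurability _ (RGenOpens.measurableE R)).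
move=> _ [_ [a [b ->]] <-]; rewrite setTI; apply: sub_sigma_algebra.
exact/cg/interval_open.
Qed.

Lemma measurable_hdot h : mfH (fun x => '<<x, h>>).
Proof. by apply: continuous_borel => x; exact: continuous_hdot. Qed.

Lemma measurable_cos_hdot h c : mfH (fun x => cos ('<<x, h>> + c)).
Proof.
apply: (@measurableT_comp _ _ _ (borel H) RM RM (fun t => cos (t + c))).
  apply: continuous_measurable_fun => x.
  apply: continuous_comp; last exact: continuous_cos.
  by apply: cvgD; [exact: cvg_id|exact: cvg_cst].
exact: measurable_hdot.
Qed.

Lemma measurable_trig g : is_trig g -> mfH g.
Proof.
move=> [l gl]; rewrite (_ : g = trig l); last exact/funext.
rewrite /trig; apply: (@measurable_sum _ (borel H)) => p.
by apply: measurable_funM => //; exact: measurable_cos_hdot.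
Qed.

Lemma is_trig_bounded g : is_trig g -> exists2 K : R, 0 <= K & forall x, `|g x| <= K.
Proof.
move=> [l gl]; exists (\sum_(p <- l) `|p.1.1|); first exact: sumr_ge0.
move=> x; rewrite gl /trig (le_trans (ler_norm_sum _ _ _))// ler_sum// => p _.
by rewrite normrM ler_piMr// cos_norm_le1.
Qed.

(** The pi-system for the uniqueness of measures: products of approximants approximate
    intersections, and values in [0, 1] allow dominated convergence. *)
Definition trig_approximable (A : set H) := exists g : nat -> H -> R,
  [/\ forall n, is_trig (g n), forall n x, 0 <= g n x <= 1 &
      forall x, (fun n => g n x) @ \oo --> (\1_A x : R)].

Lemma trig_approximable_setT : trig_approximable setT.
Proof.
exists (fun _ _ => 1); split => [n|n x|x]; first exact: is_trig_cst.
- by rewrite ler01 lexx.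
- by rewrite indicT; exact: cvg_cst.
Qed.

Lemma trig_approximableI : setI_closed trig_approximable.
Proof.
move=> A B [f [tf f01 fA]] [g [tg g01 gB]]; exists (fun n x => f n x * g n x); split.
- by move=> n; exact: is_trigM.
- move=> n x; have /andP[a0 a1] := f01 n x; have /andP[b0 b1] := g01 n x.
  by rewrite mulr_ge0//= mulr_ile1.
- by move=> x; rewrite indicI; apply: cvgM; [exact: fA|exact: gB].
Qed.

Lemma trig_approximable_lt g (c : R) : is_trig g -> trig_approximable [set x | g x < c].
Proof.
move=> tg; have [K K0 gK] := is_trig_bounded tg.
pose M := 2 * (K + `|c| + 1).
have M0 : 0 < M by rewrite /M; have := normr_ge0 c; lra.
(* This affine map sends the values of [g] into [0, 1] and the threshold [c] to 1/2, where the limit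
   of [cutoff] jumps. *)
pose f x := M^-1 * (g x - c) + 2^-1.
have tf : is_trig f.
  by apply: is_trigD; [apply: is_trigZ; apply: is_trigD => //|]; exact: is_trig_cst.
have f01 x : 0 <= f x <= 1.
  have : `|M^-1 * (g x - c)| <= 2^-1.
    rewrite normrM gtr0_norm ?invr_gt0// mulrC ler_pdivrMr//.
    by rewrite (le_trans (ler_normB _ _))// /M; have := gK x; lra.
  by rewrite ler_norml /f; lra.
exists (fun n x => cutoff n (f x)); split.
- move=> n; apply: is_trigX; apply: is_trig_ext (is_trigD (is_trig_cst 1) (is_trigZ (-1) (is_trigX n tf))) _ => x.
  by rewrite mulN1r.
- by move=> n x; exact: cutoff01.
- move=> x; have := cutoff_cvg (f01 x); rewrite indicE.
  suff -> : (f x < 2^-1) = (x \in [set x | g x < c]) by case: (_ \in _).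
  apply/idP/idP; rewrite inE /f /= -subr_gt0 => h.
    by rewrite -subr_gt0 -(pmulr_rgt0 _ (_ : 0 < M^-1)) ?invr_gt0//; lra.
  rewrite -subr_gt0; have : 0 < M^-1 * (c - g x) by rewrite mulr_gt0// invr_gt0.
  by lra.
Qed.

Hypothesis Hsep : separable H.
Hypothesis Hinf : infinite_dimensional H.

(* The open sets lie in the sigma-algebra generated by the sets whose indicator
   is a limit of trigonometric polynomials, because <<x, h>> is the limit of
   n sin(<<x, h>>/n) and |x - a|^2 is the limit of sums of squares of such. *)
Lemma open_trig_generated : @open H `<=` <<s trig_approximable >>.
Proof.
pose T' := g_sigma_algebraType trig_approximable.
have mtrig g : is_trig g -> @measurable_fun _ _ T' RM setT g.
  move=> tg; apply: (measurability _ (RGenInftyO.measurableE R)).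
  move=> _ [_ [c ->] <-]; rewrite setTI; apply: sub_sigma_algebra.
  rewrite (_ : _ @^-1` _ = [set x | g x < c]); first exact: trig_approximable_lt.
  by apply/seteqP; split => x /=; rewrite in_itv.
have mdot h : @measurable_fun _ _ T' RM setT (fun x => '<<x, h>>).
  apply: (@measurable_fun_cvg _ T' R setT
    (fun (n : nat) (x : H) => n.+1%:R * sin ('<<x, h>> * n.+1%:R^-1))).
    move=> n; apply: mtrig; apply: is_trigZ.
    apply: is_trig_ext (is_trig_cos (n.+1%:R^-1 *: h) (- (pi / 2))) _ => x.
    by rewrite -cosN opprD opprK addrC cosD cos_pihalf sin_pihalf mul0r mul1r sinN sub0r
      opprK hdotZr mulrC.
  by move=> x _; exact: sin_scaled_cvg.
have be := basisP Hsep Hinf.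
have mball a r : measurable ([set x | `|x - a| ^+ 2 < r] : set T').
  have mn : @measurable_fun _ _ T' RM setT (fun x => `|x - a| ^+ 2).
    apply: (@measurable_fun_cvg _ T' R setT
      (fun n x => series (fun i => '<<x - a, Defs.basis H i>> ^+ 2) n)).
      move=> n; rewrite /series /=; apply: (@measurable_sum _ T') => i.
      apply: measurable_funX.
      rewrite (_ : (fun x => _) = fun x => '<<x, Defs.basis H i>> - '<<a, Defs.basis H i>>).
        by apply: (@measurable_funB _ T') => //; exact: mdot.
      by apply/funext => x; rewrite hdotBl.
    by move=> x _; exact: parseval.
  have := mn measurableT `]-oo, r[%classic (measurable_itv _); rewrite setTI.
  by congr (measurable _); apply/seteqP; split => x /=; rewrite in_itv.
have [d dd] := separable_seq Hsep.
move=> U oU.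
rewrite -[_ U]/(measurable (U : set T')).
pose B n m := [set x : H | `|x - d n| ^+ 2 < (m.+1%:R^-1) ^+ 2].
rewrite (_ : U = \bigcup_n \bigcup_m (if `[< B n m `<=` U >] then B n m else set0)).
  apply: bigcupT_measurable => n; apply: bigcupT_measurable => m.
  by case: ifP => _ //; exact: mball.
apply/seteqP; split => [x Ux|x [n _ [m _]]]; last by case: asboolP => // h; exact: h.
have /nbhs_ballP[e /= e0 he] : nbhs x U by exact: open_nbhs_nbhs.
have [m me] : exists m : nat, m.+1%:R^-1 < e / 2.
  have [m _ hm] := near_infty_natSinv_lt (PosNum (divr_gt0 e0 (ltr0n _ 2))).
  by exists m; exact: (hm m (leqnn m)).
have m0 : 0 < m.+1%:R^-1 :> R by rewrite invr_gt0.
have [n hn] := dd x _ m0.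
exists n => //; exists m => //; case: asboolP => [_|[]].
  by rewrite /B /= ltr_sqr ?nnegrE// ltW.
move=> y; rewrite /B /= ltr_sqr ?nnegrE ?(ltW m0)// => hy; apply: he.
rewrite -ball_normE /= -(subrK (d n) x) -addrA (le_lt_trans (ler_normD _ _))//.
by rewrite (distrC (d n)) (splitr e); exact: ltrD (lt_trans hn me) (lt_trans hy me).
Qed.

Lemma borel_trig_generated (A : set (borel H)) : measurable A -> <<s trig_approximable >> A.
Proof.
apply: smallest_sub; first exact: smallest_sigma_algebra.
exact: open_trig_generated.
Qed.

Lemma trig_approximable_measurable : trig_approximable `<=` (@measurable _ (borel H)).
Proof.
move=> A [g [tg g01 gA]].
have mA : mfH (\1_A).
  apply: (@measurable_fun_cvg _ (borel H) R setT g); first by move=> n; exact: measurable_trig.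
  by move=> x _; exact: gA.
have := mA measurableT `]0, +oo[%classic (measurable_itv _); rewrite setTI.
congr (measurable _); apply/seteqP; split => x /=; rewrite in_itv /= andbT indicE.
  by case: (boolP (x \in A)) => [/set_mem//|_]; rewrite ltxx.
by move=> /mem_set ->; rewrite ltr01.
Qed.

Lemma finite_Rintegrable_bounded (m : {measure set (borel H) -> \bar R}) (g : H -> R) (K : R) :
  (m setT < +oo)%E -> mfH g -> (forall x, `|g x| <= K) -> m.-integrable setT (EFin \o g).
Proof.
move=> mfin mg gK; apply: (@Rintegrable_le _ (borel H) R m _ (cst K)) => //.
apply/integrableP; split; first exact/measurable_EFinP/measurable_cst.
have K0 : 0 <= K by exact: le_trans (gK 0).
under eq_integral do rewrite /= ger0_norm//.
by rewrite integral_cst// lte_mul_pinfty// lee_fin.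
Qed.

(** The integrals of all trigonometric polynomials agree by linearity, then the masses of the sets
    of [trig_approximable] by dominated convergence; uniqueness on a generating pi-system
    concludes. *)
Theorem trig_unique (m1 m2 : {measure set (borel H) -> \bar R}) :
  (m1 setT < +oo)%E -> (m2 setT < +oo)%E ->
  (forall h c, \int[m1]_x cos ('<<x, h>> + c) = \int[m2]_x cos ('<<x, h>> + c)) ->
  forall A, measurable A -> m1 A = m2 A.
Proof.
move=> fin1 fin2 hcos.
have itrig (m : {measure set (borel H) -> \bar R}) g : (m setT < +oo)%E -> is_trig g ->
    m.-integrable setT (EFin \o g).
  move=> fm tg; have [K K0 gK] := is_trig_bounded tg.
  by apply: finite_Rintegrable_bounded gK => //; exact: measurable_trig.
have htrig g : is_trig g -> \int[m1]_x g x = \int[m2]_x g x.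
  move=> [l gl]; rewrite (_ : g = trig l); last exact/funext.
  elim: l {g gl} => [|p l ih].
    by rewrite (_ : trig _ = cst 0) ?Rintegral_cst ?mul0r//; apply/funext => x; rewrite /trig big_nil.
  rewrite (_ : trig _ = fun x => p.1.1 * cos ('<<x, p.1.2>> + p.2) + trig l x); last first.
    by apply/funext => x; rewrite /trig big_cons.
  have h1 (m : {measure set (borel H) -> \bar R}) : (m setT < +oo)%E ->
      m.-integrable setT (EFin \o (fun x => cos ('<<x, p.1.2>> + p.2))).
    by move=> ?; apply: itrig => //; exact: is_trig_cos.
  have h2 (m : {measure set (borel H) -> \bar R}) : (m setT < +oo)%E ->
      m.-integrable setT (EFin \o trig l) by move=> ?; apply: itrig => //; exists l.
  rewrite [LHS]RintegralD//; [|by apply: RintegrableZ; exact: h1|exact: h2].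
  rewrite [RHS]RintegralD//; [|by apply: RintegrableZ; exact: h1|exact: h2].
  congr (_ + _); last exact: ih.
  by rewrite RintegralZl//; [rewrite RintegralZl//; [rewrite hcos|exact: h1]|exact: h1].
move=> A mA.
apply: (@g_sigma_algebra_measure_unique _ R (borel H) trig_approximable
  trig_approximable_measurable (fun=> setT)).
- by move=> _; exact: trig_approximable_setT.
- by rewrite bigcup_const.
- exact: trig_approximableI.
- move=> B [g [tg g01 gB]].
  have mB : measurable (B : set (borel H)) by apply: trig_approximable_measurable; exists g.
  have lim (m : {measure set (borel H) -> \bar R}) : (m setT < +oo)%E ->
      (fun n => (\int[m]_x (g n x)%:E)%E) @ \oo --> m B.
    move=> fm; have [] := @dominated_convergence _ (borel H) R m setT measurableT
      (fun n x => (g n x)%:E) (fun x => (\1_B x)%:E) (cst 1%E).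
    + by move=> n; apply/measurable_EFinP; exact: measurable_trig.
    + exact/measurable_EFinP/measurable_indic.
    + by apply: aeW => x _; apply: cvg_EFin; [exact: nearW|exact: gB].
    + apply: (@finite_Rintegrable_bounded m (cst 1) 1) => //.
      by move=> x; rewrite normr1.
    + apply: aeW => x n _; rewrite /= lee_fin; have /andP[h0 h1] := g01 n x.
      by rewrite ger0_norm.
    by move=> _ _; rewrite integral_indic// setIT.
  have e : (fun n => (\int[m1]_x (g n x)%:E)%E) = (fun n => (\int[m2]_x (g n x)%:E)%E).
    apply/funext => n.
    have := htrig _ (tg n); rewrite /Rintegral.
    have := integrable_fin_num measurableT (itrig _ _ fin1 (tg n)).
    have := integrable_fin_num measurableT (itrig _ _ fin2 (tg n)).
    by move=> /= /fineK <- /fineK <- /= ->.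
  have l2 := lim m2 fin2; rewrite -e in l2.
  exact: (cvg_unique _ (lim m1 fin1) l2).
- by [].
- exact: borel_trig_generated.
Qed.

Lemma log_density_cos (P Q : probability (borel H) R) (L : H -> R) : mfH L ->
  (forall h c, \int[Q]_x cos ('<<x, h>> + c) = \int[P]_x (cos ('<<x, h>> + c) * expR (L x))) ->
  is_log_density P Q L.
Proof.
move=> mL hcos; split => //.
have me : mfH (fun x => expR (L x)) by exact: measurable_expR_comp.
pose nu : {measure set (borel H) -> \bar R} := exp_density_measure P mL.
have nuT : nu setT = 1%E.
  (* At zero frequency and phase the hypothesis computes the total mass; an infinite mass would be
     read by [fine] as 0 instead of 1. *)
  have := hcos 0 0.
  under eq_Rintegral do rewrite hdot0r addr0 cos0.
  under [X in _ = X -> _]eq_Rintegral do rewrite hdot0r addr0 cos0 mul1r.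
  rewrite Rintegral_cst_prob /Rintegral -[X in fine X]/(nu setT).
  by case: (nu setT) => //= [r <-//|/eqP|/eqP]; rewrite oner_eq0.
have nufin : fin_num_fun nu by apply: lty_fin_num_fun; rewrite nuT ltry.
pose mm := Measure_isFinite.Build _ _ _ (exp_density_measure P mL) nufin.
pose nu' : {finite_measure set (borel H) -> \bar R} := HB.pack (exp_density_measure P mL) mm.
move=> A mA; apply: (@trig_unique Q nu) => //.
- by have := @probability_setT _ _ _ Q; rewrite /= => ->; rewrite ltry.
- by rewrite nuT ltry.
move=> h c; rewrite hcos; apply/esym.
apply: (@Rintegral_density _ _ _ nu' P (fun x => expR (L x)) me) => //.
exact: measurable_cos_hdot.
Qed.

End borel_measurability.

(** * Gaussian quadratic forms *)

Lemma eq_of_geometric {R : realType} (a b C : R) :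
  (forall n, `|a - b| <= C * 2^-1 ^+ n) -> a = b.
Proof.
move=> h; apply/eqP; rewrite -subr_eq0 -normr_le0.
have hc : (fun n => C * 2^-1 ^+ n) @ \oo --> (C * 0 : R).
  apply: cvgMr; apply: cvg_expr; rewrite ger0_norm ?invr_ge0//; lra.
rewrite mulr0 in hc; rewrite -(cvg_lim _ hc)//; apply: limr_ge; first by apply/cvg_ex; exists 0.
exact: nearW.
Qed.

Lemma le_of_geometric {R : realType} (a b C : R) :
  (forall n, a <= b + C * 2^-1 ^+ n) -> a <= b.
Proof.
move=> h.
have hc : (fun n => b + C * 2^-1 ^+ n) @ \oo --> (b + C * 0 : R).
  apply: cvgD; first exact: cvg_cst.
  apply: cvgMr; apply: cvg_expr; rewrite ger0_norm ?invr_ge0//; lra.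
rewrite mulr0 addr0 in hc; rewrite -(cvg_lim _ hc)//; apply: limr_ge; first by apply/cvg_ex; exists b.
exact: nearW.
Qed.

Lemma cvg_of_geometric {R : realType} (u : nat -> R) (l C : R) :
  (forall n, `|u n - l| <= C * 2^-1 ^+ n) -> u @ \oo --> l.
Proof.
move=> hu; have hc : (fun n => C * 2^-1 ^+ n) @ \oo --> (C * 0 : R).
  apply: cvgMr; apply: cvg_expr; rewrite ger0_norm ?invr_ge0//; lra.
rewrite mulr0 in hc; apply/cvgrPdist_lt => e e0.
move/cvgrPdist_lt : hc => /(_ e e0); apply: filterS => n.
rewrite sub0r normrN distrC => h; apply: le_lt_trans h.
by apply: le_trans (ler_norm _); exact: hu.
Qed.

Lemma Rintegrable_sum d (X : measurableType d) {R : realType} (P : {measure set X -> \bar R})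
    I (r : seq I) (F : I -> X -> R) :
  (forall i, P.-integrable setT (EFin \o F i)) ->
  P.-integrable setT (EFin \o (fun x => \sum_(i <- r) F i x)).
Proof.
move=> hF; elim: r => [|i r ih].
  rewrite (_ : (fun x => _) = cst 0); last by apply/funext => x; rewrite big_nil.
  exact: integrable0.
rewrite (_ : (fun x => _) = fun x => F i x + \sum_(i <- r) F i x); last first.
  by apply/funext => x; rewrite big_cons.
exact: RintegrableD.
Qed.

Lemma Rintegral_sum d (X : measurableType d) {R : realType} (P : {measure set X -> \bar R})
    I (r : seq I) (F : I -> X -> R) :
  (forall i, P.-integrable setT (EFin \o F i)) ->
  \int[P]_x (\sum_(i <- r) F i x) = \sum_(i <- r) \int[P]_x F i x.
Proof.
move=> hF; elim: r => [|i r ih].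
  rewrite (_ : (fun x => _) = cst 0); last by apply/funext => x; rewrite big_nil.
  by rewrite big_nil Rintegral_cst// mul0r.
rewrite big_cons -ih -RintegralD//; last exact: Rintegrable_sum.
by apply: eq_Rintegral => x _; rewrite big_cons.
Qed.

Section gaussian_family.
Context {R : realType} {H : hilbertType R}.
Hypotheses (Hsep : separable H) (Hinf : infinite_dimensional H).
Variables (T : H -> H) (h : nat -> H).
Hypotheses (sT : Sym T) (bh : orthonormal_basis (T \o h)).
Variable nu : (H -> H) -> probability (borel H) R.
Hypothesis nuE : forall G, SymPos G -> forall (k : H) (A : set R), measurable A ->
  nu G [set x : H | A '<<x, k>>] = centered_normal '<<G (T k), T k>> A.
Implicit Types (G V W : H -> H) (l : seq (R * H)).

Let lT : linear T. Proof. exact: bounded_op_linear sT.1. Qed.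

(** The subtracted |T g|^2 is the variance of <<x, g>> for G = I. Centering under the reference
    measure is what makes these forms converge along Hilbert-Schmidt, and not only trace class,
    limits. *)
Definition quad l (x : H) : R := \sum_(p <- l) p.1 * ('<<x, p.2>> ^+ 2 - `|T p.2| ^+ 2).

Lemma quad_cat l l' x : quad (l ++ l') x = quad l x + quad l' x.
Proof. by rewrite /quad big_cat. Qed.

Definition scale_list (a : R) l := [seq (a * p.1, p.2) | p <- l].

Lemma quad_scale a l x : quad (scale_list a l) x = a * quad l x.
Proof.
by rewrite /quad big_map mulr_sumr; apply: eq_bigr => p _ /=; rewrite mulrA.
Qed.

Lemma rank_op_scale a l : rank_op T (scale_list a l) = a \*: rank_op T l.
Proof.
apply/funext => x; rewrite /rank_op /= big_map scaler_sumr; apply: eq_bigr => p _ /=.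
by rewrite scalerA mulrA.
Qed.

Definition approx V n : seq (R * H) :=
  xget [::] [set l | hsn (V \- rank_op T l) <= 2^-1 ^+ n].

Lemma approxP V n : SymHS V -> hsn (V \- rank_op T (approx V n)) <= 2^-1 ^+ n.
Proof.
move=> hV; have e0 : 0 < 2^-1 ^+ n :> R by rewrite exprn_gt0// invr_gt0.
have [l hl] := finite_rank_approx Hsep Hinf lT bh hV e0.
exact: (@xgetPex _ _ [set l | hsn (V \- rank_op T l) <= 2^-1 ^+ n]) (ex_intro _ l hl).
Qed.

(** The lists [approx V n] depend on [V] alone, so the same function is used under every [nu G]. *)
Definition qform V : H -> R := @mlim _ (borel H) R (fun n => quad (approx V n)).

Lemma hsn_tri U V W : HS U -> HS V -> HS W -> hsn (U \- W) <= hsn (U \- V) + hsn (V \- W).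
Proof.
move=> hU hV hW; have -> : U \- W = (U \- V) \+ (V \- W).
  by apply/funext => x /=; rewrite addrA subrK.
by apply: hsnD => //; exact: HSB.
Qed.

Lemma hsn_sym V W : HS V -> HS W -> hsn (V \- W) = hsn (W \- V).
Proof.
move=> hV hW; rewrite -hsnN//; last exact: HSB.
by congr hsn; apply/funext => x /=; rewrite opprB.
Qed.

Section fixed_covariance.
Variable G : H -> H.
Hypothesis pG : SymPos G.
Let sG : Sym G := pG.1.
Let lG : linear G. Proof. exact: bounded_op_linear sG.1. Qed.
Local Notation c g k := '<<G (T g), T k>>.

Let c_ge0 g : 0 <= c g g. Proof. exact: pG.2. Qed.

Let cC g k : c g k = c k g. Proof. by rewrite sG.2 hdotC. Qed.

Lemma gaussian_cos k a : \int[nu G]_x cos ('<<x, k>> + a) = cos a * expR (- (c k k / 2)).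
Proof.
exact: (centered_normal_cos (measurable_hdot k) (c_ge0 k) (nuE pG k)).
Qed.

Lemma gaussian_moment2 k : \int[nu G]_x ('<<x, k>> ^+ 2) = c k k.
Proof.
exact: (centered_normal_moment2 (measurable_hdot k) (c_ge0 k) (nuE pG k)).
Qed.

Lemma gaussian_moment4 k : \int[nu G]_x ('<<x, k>> ^+ 4) = 3 * c k k ^+ 2.
Proof.
exact: (centered_normal_moment4 (measurable_hdot k) (c_ge0 k) (nuE pG k)).
Qed.

Lemma gaussian_sqint_sqr k : sqint (nu G) (fun x => '<<x, k>> ^+ 2).
Proof.
split; first by apply: measurable_funX; exact: measurable_hdot.
have := centered_normal_integrable4 (measurable_hdot k) (c_ge0 k) (nuE pG k).
by congr (_.-integrable _ (EFin \o _)); apply/funext => x; rewrite -exprM.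
Qed.

(* Polarization: (X + Y)^4 + (X - Y)^4 = 2 X^4 + 12 X^2 Y^2 + 2 Y^4. *)
Lemma gaussian_moment22 g k : \int[nu G]_x ('<<x, g>> ^+ 2 * '<<x, k>> ^+ 2) =
  c g g * c k k + 2 * c g k ^+ 2.
Proof.
have i4 (k' : H) : (nu G).-integrable setT (EFin \o (fun x => '<<x, k'>> ^+ 4)).
  exact: (centered_normal_integrable4 (measurable_hdot k') (c_ge0 k') (nuE pG k')).
have i22 := sqint_mul (gaussian_sqint_sqr g) (gaussian_sqint_sqr k).
have h1 : \int[nu G]_x ('<<x, g + k>> ^+ 4 + '<<x, g - k>> ^+ 4) =
    3 * (c g g + c k k + 2 * c g k) ^+ 2 + 3 * (c g g + c k k - 2 * c g k) ^+ 2.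
  rewrite RintegralD// !gaussian_moment4 (linearD_ lT) (linearB_ lT) (linearD_ lG) (linearB_ lG).
  rewrite !hdotDl !hdotDr !hdotNl !hdotNr (cC k g); ring.
have h2 : \int[nu G]_x ('<<x, g + k>> ^+ 4 + '<<x, g - k>> ^+ 4) =
    2 * (3 * c g g ^+ 2) + (12 * \int[nu G]_x ('<<x, g>> ^+ 2 * '<<x, k>> ^+ 2)
    + 2 * (3 * c k k ^+ 2)).
  rewrite -!gaussian_moment4 -!RintegralZl// -RintegralD//; try exact: RintegrableZ.
  rewrite -RintegralD//; try exact: RintegrableZ; last first.
    by apply: RintegrableD; exact: RintegrableZ.
  by apply: eq_Rintegral => x _; rewrite hdotDr hdotBr; ring.
move: h1; rewrite h2; set I := Rintegral _ _ _; lra.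
Qed.

Let sqc g (a : R) : sqint (nu G) (fun x => '<<x, g>> ^+ 2 - a).
Proof. by apply: sqintB; [exact: gaussian_sqint_sqr|exact: sqint_cst]. Qed.

Lemma quad_sqint l : sqint (nu G) (quad l).
Proof.
elim: l => [|p l ih].
  rewrite (_ : quad _ = cst 0); last by apply/funext => x; rewrite /quad big_nil.
  exact: sqint_cst.
rewrite (_ : quad _ = fun x => p.1 * ('<<x, p.2>> ^+ 2 - `|T p.2| ^+ 2) + quad l x).
  by apply: sqintD => //; apply: sqintZ; exact: sqc.
by apply/funext => x; rewrite /quad big_cons.
Qed.

Hypothesis hG : HS (idfun \- G).

Lemma quad_mean l : \int[nu G]_x quad l x = - hs (rank_op T l) (idfun \- G).
Proof.
rewrite /quad Rintegral_sum; last first.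
  by move=> p; apply: RintegrableZ; exact: sqint_integrable.
rewrite hs_rank_op// -sumrN; apply: eq_bigr => p _.
rewrite RintegralZl//; last exact: sqint_integrable.
rewrite RintegralB//; [|exact: sqint_integrable (gaussian_sqint_sqr _)|exact: finite_measure_integrable_cst].
by rewrite Rintegral_cst_prob gaussian_moment2 hdotBl -sqr_normE; ring.
Qed.

(** Wick's formula summed over both lists: the product of the means plus twice the squared
    covariances, which [hs_rank_op_conj] gathers into one inner product. *)
Lemma quad_product l l' : \int[nu G]_x (quad l x * quad l' x) =
  hs (rank_op T l) (idfun \- G) * hs (rank_op T l') (idfun \- G)
  + 2 * hs (rank_op T l) (G \o rank_op T l' \o G).
Proof.
rewrite -[X in X + _]mulrNN -!quad_mean hs_rank_op_conj//.
pose Y (p : R * H) x := p.1 * ('<<x, p.2>> ^+ 2 - `|T p.2| ^+ 2).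
have sY p : sqint (nu G) (Y p) by apply: sqintZ; exact: sqc.
have iY p p' := sqint_mul (sY p) (sY p').
have EY p : \int[nu G]_x Y p x = p.1 * (c p.2 p.2 - `|T p.2| ^+ 2).
  rewrite RintegralZl//; last exact: sqint_integrable.
  rewrite RintegralB//; [|exact: sqint_integrable (gaussian_sqint_sqr _)|exact: finite_measure_integrable_cst].
  by rewrite Rintegral_cst_prob gaussian_moment2.
have E2 p p' : \int[nu G]_x (Y p x * Y p' x) =
    (\int[nu G]_x Y p x) * (\int[nu G]_x Y p' x) + 2 * (p.1 * p'.1 * c p.2 p'.2 ^+ 2).
  rewrite !EY; pose u : R := `|T p.2| ^+ 2; pose v : R := `|T p'.2| ^+ 2; rewrite -/u -/v.
  have -> : \int[nu G]_x (Y p x * Y p' x) = \int[nu G]_x ((p.1 * p'.1) *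
     (('<<x, p.2>> ^+ 2 * '<<x, p'.2>> ^+ 2) + ((- v * '<<x, p.2>> ^+ 2) + ((- u) * '<<x, p'.2>> ^+ 2 + u * v)))).
    by apply: eq_Rintegral => x _; rewrite /Y -/u -/v; ring.
  have i1 := sqint_mul (gaussian_sqint_sqr p.2) (gaussian_sqint_sqr p'.2).
  have i2 (k : H) := sqint_integrable (gaussian_sqint_sqr k).
  have i3 (k : R) : (nu G).-integrable setT (EFin \o cst k) by exact: finite_measure_integrable_cst.
  have i4 : (nu G).-integrable setT (EFin \o (fun x => (- u) * '<<x, p'.2>> ^+ 2 + u * v)).
    by apply: RintegrableD; [exact: RintegrableZ|exact: (i3 (u * v))].
  have i5 : (nu G).-integrable setT (EFin \o (fun x => - v * '<<x, p.2>> ^+ 2 + ((- u) * '<<x, p'.2>> ^+ 2 + u * v))).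
    by apply: RintegrableD => //; exact: RintegrableZ.
  rewrite RintegralZl//; last exact: RintegrableD.
  rewrite RintegralD// RintegralD//; last exact: RintegrableZ.
  rewrite RintegralD//; [|exact: RintegrableZ|exact: (i3 (u * v))].
  rewrite (Rintegral_cst_prob (nu G) (u * v)) !RintegralZl// gaussian_moment22 !gaussian_moment2; ring.
have Es m : \int[nu G]_x quad m x = \sum_(p <- m) \int[nu G]_x Y p x.
  exact: (@Rintegral_sum _ (borel H) R (nu G) _ m Y (fun p => sqint_integrable (sY p))).
rewrite !Es.
have -> : \int[nu G]_x (quad l x * quad l' x) =
    \sum_(p <- l) \sum_(p' <- l') \int[nu G]_x (Y p x * Y p' x).
  rewrite /quad.
  under eq_Rintegral do rewrite mulr_suml.
  under eq_Rintegral do under eq_bigr do rewrite mulr_sumr.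
  have i2 p : (nu G).-integrable setT (EFin \o (fun x => \sum_(p' <- l') Y p x * Y p' x)).
    exact: (@Rintegrable_sum _ (borel H) R (nu G) _ l' (fun p' x => Y p x * Y p' x) (iY p)).
  rewrite (@Rintegral_sum _ (borel H) R (nu G) _ l (fun p x => \sum_(p' <- l') Y p x * Y p' x) i2).
  apply: eq_bigr => p _.
  exact: (@Rintegral_sum _ (borel H) R (nu G) _ l' (fun p' x => Y p x * Y p' x) (iY p)).
rewrite mulr_suml mulr_sumr -big_split /=; apply: eq_bigr => p _.
rewrite mulr_sumr mulr_sumr -big_split /=; apply: eq_bigr => p' _.
exact: E2.
Qed.

Variable M : R.
Hypotheses (M0 : 0 <= M) (bG : bnd G M).

Lemma hs_conj_le V W : HS V -> HS W ->
  `|hs V (G \o W \o G)| <= hsn V * (M ^+ 2 * hsn W).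
Proof.
move=> hV hW.
have [h1 n1] := HS_compr Hsep Hinf M0 sG.1 bG hW.
have [h2 n2] := HS_compl Hsep Hinf M0 sG.1 bG h1.
apply: (le_trans (hs_CauchySchwarz Hsep Hinf hV h2)).
rewrite ler_wpM2l ?hsn_ge0// (le_trans n2)// expr2 -mulrA ler_wpM2l//.
Qed.

(** With V the operator of a list, the second moment of its form is a squared mean, at most |I -
    G|^2 |V|^2, plus a variance, at most 2 M^2 |V|^2. The square of the present sum dominates both
    coefficients. *)
Definition quad_bound : R := hsn (idfun \- G) + 2 * M.

Lemma quad_bound_ge0 : 0 <= quad_bound.
Proof. by rewrite addr_ge0 ?hsn_ge0// mulr_ge0. Qed.

Lemma quad_l2 l : l2 (nu G) (quad l) <= quad_bound * hsn (rank_op T l).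
Proof.
have hl := rank_op_HS Hsep Hinf T l.
rewrite -ler_sqr ?nnegrE ?mulr_ge0 ?l2_ge0 ?hsn_ge0 ?quad_bound_ge0// sqr_l2.
under eq_Rintegral do rewrite expr2; rewrite quad_product.
have := hs_conj_le hl hl; rewrite ler_norml => /andP[_ h1].
have h2 : hs (rank_op T l) (idfun \- G) ^+ 2 <= (hsn (rank_op T l) * hsn (idfun \- G)) ^+ 2.
  rewrite -(real_normK (num_real (hs _ _))) ler_sqr ?nnegrE ?mulr_ge0 ?hsn_ge0//.
  exact: hs_CauchySchwarz.
rewrite /quad_bound.
have := hsn_ge0 (rank_op T l); have := hsn_ge0 (idfun \- G).
move: (hsn (idfun \- G)) (hsn _) (hs _ (idfun \- G)) (hs _ _) h1 h2 => s t u v h1 h2 s0 t0.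
rewrite exprMn in h2; have : 0 <= s * M * t ^+ 2 by rewrite !mulr_ge0// sqr_ge0.
have : 0 <= M ^+ 2 * t ^+ 2 by rewrite mulr_ge0 ?sqr_ge0.
nra.
Qed.

Lemma quadB_l2 l l' :
  l2 (nu G) (fun x => quad l x - quad l' x) <= quad_bound * hsn (rank_op T l \- rank_op T l').
Proof.
have := quad_l2 (l ++ scale_list (-1) l'); rewrite rank_op_cat rank_op_scale.
have -> : rank_op T l \+ (-1 \*: rank_op T l') = rank_op T l \- rank_op T l'.
  by apply/funext => x /=; rewrite scaleN1r.
by congr (l2 _ _ <= _); apply/funext => x; rewrite quad_cat quad_scale mulN1r.
Qed.

Lemma approx_step V n : SymHS V ->
  l2 (nu G) (fun x => quad (approx V n.+1) x - quad (approx V n) x)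
  <= (2 * quad_bound) * 2^-1 ^+ n.
Proof.
move=> sV; have hl m := rank_op_HS Hsep Hinf T (approx V m).
apply: (le_trans (quadB_l2 _ _)); rewrite [2 * _]mulrC -mulrA ler_wpM2l ?quad_bound_ge0//.
apply: (le_trans (hsn_tri (hl _) sV.2 (hl _))).
rewrite hsn_sym//; last exact: sV.2.
have := approxP n sV; have := approxP n.+1 sV; rewrite exprS.
have : 0 <= 2^-1 ^+ n :> R by rewrite exprn_ge0.
lra.
Qed.

Lemma qform_sqint V : SymHS V -> sqint (nu G) (qform V).
Proof.
move=> sV; have [] // := mlim_l2 _ (fun n => quad_sqint (approx V n)) (fun n => approx_step n sV).
by rewrite mulr_ge0// quad_bound_ge0.
Qed.

Lemma qform_ae_cvg V : SymHS V ->
  {ae nu G, forall x, (fun n => quad (approx V n) x) @ \oo --> qform V x}.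
Proof.
move=> sV; apply: (ae_cvg_geometric _ (fun n => quad_sqint (approx V n)) (fun n => approx_step n sV)).
by rewrite mulr_ge0// quad_bound_ge0.
Qed.

Lemma qform_approx V n : SymHS V ->
  l2 (nu G) (fun x => qform V x - quad (approx V n) x) <= 4 * quad_bound * 2^-1 ^+ n.
Proof.
move=> sV; have [] // := mlim_l2 _ (fun n => quad_sqint (approx V n)) (fun n => approx_step n sV).
  by rewrite mulr_ge0// quad_bound_ge0.
by move=> _ /(_ n); rewrite mulrA -natrM.
Qed.

Lemma qform_quad V l : SymHS V ->
  l2 (nu G) (fun x => qform V x - quad l x) <= quad_bound * hsn (V \- rank_op T l).
Proof.
move=> sV; have hl l' := rank_op_HS Hsep Hinf T l'.
(* 4 comes from the distance between [qform V] and [quad (approx V n)], 1 from the distance between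
   [V] and the operator of [approx V n]. *)
apply: (@le_of_geometric _ _ _ (5 * quad_bound)) => n.
have -> : (fun x => qform V x - quad l x) =
    (fun x => (qform V x - quad (approx V n) x) + (quad (approx V n) x - quad l x)).
  by apply/funext => x; rewrite addrA subrK.
have sq1 := qform_sqint sV; have sq2 := quad_sqint (approx V n).
apply: (le_trans (l2D (sqintB sq1 sq2) (sqintB sq2 (quad_sqint l)))).
have h1 := qform_approx n sV; have h2 := quadB_l2 (approx V n) l.
have h3 := hsn_tri (hl (approx V n)) sV.2 (hl l).
rewrite (hsn_sym (hl _) sV.2) in h3; have h4 := approxP n sV.
have h5 := quad_bound_ge0; nra.
Qed.

Lemma qform_mean V : SymHS V -> \int[nu G]_x qform V x = - hs V (idfun \- G).
Proof.
move=> sV; have hl l' := rank_op_HS Hsep Hinf T l'.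
apply: (@eq_of_geometric _ _ _ (4 * quad_bound + hsn (idfun \- G))) => n.
have sq1 := qform_sqint sV; have sq2 := quad_sqint (approx V n).
have h1 := le_trans (mean_le_l2 (sqintB sq1 sq2)) (qform_approx n sV).
rewrite RintegralB// in h1; [|exact: sqint_integrable..].
rewrite quad_mean in h1.
have h2 := hs_CauchySchwarz Hsep Hinf (HSB Hsep Hinf sV.2 (hl (approx V n))) hG.
rewrite hsBl// in h2; last exact: sV.2.
have h3 := approxP n sV; have h4 := hsn_ge0 (idfun \- G).
move: h1 h2; rewrite !ler_norml => /andP[h1 h1'] /andP[h2 h2'].
by apply/andP; split; nra.
Qed.

Lemma hs_conj_sym V W : HS V -> HS W -> hs V (G \o W \o G) = hs (G \o V \o G) W.
Proof.
move=> hV hW.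
have [h1 _] := HS_compr Hsep Hinf M0 sG.1 bG hW.
have [h2 _] := HS_compl Hsep Hinf M0 sG.1 bG hV.
rewrite -(hs_movel Hsep Hinf sG.1 sG.1 sG.2 hV h1).
by rewrite (hs_mover Hsep Hinf sG.1 sG.1 sG.2 h2 hW).
Qed.

Lemma HS_conj V : HS V -> HS (G \o V \o G).
Proof.
move=> hV; have [h1 _] := HS_compr Hsep Hinf M0 sG.1 bG hV.
by have [] := HS_compl Hsep Hinf M0 sG.1 bG h1.
Qed.

Let hs_approx_cvg V X : SymHS V -> HS X ->
  (fun n => hs (rank_op T (approx V n)) X) @ \oo --> hs V X.
Proof.
move=> sV hX; have hl l' := rank_op_HS Hsep Hinf T l'.
apply: (@cvg_of_geometric _ _ _ (hsn X)) => n.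
rewrite -hsBl//; last exact: sV.2.
apply: (le_trans (hs_CauchySchwarz Hsep Hinf (HSB Hsep Hinf (hl _) sV.2) hX)).
rewrite mulrC ler_wpM2l ?hsn_ge0// hsn_sym//; [exact: approxP|exact: sV.2].
Qed.

Let integral_approx_cvg V f : SymHS V -> sqint (nu G) f ->
  (fun n => \int[nu G]_x (quad (approx V n) x * f x)) @ \oo --> \int[nu G]_x (qform V x * f x).
Proof.
move=> sV hf; have sq1 := qform_sqint sV.
apply: (@cvg_of_geometric _ _ _ (4 * quad_bound * l2 (nu G) f)) => n.
have sq2 := quad_sqint (approx V n).
rewrite -normrN opprB -RintegralB//; [|exact: sqint_mul..].
rewrite (_ : Rintegral _ _ _ = \int[nu G]_x ((qform V x - quad (approx V n) x) * f x)); last first.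
  by apply: eq_Rintegral => x _; rewrite mulrBl.
apply: (le_trans (l2_CauchySchwarz (sqintB sq1 sq2) hf)).
rewrite mulrAC ler_wpM2r ?l2_ge0//; exact: qform_approx.
Qed.

(** One factor is approximated at a time, so that every limit is linear in the approximated
    argument; symmetry of the conjugation by [G] treats the second factor like the first. *)
Lemma qform_product V W : SymHS V -> SymHS W ->
  \int[nu G]_x (qform V x * qform W x) =
  hs V (idfun \- G) * hs W (idfun \- G) + 2 * hs V (G \o W \o G).
Proof.
move=> sV sW; have hl l' := rank_op_HS Hsep Hinf T l'.
have E l : \int[nu G]_x (qform V x * quad l x) =
    hs V (idfun \- G) * hs (rank_op T l) (idfun \- G) + 2 * hs V (G \o rank_op T l \o G).
  have h1 := integral_approx_cvg sV (quad_sqint l).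
  apply: (cvg_unique _ h1) => //=.
  under eq_fun do rewrite quad_product.
  apply: cvgD; first by apply: cvgM; [exact: hs_approx_cvg|exact: cvg_cst].
  by apply: cvgM; [exact: cvg_cst|apply: hs_approx_cvg => //; exact: HS_conj].
under eq_Rintegral do rewrite mulrC.
have h1 := integral_approx_cvg sW (qform_sqint sV).
apply: (cvg_unique _ h1) => //=.
under eq_fun do (under eq_Rintegral do rewrite mulrC).
have E' X : HS X -> hs V (G \o X \o G) = hs X (G \o V \o G).
  move=> hX; rewrite (hs_conj_sym sV.2 hX).
  exact: (hsC Hsep Hinf (HS_conj sV.2) hX).
under eq_fun do rewrite E E'//.
rewrite (E' _ sW.2).
apply: cvgD; first by apply: cvgM; [exact: cvg_cst|exact: hs_approx_cvg].
by apply: cvgM; [exact: cvg_cst|apply: hs_approx_cvg => //; apply: HS_conj; exact: sV.2].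
Qed.

(** Centering removes the squared mean, and with it |I - G|; only the bound [M] on [G] remains. *)
Lemma qform_center_l2 V : SymHS V ->
  l2 (nu G) (fun x => qform V x - \int[nu G]_y qform V y) <= 2 * M * hsn V.
Proof.
move=> sV; rewrite -ler_sqr ?nnegrE ?l2_ge0 ?mulr_ge0 ?hsn_ge0//.
rewrite l2_center; last exact: qform_sqint.
under eq_Rintegral do rewrite expr2.
rewrite qform_product// qform_mean//.
have := hs_conj_le sV.2 sV.2; rewrite ler_norml => /andP[_].
have : 0 <= (M * hsn V) ^+ 2 by exact: sqr_ge0.
nra.
Qed.

(** The lists for [V], [W] and the combination are chosen separately, so the identity is almost
    everywhere only. The scaled and concatenated lists of [V] and [W] approximate the combination,
    and the L^2 norm of the defect is below every geometric error. *)
Lemma qform_linear a V W : SymHS V -> SymHS W ->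
  {ae nu G, forall x, qform (a \*: V \+ W) x = a * qform V x + qform W x}.
Proof.
move=> sV sW; have hl l' := rank_op_HS Hsep Hinf T l'.
have sVW : SymHS (a \*: V \+ W).
  split; first exact: (SymD (SymZ _ sV.1) sW.1).
  exact: (HSD Hsep Hinf (HSZ Hsep Hinf a sV.2).1 sW.2).
have s1 := qform_sqint sVW; have s2 := qform_sqint sV; have s3 := qform_sqint sW.
pose D x := qform (a \*: V \+ W) x - (a * qform V x + qform W x).
have sD : sqint (nu G) D by apply: sqintB => //; apply: sqintD => //; exact: sqintZ.
suff D0 : l2 (nu G) D = 0.
  by apply: filterS (l2_eq0 sD D0) => x /eqP; rewrite subr_eq0 => /eqP.
apply/eqP; rewrite eq_le l2_ge0 andbT.
apply: (@le_of_geometric _ _ _ (quad_bound * (2 * (`|a| + 1)))) => n; rewrite add0r.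
pose l := approx V n; pose l' := approx W n; pose ll := scale_list a l ++ l'.
have -> : D = (fun x => (qform (a \*: V \+ W) x - quad ll x) -
    ((a * (qform V x - quad l x)) + (qform W x - quad l' x))).
  apply/funext => x; rewrite /D /ll quad_cat quad_scale.
  by move: (qform _ x) (qform V x) (qform W x) (quad l x) (quad l' x) => *; ring.
have t1 := sqintB s1 (quad_sqint ll); have t2 := sqintB s2 (quad_sqint l).
have t3 := sqintB s3 (quad_sqint l'); have t4 := sqintZ a t2.
apply: (le_trans (l2B t1 (sqintD t4 t3))).
have u1 := l2D t4 t3; rewrite l2Z// in u1.
have e1 := approxP n sV; have e2 := approxP n sW.
have n1 : hsn ((a \*: V \+ W) \- rank_op T ll) <= (`|a| + 1) * 2^-1 ^+ n.
  have -> : (a \*: V \+ W) \- rank_op T ll = a \*: (V \- rank_op T l) \+ (W \- rank_op T l').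
    apply/funext => x; rewrite /ll rank_op_cat rank_op_scale /= scalerBr opprD.
    by rewrite -!addrA; congr (_ + _); rewrite !addrA; congr (_ + _); rewrite addrC.
  have b1 := HSB Hsep Hinf sV.2 (hl l); have b2 := HSB Hsep Hinf sW.2 (hl l').
  apply: (le_trans (hsnD Hsep Hinf (HSZ Hsep Hinf a b1).1 b2)).
  rewrite (hsnZ Hsep Hinf a b1) mulrDl mul1r; apply: lerD e2.
  exact: ler_wpM2l e1.
have q1 := le_trans (qform_quad ll sVW) (ler_wpM2l quad_bound_ge0 n1).
have q2 := le_trans (qform_quad l sV) (ler_wpM2l quad_bound_ge0 e1).
have q3 := le_trans (qform_quad l' sW) (ler_wpM2l quad_bound_ge0 e2).
have q4 := ler_wpM2l (normr_ge0 a) q2.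
apply: (le_trans (lerD q1 (le_trans u1 (lerD q4 q3)))).
move: (quad_bound) (2^-1 ^+ n) => K e; rewrite le_eqVlt; apply/orP; left; apply/eqP.
by ring.
Qed.

End fixed_covariance.
End gaussian_family.

(** * Densities of Gaussian measures *)

Lemma Rintegral_ext d (X : measurableType d) {R : realType} (P : {measure set X -> \bar R})
    (f g : X -> R) : f =1 g -> \int[P]_x f x = \int[P]_x g x.
Proof. by move=> fg; apply: eq_Rintegral => x _; rewrite fg. Qed.
Arguments Rintegral_ext {d X R} P f g.

Lemma Rintegral_swap d1 d2 (X : measurableType d1) (Y : measurableType d2) {R : realType}
    (P : probability X R) (Q : probability Y R) (F : X -> Y -> R) (K : R) :
  measurable_fun setT (fun z : X * Y => F z.1 z.2) -> (forall x y, `|F x y| <= K) ->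
  \int[P]_x (\int[Q]_y F x y) = \int[Q]_y (\int[P]_x F x y).
Proof.
move=> mF FK.
have iF : (P \x Q)%E.-integrable setT (EFin \o (fun z : X * Y => F z.1 z.2)).
  apply: (@Rintegrable_le _ _ R _ _ (cst K)) => //.
  apply/integrableP; split; first exact/measurable_EFinP.
  have K0 : 0 <= K by rewrite (le_trans _ (FK point point)).
  under eq_integral do rewrite /= ger0_norm//.
  rewrite integral_cst//= -setXTT product_measure1E//.
  by rewrite lte_mul_pinfty// -ge0_fin_numE ?mule_ge0// fin_numM// fin_num_measure.
have m1 x : measurable_fun setT (F x).
  exact: (measurableT_comp mF (@pair1_measurable _ _ _ _ x)).
have m2 y : measurable_fun setT (F ^~ y).
  exact: (measurableT_comp mF (@pair2_measurable _ _ _ _ y)).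
have i1 x : Q.-integrable setT (EFin \o F x).
  by apply: (Rintegrable_le (g := cst K)) => //; exact: finite_measure_integrable_cst.
have i2 y : P.-integrable setT (EFin \o F ^~ y).
  by apply: (Rintegrable_le (g := cst K)) => //; exact: finite_measure_integrable_cst.
have := Fubini iF; rewrite /Rintegral => h; congr fine.
under eq_integral => x _ do (rewrite fineK; last exact: (integrable_fin_num measurableT (i1 x))).
under [RHS]eq_integral => y _ do (rewrite fineK; last exact: (integrable_fin_num measurableT (i2 y))).
exact: h.
Qed.

(** * Rank-one changes of the inverse covariance *)

Section rank_one.
Context {R : realType} {H : hilbertType R}.
Hypotheses (Hsep : separable H) (Hinf : infinite_dimensional H).
Variables (T : H -> H).
Hypotheses (sT : Sym T).
Variable nu : (H -> H) -> probability (borel H) R.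
Hypothesis nuE : forall G, SymPos G -> forall (k : H) (A : set R), measurable A ->
  nu G [set x : H | A '<<x, k>>] = centered_normal '<<G (T k), T k>> A.
Implicit Types (B G V W : H -> H) (l : seq (R * H)).

Let lT : linear T. Proof. exact: bounded_op_linear sT.1. Qed.

Lemma measurable_quad l : @measurable_fun _ _ (borel H) (measurableTypeR R) setT (quad T l).
Proof.
apply: (@measurable_sum _ (borel H)) => p.
apply: measurable_funM => //; apply: measurable_funB => //; apply: measurable_funX.
exact: measurable_hdot.
Qed.

Lemma inv_op_pos B c : 0 < c -> Sym B -> coercive B c -> SymPos (inv_op B).
Proof.
move=> c0 sB cB; have [sG _ _ _ [c' c'0 cG]] := inv_opP c0 sB cB.
by split => // x; apply: le_trans (cG x); rewrite mulr_ge0 ?sqr_ge0// ltW.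
Qed.

(** After Fubini with an auxiliary normal variable [y] of variance [k], the integral over [x] is
    explicit and leaves exponentials of b y - c y^2 / 2 and of - b y - c y^2 / 2. Completing the
    square yields the coefficient k / (1 + k c), and [Z] is common to all [h] and [a]. *)
Lemma gaussian_cos_gauss G (k : R) (g : H) : SymPos G -> 0 < k ->
  exists2 Z : R, 0 < Z & forall h a,
  \int[nu G]_x (cos ('<<x, h>> + a) * expR (- (k * '<<x, g>> ^+ 2 / 2))) =
  Z * (cos a * expR (- ('<<G (T h), T h>> -
     k / (1 + k * '<<G (T g), T g>>) * '<<G (T h), T g>> ^+ 2) / 2)).
Proof.
move=> pG k0; set c := '<<G (T g), T g>>.
have lG : linear G by exact: bounded_op_linear pG.1.1.
have c0 : 0 <= c by exact: pG.2.
pose s := Num.sqrt k; have s0 : 0 < s by rewrite sqrtr_gt0.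
have s2 : s ^+ 2 = k by rewrite sqr_sqrtr// ltW.
have [Z Z0 hZ] := normal_quadratic s0 c0; exists Z => // h a.
set b := '<<G (T h), T g>>; set e := '<<G (T h), T h>>.
pose N := normal_prob 0 s.
pose F (x : borel H) (y : measurableTypeR R) : R := cos ('<<x, h>> + a) * cos ('<<x, g>> * y + 0).
have F1 x y : `|F x y| <= 1.
  by rewrite normrM mulr_ile1 ?cos_norm_le1.
have mcos (f : borel H * measurableTypeR R -> R) : measurable_fun setT f ->
    measurable_fun setT (fun z => cos (f z)).
  move=> mf; apply: (@measurableT_comp _ _ _ _ (measurableTypeR R) (measurableTypeR R) cos) => //.
  by apply: continuous_measurable_fun; exact: continuous_cos.
have md (k' : H) : measurable_fun setT (fun z : borel H * measurableTypeR R => '<<z.1, k'>>).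
  by apply: (measurableT_comp (measurable_hdot k')).
have mF : measurable_fun setT (fun z : borel H * measurableTypeR R => F z.1 z.2).
  apply: measurable_funM; apply: mcos; apply: measurable_funD => //.
  by apply: measurable_funM => //; exact: md.
have e1 x : cos ('<<x, h>> + a) * expR (- (k * '<<x, g>> ^+ 2 / 2)) = \int[N]_y F x y.
  rewrite RintegralZl//; last first.
    apply: (integrable_normal_dom s0 (C := 1) (c := 0)); last first.
      by move=> y; rewrite mul0r expR0 mulr1 cos_norm_le1.
    apply: (@measurableT_comp _ _ _ _ (measurableTypeR R) (measurableTypeR R) cos).
      by apply: continuous_measurable_fun; exact: continuous_cos.
    by apply: measurable_funD => //; exact: measurable_funM.
  by rewrite normal_cos// cos0 mul1r s2 (mulrC k).
rewrite (Rintegral_ext (nu G) _ _ e1).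
rewrite (Rintegral_swap (nu G) N mF F1).
have e2 y : \int[nu G]_x F x y = 2^-1 * (cos a * expR (- e / 2)) *
   (expR (- b * y - c * y ^+ 2 / 2) + expR (b * y - c * y ^+ 2 / 2)).
  have ic (k' : H) : (nu G).-integrable setT (EFin \o (fun x : borel H => cos ('<<x, k'>> + a))).
    apply: (Rintegrable_le (g := cst 1)); first exact: measurable_cos_hdot.
      by move=> x; exact: cos_norm_le1.
    exact: finite_measure_integrable_cst.
  rewrite (Rintegral_ext (nu G) _ (fun x => 2^-1 * (cos ('<<x, h + y *: g>> + a) + cos ('<<x, h - y *: g>> + a)))); last first.
    move=> x; rewrite /F addr0 hdotDr hdotBr hdotZr.
    set u := '<<x, h>>; set v := '<<x, g>>.
    rewrite (_ : u + y * v + a = (u + a) + v * y); last by ring.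
    rewrite (_ : u - y * v + a = (u + a) - v * y); last by ring.
    by rewrite (cosD (u + a)) (cosB (u + a)); field.
  rewrite RintegralZl//; last exact: RintegrableD.
  rewrite RintegralD// !(gaussian_cos nuE pG).
  rewrite (linearD_ lT) (linearB_ lT) (linearZ_ lT) (linearD_ lG) (linearB_ lG) (linearZ_ lG).
  have cC : '<<G (T g), T h>> = b by rewrite pG.1.2 hdotC.
  rewrite !hdotDl !hdotDr !hdotNl !hdotNr !hdotZl !hdotZr cC -/e -/b -/c.
  rewrite -!mulrA; congr (_ * _); rewrite -mulrDr; congr (_ * _).
  by rewrite mulrDr -!expRD; congr (expR _ + expR _); field.
rewrite (Rintegral_ext N _ _ e2).
have iq (b' : R) : N.-integrable setT (EFin \o (fun y => expR (b' * y - c * y ^+ 2 / 2))) /\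
    \int[N]_y expR (b' * y - c * y ^+ 2 / 2) = Z * expR (2^-1 * b' ^+ 2 * (s ^+ 2 / (1 + c * s ^+ 2))).
  split; last by rewrite /Rintegral hZ.
  apply/integrableP; split.
    apply/measurable_EFinP; apply: (@measurableT_comp _ _ _ _ (measurableTypeR R) (measurableTypeR R) expR) => //.
    apply: measurable_funB; first exact: measurable_funM.
    apply: measurable_funM => //; apply: measurable_funM => //; exact: measurable_funX.
  under eq_integral do rewrite /= ger0_norm ?expR_ge0//.
  by rewrite hZ ltry.
rewrite RintegralZl//; last by apply: RintegrableD; [exact: (iq (- b)).1|exact: (iq b).1].
rewrite RintegralD//; [|exact: (iq (- b)).1|exact: (iq b).1].
rewrite (iq (- b)).2 (iq b).2 sqrrN s2.
have -> : expR (- (e - k / (1 + k * c) * b ^+ 2) / 2) =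
    expR (- e / 2) * expR (2^-1 * b ^+ 2 * (k / (1 + c * k))).
  by rewrite -expRD (mulrC c k); congr expR; field; rewrite gt_eqF// ltr_pwDl// mulr_ge0// ltW.
by field.
Qed.

Lemma rank_op1_dot k g x y : '<<rank_op T [:: (k, g)] x, y>> = k * '<<x, T g>> * '<<T g, y>>.
Proof. by rewrite rank_op_dot big_seq1. Qed.

(* Sherman-Morrison *)
Lemma inv_op_rank_one B c k g : 0 < c -> Sym B -> coercive B c -> 0 <= k ->
  let G := inv_op B in forall y,
  inv_op (B \+ rank_op T [:: (k, g)]) y =
    G y - (k * '<<G y, T g>> / (1 + k * '<<G (T g), T g>>)) *: G (T g).
Proof.
move=> c0 sB cB k0 G y; have [sG BG GB _ _] := inv_opP c0 sB cB.
have pG := inv_op_pos c0 sB cB.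
have sB' : Sym (B \+ rank_op T [:: (k, g)]) by apply: SymD => //; exact: rank_op_Sym.
have cB' : coercive (B \+ rank_op T [:: (k, g)]) c.
  move=> x; rewrite hdotDl rank_op1_dot (hdotC (T g)) -mulrA -expr2.
  by apply: (le_trans (cB x)); rewrite lerDl mulr_ge0 ?sqr_ge0.
have [_ _ GB' _ _] := inv_opP c0 sB' cB'.
have d0 : 1 + k * '<<G (T g), T g>> != 0 by rewrite gt_eqF// ltr_pwDl// mulr_ge0//; exact: pG.2.
set t := _ / _; rewrite -[RHS]GB'; congr inv_op.
have lB := bounded_op_linear sB.1; rewrite /= (linearB_ lB) (linearZ_ lB) !BG.
rewrite /rank_op big_seq1 /= hdotBl hdotZl -addrA.
rewrite (_ : - (t *: T g) + _ = 0) ?addr0//.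
rewrite -scaleNr -scalerDl; apply/eqP; rewrite scaler_eq0; apply/orP; left; apply/eqP.
by rewrite /t -/G; field.
Qed.

Lemma rank_one_density B c k g : 0 < c -> Sym B -> coercive B c -> 0 <= k ->
  exists a : R, is_log_density (nu (inv_op B)) (nu (inv_op (B \+ rank_op T [:: (k, g)])))
    (fun x => - (2^-1 * quad T [:: (k, g)] x) + a).
Proof.
move=> c0 sB cB; rewrite le_eqVlt => /predU1P[<-|k0].
  exists 0; have -> : B \+ rank_op T [:: (0, g)] = B.
    by apply/funext => x /=; rewrite /rank_op big_seq1 /= mul0r scale0r addr0.
  apply: (log_density_eq (log_density_refl _)) => x.
  by rewrite /quad big_seq1 mul0r mulr0 oppr0 addr0.
have pG := inv_op_pos c0 sB cB.
have cG' := inv_op_rank_one g c0 sB cB (ltW k0).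
have sB' : Sym (B \+ rank_op T [:: (k, g)]) by apply: SymD => //; exact: rank_op_Sym.
have cB' : coercive (B \+ rank_op T [:: (k, g)]) c.
  move=> x; rewrite hdotDl rank_op1_dot (hdotC (T g)) -mulrA -expr2.
  by apply: (le_trans (cB x)); rewrite lerDl mulr_ge0 ?sqr_ge0 ?ltW.
have pG' := inv_op_pos c0 sB' cB'.
have [Z Z0 hZ] := gaussian_cos_gauss g pG k0.
(* The first term undoes the centering in [quad]; the second normalizes. *)
exists (- (2^-1 * (k * `|T g| ^+ 2)) - ln Z); apply: log_density_cos => //.
  apply: measurable_funD => //; apply: measurableT_comp => //.
  by apply: measurable_funM => //; exact: measurable_quad.
move=> h a; rewrite (gaussian_cos nuE pG').
rewrite (Rintegral_ext (nu (inv_op B)) _ (fun x => Z^-1 * (cos ('<<x, h>> + a) * expR (- (k * '<<x, g>> ^+ 2 / 2))))); last first.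
  move=> x; rewrite [RHS]mulrCA; congr (_ * _).
  have -> : Z^-1 = expR (- ln Z) by rewrite expRN lnK ?posrE.
  rewrite -expRD; congr expR.
  by rewrite /quad big_seq1 /=; field.
rewrite RintegralZl//; last first.
  apply: (Rintegrable_le (g := cst 1)).
  - apply: measurable_funM; first exact: measurable_cos_hdot.
    apply: measurable_expR_comp; apply: measurableT_comp => //.
    apply: measurable_funM => //; apply: measurable_funM => //; apply: measurable_funX.
    exact: measurable_hdot.
  - move=> x /=; rewrite normrM mulr_ile1 ?cos_norm_le1// ger0_norm ?expR_ge0//.
    rewrite expR_le1 oppr_le0; apply: divr_ge0 => //.
    by apply: mulr_ge0; [exact: ltW|exact: sqr_ge0].
  - exact: finite_measure_integrable_cst.
rewrite hZ mulrA mulVf ?gt_eqF// mul1r; congr (_ * expR _).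
rewrite cG' hdotBl hdotZl.
have -> : '<<inv_op B (T g), T h>> = '<<inv_op B (T h), T g>> by rewrite pG.1.2 hdotC.
have d0 : 1 + k * '<<inv_op B (T g), T g>> != 0.
  by rewrite gt_eqF// ltr_pwDl// mulr_ge0// ?(ltW k0)//; exact: pG.2.
by field.
Qed.

End rank_one.

(** * Finite-rank and Hilbert-Schmidt changes of the inverse covariance *)

Section gaussian_densities.
Context {R : realType} {H : hilbertType R}.
Hypotheses (Hsep : separable H) (Hinf : infinite_dimensional H).
Variables (T : H -> H) (h : nat -> H).
Hypotheses (sT : Sym T) (bh : orthonormal_basis (T \o h)).
Variable nu : (H -> H) -> probability (borel H) R.
Hypothesis nuE : forall G, SymPos G -> forall (k : H) (A : set R), measurable A ->
  nu G [set x : H | A '<<x, k>>] = centered_normal '<<G (T k), T k>> A.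
Implicit Types (B G V W : H -> H) (l : seq (R * H)).

Lemma rank_op_pos l x : (forall p, p \in l -> 0 <= p.1) -> 0 <= '<<rank_op T l x, x>>.
Proof.
move=> l0; rewrite rank_op_dot big_seq sumr_ge0// => p /l0 p0.
by rewrite (hdotC (T p.2)) -mulrA -expr2 mulr_ge0// sqr_ge0.
Qed.

(** Nonnegative weights preserve the lower bound [c], so every intermediate operator is invertible
    and the rank-one steps can be chained. *)
Lemma nonneg_list_density B c l : 0 < c -> Sym B -> coercive B c ->
  (forall p, p \in l -> 0 <= p.1) ->
  exists a : R, is_log_density (nu (inv_op B)) (nu (inv_op (B \+ rank_op T l)))
    (fun x => - (2^-1 * quad T l x) + a).
Proof.
move=> c0; elim: l B => [|[k g] l ih] B sB cB l0.
  exists 0; have -> : B \+ rank_op T [::] = B.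
    by apply/funext => x /=; rewrite rank_op_nil addr0.
  apply: (log_density_eq (log_density_refl _)) => x.
  by rewrite /quad big_nil mulr0 oppr0 addr0.
have k0 : 0 <= k by apply: (l0 (k, g)); rewrite inE eqxx.
have [a1 h1] := rank_one_density Hsep Hinf sT nuE g c0 sB cB k0.
have sB' : Sym (B \+ rank_op T [:: (k, g)]) by apply: SymD => //; exact: rank_op_Sym.
have cB' : coercive (B \+ rank_op T [:: (k, g)]) c.
  move=> x; rewrite hdotDl; apply: (le_trans (cB x)); rewrite lerDl rank_op_pos// => p.
  by rewrite inE => /eqP ->.
have [|a2 h2] := ih _ sB' cB'; first by move=> p pl; apply: l0; rewrite inE pl orbT.
exists (a1 + a2); have -> : B \+ rank_op T ((k, g) :: l) = (B \+ rank_op T [:: (k, g)]) \+ rank_op T l.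
  by apply/funext => x /=; rewrite !rank_op_cons rank_op_nil /= addr0 addrA.
apply: (log_density_eq (log_density_trans h1 h2)) => x.
by rewrite /quad !big_cons big_nil; ring.
Qed.

Lemma inv_op_idfun : inv_op (idfun : H -> H) = idfun.
Proof.
have c1 : coercive (idfun : H -> H) 1 by move=> x; rewrite mul1r sqr_normE.
by have [_ /= h1 _ _ _] := inv_opP ltr01 Sym_id c1; apply/funext => x; rewrite [LHS]h1.
Qed.

Let pos l := [seq p <- l | 0 <= p.1].
Let neg l := [seq (- p.1, p.2) | p <- l & ~~ (0 <= p.1)].

Let rank_op_split l : rank_op T l \+ rank_op T (neg l) = rank_op T (pos l).
Proof.
apply/funext => x; rewrite /rank_op /= big_map !big_filter.
rewrite [X in X + _](bigID (fun p => 0 <= p.1)) /= -addrA -big_split /= [X in _ + X]big1 ?addr0// => p _.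
by rewrite mulNr scaleNr subrr.
Qed.

Let quad_split l x : quad T l x + quad T (neg l) x = quad T (pos l) x.
Proof.
rewrite /quad /= big_map !big_filter.
rewrite [X in X + _](bigID (fun p => 0 <= p.1)) /= -addrA -big_split /= [X in _ + X]big1 ?addr0// => p _.
by rewrite mulNr subrr.
Qed.

(** With negative weights an intermediate operator could fail to be invertible. So the identity is
    raised by the nonnegative part of [l], and the target by the opposite of the negative part; both
    arrive at the same operator, and the two densities are composed through it. *)
Lemma list_density l c : 0 < c -> coercive (idfun \+ rank_op T l) c ->
  exists a : R, is_log_density (nu idfun) (nu (inv_op (idfun \+ rank_op T l)))
    (fun x => - (2^-1 * quad T l x) + a).
Proof.
move=> c0 cl; have sl : Sym (idfun \+ rank_op T l).
  by apply: SymD; [exact: Sym_id|exact: rank_op_Sym].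
have c1 : coercive (idfun : H -> H) 1 by move=> x; rewrite mul1r sqr_normE.
have [|a1] := @nonneg_list_density idfun 1 (pos l) ltr01 Sym_id c1.
  by move=> p; rewrite mem_filter => /andP[].
rewrite inv_op_idfun => h1.
have [|a2] := @nonneg_list_density _ c (neg l) c0 sl cl.
  move=> p /mapP[q]; rewrite mem_filter -ltNge => /andP[q0 _] ->.
  by rewrite oppr_ge0 ltW.
have -> : (idfun \+ rank_op T l) \+ rank_op T (neg l) = idfun \+ rank_op T (pos l).
  by rewrite -rank_op_split; apply/funext => x /=; rewrite addrA.
move=> h2; exists (a1 - a2).
apply: (log_density_eq (log_density_trans h1 (log_density_sym h2))) => x.
by rewrite -(quad_split l); ring.
Qed.

(** For [u] and [v] log densities, the two terms on the right integrate to means of |u - v| under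
    the two measures: an L^1 distance of densities is controlled by the exponents alone. *)
Lemma expRB_le (u v : R) : `|expR u - expR v| <= `|u - v| * expR u + `|u - v| * expR v.
Proof.
wlog uv : u v / v <= u.
  move=> hw; have [/hw //|/ltW /hw] := leP v u.
  by rewrite (distrC (expR v)) (distrC v) (addrC (_ * expR v)).
rewrite !ger0_norm ?subr_ge0 ?ler_expR//.
have h1 : 1 + (v - u) <= expR (v - u) by exact: expR_ge1Dx.
have h2 : expR v = expR u * expR (v - u) by rewrite -expRD addrC subrK.
have := expR_gt0 u; have := expR_gt0 v.
have : 0 <= u - v by rewrite subr_ge0.
rewrite {3}h2; nra.
Qed.

(** Convergence of the exponents in L^2 of the reference measure would not by itself give
    convergence of the densities. The L^2 estimates on [quad] are uniform over the approximating
    measures [nu (Gn n)], which makes the densities Cauchy in L^1; the limit measure is recognized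
    by its characteristic function. *)
Lemma gaussian_density G c : 0 < c -> Sym G -> coercive G c -> SymHS (inv_op G \- idfun) ->
  exists a : R, is_log_density (nu idfun) (nu G)
    (fun x => - (2^-1 * qform T (inv_op G \- idfun) x) + a).
Proof.
move=> c0 sG cG; set B := inv_op G; set W := B \- idfun => sW.
have pG : SymPos G by split => // x; apply: le_trans (cG x); rewrite mulr_ge0 ?sqr_ge0// ltW.
have [sB GB BG _ [b b0 cB]] := inv_opP c0 sG cG; rewrite -/B in sB GB BG cB.
have lB := bounded_op_linear sB.1; have lG := bounded_op_linear sG.1.
have half1 : `|2^-1 : R| < 1 by rewrite ger0_norm ?invr_ge0//; lra.
(* Skipping [N] approximations keeps every [Bn n] above half the lower bound of [B], so that the
   inverses [Gn n] share the bound [M]. *)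
have [N hN] : exists N, 2^-1 ^+ N <= b / 2 :> R.
  have /cvgrPdist_lt/(_ (b / 2)) [|N _ hN] := @cvg_expr R _ half1; first by rewrite divr_gt0.
  exists N; have := hN N (leqnn N); rewrite /= sub0r normrN ger0_norm ?exprn_ge0//.
  exact: ltW.
pose e n : R := 2^-1 ^+ n.
have e0 n : 0 <= e n by rewrite exprn_ge0.
have eS n m : e (n + m)%N <= e n by rewrite /e exprD ler_piMr ?exprn_ge0// exprn_ile1//; lra.
pose l n := approx T W (n + N).
have hl n : HS (rank_op T (l n)) by exact: rank_op_HS.
have lW n : hsn (W \- rank_op T (l n)) <= e n /\ hsn (W \- rank_op T (l n)) <= b / 2.
  have h1 := approxP Hsep Hinf sT bh (n + N) sW; split; first exact: le_trans h1 (eS n N).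
  by apply: (le_trans h1); apply: le_trans hN; rewrite addnC; exact: (eS N n).
pose Bn n := idfun \+ rank_op T (l n).
have sBn n : Sym (Bn n) by apply: SymD; [exact: Sym_id|exact: rank_op_Sym].
have BBn n : B \- Bn n = W \- rank_op T (l n).
  by apply/funext => x; rewrite /Bn /W /= opprD addrA.
have b20 : 0 < b / 2 by rewrite divr_gt0.
have cBn n : coercive (Bn n) (b / 2).
  move=> x; have := cB x; have -> : B x = (B \- Bn n) x + Bn n x by rewrite /= subrK.
  rewrite hdotDl BBn; have := CauchySchwarz ((W \- rank_op T (l n)) x) x.
  have := HS_bnd Hsep Hinf (HSB Hsep Hinf sW.2 (hl n)) x.
  set Z := (W \- _) x; move=> h1; rewrite ler_norml => /andP[_ h2] h3.
  have h4 : `|Z| * `|x| <= b / 2 * `|x| ^+ 2.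
    rewrite expr2 mulrA ler_wpM2r// (le_trans h1)// ler_wpM2r//; exact: (lW n).2.
  by move: (hdot _ _) (hdot _ _) (`|Z| * _) (`|x| ^+ 2) h2 h3 h4 => y z w t; lra.
pose Gn n := inv_op (Bn n); pose M := (b / 2)^-1.
have M0 : 0 <= M by rewrite invr_ge0 ltW.
have Gp n : SymPos (Gn n) by exact: inv_op_pos b20 (sBn n) (cBn n).
have Gb n : bnd (Gn n) M by have [] := inv_opP b20 (sBn n) (cBn n).
have GBn n x : Gn n (Bn n x) = x.
  by have [_ _ hx _ _] := inv_opP b20 (sBn n) (cBn n); exact: hx.
have IG n : idfun \- Gn n = Gn n \o rank_op T (l n).
  apply/funext => x /=; rewrite -[X in X - _](GBn n) /Bn /=.
  by rewrite (linearD_ (bounded_op_linear (Gp n).1.1)) addrAC subrr add0r.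
have IGHS n : HS (idfun \- Gn n) /\ hsn (idfun \- Gn n) <= M * hsn (rank_op T (l n)).
  by rewrite IG; have := HS_compl Hsep Hinf M0 (Gp n).1.1 (Gb n) (hl n).
pose K := M * (hsn W + 1) + 2 * M.
have opl n : hsn (rank_op T (l n)) <= hsn W + 1.
  have -> : rank_op T (l n) = W \- (W \- rank_op T (l n)).
    by apply/funext => x /=; rewrite opprB addrC subrK.
  apply: (le_trans (hsnB Hsep Hinf sW.2 (HSB Hsep Hinf sW.2 (hl n)))).
  rewrite lerD2l (le_trans (lW n).1)// exprn_ile1//; lra.
have qbK n : quad_bound (Gn n) M <= K.
  rewrite /quad_bound /K lerD2r; apply: (le_trans (IGHS n).2).
  by rewrite ler_wpM2l.
have K0 : 0 <= K by apply: le_trans (qbK 0%N); exact: quad_bound_ge0.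
have sq n p : sqint (nu (Gn n)) (quad T (l p)) by exact: (quad_sqint nuE (Gp n)).
have dq n p q : l2 (nu (Gn n)) (fun x => quad T (l p) x - quad T (l q) x) <= K * (e p + e q).
  apply: (le_trans (quadB_l2 Hsep Hinf sT nuE (Gp n) (IGHS n).1 M0 (Gb n) (l p) (l q))).
  apply: ler_pM => //; [exact: quad_bound_ge0|exact: hsn_ge0|].
  apply: (le_trans (hsn_tri Hsep Hinf (hl p) sW.2 (hl q))).
  by rewrite (hsn_sym Hsep Hinf (hl p) sW.2) lerD// (lW _).1.
have [a ha] := (@choice _ _ (fun n a => is_log_density (nu idfun) (nu (Gn n))
    (fun x => - (2^-1 * quad T (l n) x) + a)) (fun n => list_density b20 (cBn n))).
pose L n x := - (2^-1 * quad T (l n) x) + a n.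
(* Jensen under [nu (Gn n)] for the density of [nu (Gn m)]: the difference of the constants is at
   most half the mean of a form that is small in L^2. Exchanging [n] and [m] bounds the absolute
   value. *)
have ale n m : a m - a n <= 2^-1 * (K * (e m + e n)).
  have hd := log_density_trans (log_density_sym (ha n)) (ha m).
  have sd := sqintB (sq n m) (sq n n).
  have E x : - (- (2^-1 * quad T (l n) x) + a n) + (- (2^-1 * quad T (l m) x) + a m) =
     - 2^-1 * (quad T (l m) x - quad T (l n) x) + (a m - a n) by ring.
  have hd' := log_density_eq hd E.
  have i1 := RintegrableZ (- 2^-1) (sqint_integrable sd).
  have ic : (nu (Gn n)).-integrable setT (EFin \o cst (a m - a n)).
    exact: finite_measure_integrable_cst.
  have := log_density_mean_le0 hd' (RintegrableD i1 ic).
  rewrite RintegralD// RintegralZl//; last exact: sqint_integrable.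
  rewrite Rintegral_cst_prob.
  have := le_trans (mean_le_l2 sd) (dq n m n); rewrite ler_norml => /andP[_].
  by move: (Rintegral _ _ _) => I; lra.
have da n m : `|a m - a n| <= 2^-1 * (K * (e m + e n)).
  by rewrite ler_norml ale andbT lerNl opprB (addrC (e m)); exact: ale.
have /cvg_ex[a' aa] : cvgn a.
  apply: (@cauchy_rate_cvg R R^o a (fun n => K * e n)).
    by rewrite -[X in _ --> X](mulr0 K); apply: cvgMr; exact: cvg_expr.
  move=> m n mn; apply: (le_trans (da _ _)).
  have : K * e n <= K * e m by rewrite ler_wpM2l// -(subnKC mn); exact: eS.
  lra.
exists a'; pose Lx x := - (2^-1 * qform T W x) + a'.
have sid : SymPos (idfun : H -> H) by split; [exact: Sym_id|move=> x; exact: hdot_ge0].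
have hid : HS ((idfun : H -> H) \- idfun).
  by have -> : (idfun : H -> H) \- idfun = \0; [apply/funext => x /=; rewrite subrr|exact: HS0].
have bid : bnd (idfun : H -> H) 1 by move=> x; rewrite mul1r.
have sqI := qform_sqint Hsep Hinf sT bh nuE sid hid ler01 bid sW.
have mL n : @measurable_fun _ _ (borel H) (measurableTypeR R) setT (L n) by exact: (ha n).1.
have mLx : @measurable_fun _ _ (borel H) (measurableTypeR R) setT Lx.
  apply: measurable_funD => //; apply: measurableT_comp => //; apply: measurable_funM => //.
  exact: sqI.1.
have LL : {ae nu idfun, forall x, L ^~ x @ \oo --> Lx x}.
  have := qform_ae_cvg Hsep Hinf sT bh nuE sid hid ler01 bid sW.
  apply: (ae_mono (nu idfun)) => x hx; apply: cvgD => //; apply: cvgN; apply: cvgM; first exact: cvg_cst.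
  by move: hx; rewrite -(cvg_shiftn N).
have iL n : (nu idfun).-integrable setT (EFin \o (fun x => expR (L n x))).
  exact: log_density_expR_integrable (ha n).
have meL n := measurable_expR_comp (mL n); have meLx := measurable_expR_comp mLx.
have dL n m : (n <= m)%N -> \int[nu idfun]_x `|expR (L n x) - expR (L m x)| <= 4 * K * e n.
  move=> nm; have em : e m <= e n by rewrite -(subnKC nm); exact: eS.
  have hLL p : sqint (nu (Gn p)) (fun x => L n x - L m x) /\
      l2 (nu (Gn p)) (fun x => L n x - L m x) <= 2 * K * e n.
    have sd := sqintB (sq p n) (sq p m).
    have sd' := sqintZ (- 2^-1) sd; have sc := sqint_cst (nu (Gn p)) (a n - a m).
    have E : (fun x => L n x - L m x) =
        fun x => - 2^-1 * (quad T (l n) x - quad T (l m) x) + cst (a n - a m) x.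
      by apply/funext => x; rewrite /L /=; ring.
    rewrite E; split; first exact: sqintD.
    apply: (le_trans (l2D sd' sc)); rewrite l2Z// l2_cst normrN ger0_norm ?invr_ge0//.
    have := dq p n m; have := da m n; nra.
  have mabs : @measurable_fun _ _ (borel H) (measurableTypeR R) setT (fun x => `|L n x - L m x|).
    by apply: measurableT_comp => //; exact: (hLL 0%N).1.1.
  have i1 p : (nu (Gn p)).-integrable setT (EFin \o (fun x => `|L n x - L m x|)).
    exact/Rintegrable_abs/sqint_integrable/(hLL p).1.
  have i2 p := (log_density_integrable (ha p) mabs).1 (i1 p).
  apply: (@le_trans _ _ (\int[nu idfun]_x (`|L n x - L m x| * expR (L n x) + `|L n x - L m x| * expR (L m x)))).
    apply: le_Rintegral => //.
    + by apply: Rintegrable_abs; exact: RintegrableB.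
    + by apply: RintegrableD; exact: i2.
    + by move=> x _; exact: expRB_le.
  rewrite RintegralD//; [|exact: i2|exact: i2].
  rewrite -(log_density_Rintegral (ha n) mabs) -(log_density_Rintegral (ha m) mabs).
  have := le_trans (abs_mean_le_l2 (hLL n).1) (hLL n).2.
  have := le_trans (abs_mean_le_l2 (hLL m).1) (hLL m).2.
  lra.
(* Fatou in [m] replaces [L m] by its almost everywhere limit. *)
have fat n : (nu idfun).-integrable setT (EFin \o (fun x => `|expR (L n x) - expR (Lx x)|)) /\
    \int[nu idfun]_x `|expR (L n x) - expR (Lx x)| <= 4 * K * e n.
  apply: (@fatou_le _ _ _ (nu idfun) (fun m x => `|expR (L n x) - expR (L m x)|)).
  - by move=> m; apply: measurableT_comp => //; exact: (@measurable_funB _ (borel H) R _ _ _ (meL n) (meL m)).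
  - by apply: measurableT_comp => //; exact: (@measurable_funB _ (borel H) R _ _ _ (meL n) meLx).
  - by [].
  - by [].
  - apply: (ae_mono (nu idfun)) LL => x hx; apply: cvg_norm; apply: cvgB; first exact: cvg_cst.
    by apply: continuous_cvg => //; exact: continuous_expR.
  - by move=> m; apply: Rintegrable_abs; exact: RintegrableB.
  - by exists n => // m /= nm; exact: dL.
have iLx : (nu idfun).-integrable setT (EFin \o (fun x => expR (Lx x))).
  apply: (@Rintegrable_le _ (borel H) R (nu idfun) _ (fun x => `|expR (L 0%N x) - expR (Lx x)| + expR (L 0%N x))).
  - exact: meLx.
  - move=> x; rewrite ger0_norm ?expR_ge0//.
    have := ler_norm (expR (Lx x) - expR (L 0%N x)); rewrite distrC; lra.
  - by apply: RintegrableD => //; exact: (fat 0%N).1.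
apply: log_density_cos => // k t.
have icos f : @measurable_fun _ _ (borel H) (measurableTypeR R) setT f ->
    (nu idfun).-integrable setT (EFin \o (fun x => expR (f x))) ->
    (nu idfun).-integrable setT (EFin \o (fun x => cos ('<<x, k>> + t) * expR (f x))).
  move=> mf i; apply: (@Rintegrable_le _ (borel H) R (nu idfun) _ (fun x => expR (f x))) i.
    exact: (@measurable_funM _ (borel H) R _ _ _ (measurable_cos_hdot k t) (measurable_expR_comp mf)).
  by move=> x; rewrite normrM (ger0_norm (expR_ge0 _)) ler_piMl ?expR_ge0// cos_norm_le1.
have h1 : (fun n => \int[nu (Gn n)]_x cos ('<<x, k>> + t)) @ \oo -->
    \int[nu G]_x cos ('<<x, k>> + t).
  rewrite (gaussian_cos nuE pG); under eq_fun do rewrite (gaussian_cos nuE (Gp _)).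
  apply: cvgM; first exact: cvg_cst.
  apply: continuous_cvg; first exact: continuous_expR.
  apply: cvgN; apply: cvgM; last exact: cvg_cst.
  apply: (@cvg_of_geometric _ _ _ (M * `|G (T k)| * `|T k|)) => n.
  rewrite -hdotBl.
  (* The resolvent identity for the inverses of [Bn n] and [B]. *)
  have -> : Gn n (T k) - G (T k) = Gn n ((B \- Bn n) (G (T k))).
    rewrite /= (linearB_ (bounded_op_linear (Gp n).1.1)) BG GBn//.
  apply: (le_trans (CauchySchwarz _ _)); rewrite [leRHS]mulrAC ler_wpM2r//.
  apply: (le_trans (Gb n _)); rewrite -mulrA ler_wpM2l// BBn [leRHS]mulrC.
  apply: (le_trans (HS_bnd Hsep Hinf (HSB Hsep Hinf sW.2 (hl n)) _)).
  by rewrite ler_wpM2r// (lW n).1.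
have h2 : (fun n => \int[nu (Gn n)]_x cos ('<<x, k>> + t)) @ \oo -->
    \int[nu idfun]_x (cos ('<<x, k>> + t) * expR (Lx x)).
  under eq_fun do rewrite (log_density_Rintegral (ha _) (measurable_cos_hdot k t)).
  apply: (@cvg_of_geometric _ _ _ (4 * K)) => n.
  have ci := RintegrableB (icos _ (mL n) (iL n)) (icos _ mLx iLx).
  rewrite -(RintegralB measurableT (icos _ (mL n) (iL n)) (icos _ mLx iLx)).
  apply: le_trans (fat n).2.
  apply: (le_trans (le_normr_Rintegral measurableT ci)).
  apply: le_Rintegral => //.
  - exact: Rintegrable_abs ci.
  - exact: (fat n).1.
  - by move=> x _; rewrite -mulrBr normrM ler_piMl// cos_norm_le1.
exact: (cvg_unique _ h1 h2).
Qed.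

End gaussian_densities.

(** * The score *)

Section log_density_Radon_Nikodym.
Context {R : realType} {H : hilbertType R}.
Variables (P Q : probability (borel H) R) (f : H -> R).
Hypothesis fPQ : is_log_density P Q f.

Lemma log_density_ae : {ae P, forall x : borel H, log_density Q P x = f x}.
Proof.
have QP := log_density_dominates fPQ; have [mf QE] := fPQ.
have me : measurable_fun setT (fun x : borel H => (expR (f x))%:E).
  by apply/measurable_EFinP; exact: (measurable_expR_comp mf).
have h : ae_eq P setT (Radon_Nikodym (charge_of_finite_measure Q) P) (fun x => (expR (f x))%:E).
  apply: integral_ae_eq => //; first exact: Radon_Nikodym_integrable.
  by move=> E _ mE; rewrite -Radon_Nikodym_integral//= -QE.
apply: (ae_mono P) h => x h; rewrite /log_density h//= expRK//.
Qed.

Lemma measurable_log_density :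
  @measurable_fun _ _ (borel H) (measurableTypeR R) setT (log_density Q P).
Proof.
have QP := log_density_dominates fPQ.
apply: (@measurableT_comp _ _ _ (borel H) (measurableTypeR R) (measurableTypeR R) (@ln R)) => //.
apply: (@measurableT_comp _ _ _ (borel H) _ (measurableTypeR R) fine) => //.

Qed.

End log_density_Radon_Nikodym.

Lemma dominates_ae d (X : measurableType d) {R : realType} (P Q : {measure set X -> \bar R})
    (A : X -> Prop) : Q `<< P -> {ae P, forall x, A x} -> {ae Q, forall x, A x}.
Proof.
move=> /null_content_dominatesP QP [N [mN PN hN]]; exists N; split => //.
exact: QP.
Qed.

Lemma mean_affine_product d (X : measurableType d) {R : realType} (P : probability X R)
    (v w m m' q : R) (f g : X -> R) : sqint P f -> sqint P g ->
  \int[P]_x f x = m -> \int[P]_x g x = m' -> \int[P]_x (f x * g x) = q ->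
  \int[P]_x (- (2^-1 * (f x + v)) * - (2^-1 * (g x + w))) =
  4^-1 * (q + w * m + v * m' + v * w).
Proof.
move=> sf sg <- <- <-; have i1 := sqint_mul sf sg.
have i2 := RintegrableZ w (sqint_integrable sf); have i3 := RintegrableZ v (sqint_integrable sg).
have ic : P.-integrable setT (EFin \o cst (v * w)) by exact: finite_measure_integrable_cst.
have j1 := RintegrableD i1 i2; have j2 := RintegrableD j1 i3.
rewrite (Rintegral_ext P _ (fun x => 4^-1 * (f x * g x + w * f x + v * g x + cst (v * w) x))).
  rewrite (RintegralZl _ measurableT (RintegrableD j2 ic)) (RintegralD measurableT j2 ic).
  rewrite (RintegralD measurableT j1 i3) (RintegralD measurableT i1 i2).
  rewrite (Rintegral_cst_prob P (v * w)).
  by rewrite !RintegralZl//; [exact: sqint_integrable..].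
by move=> x /=; field.
Qed.

Section fisher_rao.
Context {R : realType} {H : hilbertType R}.
Hypotheses (Hsep : separable H) (Hinf : infinite_dimensional H).
Variables (T : H -> H) (h : nat -> H).
Hypotheses (sT : Sym T) (bh : orthonormal_basis (T \o h)).
Variable nu : (H -> H) -> probability (borel H) R.
Hypothesis nuE : forall G, SymPos G -> forall (k : H) (A : set R), measurable A ->
  nu G [set x : H | A '<<x, k>>] = centered_normal '<<G (T k), T k>> A.
Implicit Types (S V W : H -> H).

Lemma bounded_op_bnd (A : H -> H) : bounded_op A -> exists2 M : R, 0 <= M & bnd A M.
Proof. by move=> /bounded_opP[_]. Qed.

Lemma SymHS_D V W : SymHS V -> SymHS W -> SymHS (V \+ W).
Proof. by move=> [sV hV] [sW hW]; split; [exact: SymD|exact: HSD]. Qed.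

Lemma SymHS_Z (a : R) V : SymHS V -> SymHS (a \*: V).
Proof. by move=> [sV hV]; split; [exact: SymZ|exact: (HSZ Hsep Hinf a hV).1]. Qed.

Lemma SymHS_N V : SymHS V -> SymHS (\- V).
Proof. by move=> [sV hV]; split; [exact: SymN|exact: HSN]. Qed.

Lemma SymHS_conj B V : Sym B -> SymHS V -> SymHS (B \o V \o B).
Proof.
move=> sB [sV hV]; split; first exact: Sym_conj.
have [M M0 bM] := bounded_op_bnd sB.1.
have [h1 _] := HS_compr Hsep Hinf M0 sB.1 bM hV.
by have [] := HS_compl Hsep Hinf M0 sB.1 bM h1.
Qed.

Lemma coercive_perturb A V c : coercive A c -> HS V -> hsn V <= c / 2 ->
  coercive (A \- V) (c / 2).
Proof.
move=> cA hV Vc x; rewrite hdotBl.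
have := CauchySchwarz (V x) x; rewrite ler_norml => /andP[_ h1].
have h2 := HS_bnd Hsep Hinf hV x.
have h3 : `|V x| * `|x| <= c / 2 * `|x| ^+ 2.
  by rewrite expr2 mulrA ler_wpM2r// (le_trans h2)// ler_wpM2r.
have := cA x; move: (hdot _ _) (hdot _ _) h1 => y z h1.
by move: (`|V x| * _) (`|x| ^+ 2) h1 h3 => w t; lra.
Qed.

(** With B the inverse of I - S, one has B - I = B S, and the Hilbert-Schmidt operators form an
    ideal. *)
Lemma SymHS_ltI_adm S : SymHS_ltI S -> exists c : R,
  [/\ 0 < c, Sym (idfun \- S), coercive (idfun \- S) c &
      SymHS (inv_op (idfun \- S) \- idfun)].
Proof.
move=> hS; have [c c0 cG] := SymHS_ltI_coercive Hsep Hinf hS.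
have [[sS hsS] _] := hS.
have sG : Sym (idfun \- S) by apply: SymB => //; exact: Sym_id.
exists c; split => //; split.
  by apply: SymB; [by have [] := inv_opP c0 sG cG|exact: Sym_id].
have [sB _ BG bB _] := inv_opP c0 sG cG.
have -> : inv_op (idfun \- S) \- idfun = inv_op (idfun \- S) \o S.
  apply/funext => x /=; rewrite -[X in _ - X](BG x) /=.
  rewrite (linearB_ (bounded_op_linear sB.1)) opprB addrC subrK//.
have ci : 0 <= c^-1 by rewrite invr_ge0 ltW.
by have [] := HS_compl Hsep Hinf ci sB.1 bB hsS.
Qed.

Lemma coercive_SymHS_ltI S c : 0 < c -> SymHS S -> coercive (idfun \- S) c -> SymHS_ltI S.
Proof.
move=> c0 [sS hS] cG; split => //; split; first by apply: SymB => //; exact: Sym_id.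
move=> x x0; rewrite hdotC; apply: lt_le_trans (cG x).
by rewrite mulr_gt0// exprn_gt0// normr_gt0.
Qed.

(** Needed because [score] is an arbitrary choice among derivatives. Both remainders are evaluated
    at a small multiple t V, and division by t leaves a bound on the L^2 distance valid for every
    [eps]. *)
Lemma frechet_derivative_unique (P : probability (borel H) R) (F : (H -> H) -> H -> R) S D D' V :
  SymHS_ltI S -> is_frechet_derivative P F S D -> is_frechet_derivative P F S D' ->
  SymHS V -> {ae P, forall x : borel H, D V x = D' V x}.
Proof.
move=> hS [F2 D2 Dlin _ Drem] [_ D2' Dlin' _ Drem'] sV.
have sqF W : SymHS_ltI W -> sqint P (F W) by move=> /F2 /Lfun_sqint.
have sqD W : SymHS W -> sqint P (D W) by move=> /D2 /Lfun_sqint.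
have sqD' W : SymHS W -> sqint P (D' W) by move=> /D2' /Lfun_sqint.
have s0 : SymHS (\0 : H -> H).
  have -> : (\0 : H -> H) = 0 \*: V by apply/funext => x /=; rewrite scale0r.
  exact: SymHS_Z.
have hom (E : (H -> H) -> H -> R) (t : R) : (forall (a : R) V W, SymHS V -> SymHS W ->
    {ae P, forall x : borel H, E (a \*: V \+ W) x = a * E V x + E W x}) ->
    {ae P, forall x : borel H, E (t \*: V) x = t * E V x}.
  (* Linearity at the zero operator reads E 0 = E 0 + E 0 almost everywhere; once E 0 vanishes,
     homogeneity follows. *)
  move=> El; have e1 := El 1 \0 \0 s0 s0; have e2 := El t V \0 sV s0.
  apply: (ae_mono2 P) e1 e2 => x.
  have -> : 1 \*: (\0 : H -> H) \+ \0 = \0 by apply/funext => y /=; rewrite scaler0 addr0.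
  have -> : t \*: V \+ \0 = t \*: V by apply/funext => y /=; rewrite addr0.
  by move: (E \0 x) => z; rewrite mul1r => hz ->; lra.
pose E x := D V x - D' V x.
have sE : sqint P E by apply: sqintB; [exact: sqD|exact: sqD'].
have [[c [c0 sG cG _]] [sS _]] := (SymHS_ltI_adm hS, hS).
have small eps : 0 < eps -> l2 P E <= 2 * eps * hsn V.
  move=> eps0; have [d d0 hd] := Drem _ eps0; have [d' d'0 hd'] := Drem' _ eps0.
  (* The bound [c / 2] keeps S + t V inside [SymHS_ltI]. *)
  pose m := Num.min (Num.min d d') (c / 2).
  have m0 : 0 < m by rewrite !lt_min d0 d'0 divr_gt0.
  have v1 : 0 < hsn V + 1 by rewrite ltr_wpDl// hsn_ge0.
  pose t := m / (hsn V + 1); have t0 : 0 < t by rewrite divr_gt0.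
  have ntV : hsn (t \*: V) = t * hsn V by rewrite (hsnZ Hsep Hinf t sV.2) gtr0_norm.
  have ltm : hsn (t \*: V) < m.
    by rewrite ntV /t mulrAC ltr_pdivrMr// ltr_pM2l// ltrDl.
  have stV := SymHS_Z t sV.
  have hS' : SymHS_ltI (S \+ t \*: V).
    apply: (@coercive_SymHS_ltI _ (c / 2)); [by rewrite divr_gt0|exact: SymHS_D|].
    have -> : idfun \- (S \+ t \*: V) = (idfun \- S) \- t \*: V.
      by apply/funext => x /=; rewrite opprD addrA.
    apply: coercive_perturb => //; first exact: stV.2.
    by apply: (le_trans (ltW ltm)); rewrite ge_min lexx orbT.
  have nt : hs_norm (t \*: V) = t * hsn V by rewrite (hs_normE Hsep Hinf stV.2).
  have ld : hs_norm (t \*: V) < d.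
    by rewrite nt -ntV (lt_le_trans ltm)// !ge_min lexx.
  have ld' : hs_norm (t \*: V) < d'.
    by rewrite nt -ntV (lt_le_trans ltm)// !ge_min lexx orbT.
  have r1 := hd _ stV hS' ld; have r2 := hd' _ stV hS' ld'.
  have q1 := sqintB (sqintB (sqF _ hS') (sqF _ hS)) (sqD _ stV).
  have q2 := sqintB (sqintB (sqF _ hS') (sqF _ hS)) (sqD' _ stV).
  rewrite /L2norm (L2norm_l2 q1) nt in r1; rewrite /L2norm (L2norm_l2 q2) nt in r2.
  have r3 := le_trans (l2B q2 q1) (lerD r2 r1).
  have tE : {ae P, forall x : borel H, t * E x = (F (S \+ t \*: V) x - F S x - D' (t \*: V) x) -
     (F (S \+ t \*: V) x - F S x - D (t \*: V) x)}.
    apply: (ae_mono2 P) (hom D t Dlin) (hom D' t Dlin') => x -> ->; rewrite /E.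
    by move: (F _ x) (F _ x) (D V x) (D' V x) => *; ring.
  have := l2_ae_eq (sqintZ t sE).1 (sqintB q2 q1).1 tE.
  rewrite (l2Z _ sE) gtr0_norm// => h1; rewrite -h1 in r3.
  rewrite -(ler_pM2l t0); apply: (le_trans r3).
  by rewrite le_eqVlt; apply/orP; left; apply/eqP; ring.
have l0 : l2 P E = 0.
  apply/eqP; rewrite eq_le l2_ge0 andbT leNgt; apply/negP => y0.
  have v1 : 0 < hsn V + 1 by rewrite ltr_wpDl// hsn_ge0.
  (* This choice makes the bound equal to the norm of [E] times hsn V / (2 (hsn V + 1)), a factor
     below 1. *)
  have := small (l2 P E / (4 * (hsn V + 1))) (divr_gt0 y0 (mulr_gt0 _ v1)).
  move=> /(_ (ltr0n _ _)); rewrite leNgt => /negP; apply.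
  rewrite [X in X < _](_ : _ = l2 P E * (hsn V / (2 * (hsn V + 1)))); last first.
    by field; rewrite gt_eqF.
  rewrite gtr_pMr// ltr_pdivrMr ?mulr_gt0// mul1r; have := hsn_ge0 V; lra.
apply: (ae_mono P) (l2_eq0 sE l0) => x /eqP; rewrite /E subr_eq0 => /eqP//.
Qed.

Definition llik S : H -> R := log_density (nu (idfun \- S)) (nu idfun).

Definition log_quad S (a : R) (x : H) : R :=
  - (2^-1 * qform T (inv_op (idfun \- S) \- idfun) x) + a.

Lemma log_quad_density S : SymHS_ltI S ->
  exists a, is_log_density (nu idfun) (nu (idfun \- S)) (log_quad S a).
Proof.
move=> /SymHS_ltI_adm[c [c0 sG cG sW]].
exact: (gaussian_density Hsep Hinf sT bh nuE c0 sG cG sW).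
Qed.

Section at_point.
Variable S : H -> H.
Hypothesis hS : SymHS_ltI S.
Let G := idfun \- S.
Let B := inv_op G.
Local Notation P := (nu (idfun \- S)).

Let sG : Sym G. Proof. by have [c []] := SymHS_ltI_adm hS. Qed.

Let pG : SymPos G.
Proof.
have [c [c0 _ cG _]] := SymHS_ltI_adm hS; split => // x.
by apply: le_trans (cG x); rewrite mulr_ge0 ?sqr_ge0// ltW.
Qed.

Let IG : idfun \- G = S.
Proof. by apply/funext => x; rewrite /G /= opprB addrC subrK. Qed.

Let hG : HS (idfun \- G). Proof. by rewrite IG; exact: hS.1.2. Qed.

Let M : R := xget 0 [set M | 0 <= M /\ bnd G M].

Let MP : 0 <= M /\ bnd G M.
Proof.
have [m m0 bm] := bounded_op_bnd sG.1.
by apply: (@xgetPex _ _ [set M | 0 <= M /\ bnd G M]); exists m.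
Qed.

Let M0 : 0 <= M. Proof. exact: MP.1. Qed.

Let bG : bnd G M. Proof. exact: MP.2. Qed.

Let sB : Sym B.
Proof. by have [c [c0 _ cG _]] := SymHS_ltI_adm hS; have [] := inv_opP c0 sG cG. Qed.

Let lB : linear B. Proof. exact: bounded_op_linear sB.1. Qed.

Let BGK x : B (G x) = x.
Proof. by have [c [c0 _ cG _]] := SymHS_ltI_adm hS; have [_ _ hx _ _] := inv_opP c0 sG cG; exact: hx. Qed.

Let GBK x : G (B x) = x.
Proof. by have [c [c0 _ cG _]] := SymHS_ltI_adm hS; have [_ hx _ _ _] := inv_opP c0 sG cG; exact: hx. Qed.

Let qsq V (sV : SymHS V) := qform_sqint Hsep Hinf sT bh nuE pG hG M0 bG sV.
Let qmean V (sV : SymHS V) : \int[P]_x qform T V x = - hs V S.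
Proof. by have := qform_mean Hsep Hinf sT bh nuE pG hG M0 bG sV; rewrite IG. Qed.

Definition dlik V (x : H) : R := - (2^-1 * (qform T (B \o V \o B) x + hs (B \o V \o B) S)).

Let sBVB V : SymHS V -> SymHS (B \o V \o B). Proof. exact: SymHS_conj. Qed.

Lemma dlik_sqint V : SymHS V -> sqint P (dlik V).
Proof.
move=> /sBVB sW; apply/sqintN/sqintZ; apply: (sqintD (qsq sW)).
exact: sqint_cst (hs _ _).
Qed.

Lemma dlik_linear (a : R) V W : SymHS V -> SymHS W ->
  {ae P, forall x : borel H, dlik (a \*: V \+ W) x = a * dlik V x + dlik W x}.
Proof.
move=> sV sW; have sV' := sBVB sV; have sW' := sBVB sW.
have E : B \o (a \*: V \+ W) \o B = a \*: (B \o V \o B) \+ (B \o W \o B).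
  by apply/funext => x /=; rewrite (linearD_ lB) (linearZ_ lB).
have := qform_linear Hsep Hinf sT bh nuE pG hG M0 bG a sV' sW'.
apply: (ae_mono P) => x hx; rewrite /dlik E hx.
rewrite (hsDl Hsep Hinf (HSZ Hsep Hinf a sV'.2).1 sW'.2 hS.1.2).
rewrite (hsZl Hsep Hinf a sV'.2 hS.1.2).
move: (qform _ _ _) (qform _ _ _) (hs _ _) (hs _ _) => *; ring.
Qed.

(** Both factors are centered, so only twice the inner product survives, and conjugating B W B by
    [G] gives back [W]. *)
Lemma dlik_product V W : SymHS V -> SymHS W ->
  \int[P]_x (dlik V x * dlik W x) = 2^-1 * hs (B \o V \o B) W.
Proof.
move=> sV sW; have sV' := sBVB sV; have sW' := sBVB sW.
set v := hs (B \o V \o B) S; set w := hs (B \o W \o B) S.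
have q := qform_product Hsep Hinf sT bh nuE pG hG M0 bG sV' sW'.
apply: (eq_trans (mean_affine_product v w (qsq sV') (qsq sW') (qmean sV') (qmean sW') q)).
rewrite IG -/v -/w.
have -> : G \o (B \o W \o B) \o G = W by apply/funext => x /=; rewrite BGK GBK.
by field.
Qed.

Let qcenter V : SymHS V -> l2 P (fun x => qform T V x + hs V S) <= 2 * M * hsn V.
Proof.
move=> sV; have := qform_center_l2 Hsep Hinf sT bh nuE pG hG M0 bG sV.
by rewrite qmean// opprK.
Qed.

Let c : R := xget 0 [set c | 0 < c /\ coercive G c].
Let cP : 0 < c /\ coercive G c.
Proof.
have [m [m0 _ bm _]] := SymHS_ltI_adm hS.
by apply: (@xgetPex _ _ [set c | 0 < c /\ coercive G c]); exists m.
Qed.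

Let c0 : 0 < c. Proof. exact: cP.1. Qed.

Let cG : coercive G c. Proof. exact: cP.2. Qed.

Let bB : bnd B c^-1. Proof. by have [] := inv_opP c0 sG cG. Qed.

Let ci0 : 0 <= c^-1. Proof. by rewrite invr_ge0 ltW. Qed.

Let hsnBVB V : SymHS V -> hsn (B \o V \o B) <= c^-1 ^+ 2 * hsn V.
Proof.
move=> sV; have [h1 n1] := HS_compr Hsep Hinf ci0 sB.1 bB sV.2.
have [_ n2] := HS_compl Hsep Hinf ci0 sB.1 bB h1.
by apply: (le_trans n2); rewrite expr2 -mulrA ler_wpM2l.
Qed.

Lemma dlik_l2 V : SymHS V -> l2 P (dlik V) <= M * c^-1 ^+ 2 * hsn V.
Proof.
move=> sV; have sW := sBVB sV.
have -> : dlik V = fun x => - 2^-1 * (qform T (B \o V \o B) x + hs (B \o V \o B) S).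
  by apply/funext => x; rewrite /dlik mulNr.
have sq : sqint P (fun x => qform T (B \o V \o B) x + hs (B \o V \o B) S).
  by apply: (sqintD (qsq sW)); exact: sqint_cst (hs _ _).
rewrite l2Z// normrN ger0_norm ?invr_ge0//.
have := qcenter sW; have := ler_wpM2l M0 (hsnBVB sV).
move: (l2 _ _) => y; nra.
Qed.

(** The log likelihood is a quadratic form plus a constant off a null set of the reference measure.
    That set is also null for [P], under which the form is square integrable as well. *)
Lemma llik_sqint S' : SymHS_ltI S' -> sqint P (llik S').
Proof.
move=> hS'; have [a ha] := log_quad_density hS'; have [a' ha'] := log_quad_density hS.
have [_ [_ _ _ sW]] := SymHS_ltI_adm hS'.
apply: (@sqint_ae_eq _ (borel H) R P (log_quad S' a)).
- by apply: (sqintD _ (sqint_cst P a)); apply/sqintN/sqintZ; exact: qsq.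
- exact: measurable_log_density ha.
- apply: (dominates_ae (log_density_dominates ha')).
  by apply: (ae_mono (nu idfun)) (log_density_ae ha) => x; rewrite /llik => ->.
Qed.

(** The term B V B cancels against the derivative. What remains is the centered form of [W2], of
    order |V|^2, and a constant [m], which is minus the relative entropy of [P] with respect to the
    measure of S + V. *)
Lemma llik_remainder V : SymHS V -> hsn V <= c / 2 -> SymHS_ltI (S \+ V) ->
  l2 P (fun x => llik (S \+ V) x - llik S x - dlik V x)
  <= (M * ((c / 2)^-1 * c^-1 ^+ 2) + (c / 2)^-1 * c^-1) * hsn V ^+ 2.
Proof.
move=> sV Vc hS'; have sW1 := sBVB sV.
set S' := S \+ V in hS' *; pose G' := idfun \- S'; pose B' := inv_op G'.
have GG' : G' = G \- V by apply/funext => x; rewrite /G' /S' /= opprD addrA.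
have [_ [_ sG' _ sB'I]] := SymHS_ltI_adm hS'; rewrite -/G' -/B' in sG' sB'I.
have [_ [_ _ _ sBI]] := SymHS_ltI_adm hS; rewrite -/G -/B in sBI.
have cG' : coercive G' (c / 2) by rewrite GG'; apply: coercive_perturb => //; exact: sV.2.
have c20 : 0 < c / 2 by rewrite divr_gt0.
have ci2 : 0 <= (c / 2)^-1 by rewrite invr_ge0 ltW.
have pG' : SymPos G' by split => // x; apply: le_trans (cG' x); rewrite mulr_ge0 ?sqr_ge0// ltW.
have [sB' GB' BG' bB' _] := inv_opP c20 sG' cG'; rewrite -/B' in sB' GB' BG' bB'.
have lB' := bounded_op_linear sB'.1.
pose W1 := B \o V \o B; pose W2 := B' \o (V \o W1); pose D := B' \- B.
have DE : D = B' \o (V \o B).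
  apply/funext => x; rewrite /D /= -[B x in LHS]BG' GG' /= GBK (linearB_ lB') opprB addrC subrK//.
have DW : D = W1 \+ W2.
  apply/funext => x; rewrite /W1 /W2 /= -/(D _).
  have -> : B' (V (B (V (B x)))) = D (V (B x)) by rewrite DE.
  by rewrite {2}/D /= addrC subrK DE.
have sD : SymHS D.
  have -> : D = (B' \- idfun) \- (B \- idfun).
    by apply/funext => x; rewrite /D /= opprB addrA subrK.
  exact: SymHS_D sB'I (SymHS_N sBI).
have sW2 : SymHS W2.
  have -> : W2 = D \- W1 by apply/funext => x; rewrite DW /= addrAC subrr add0r.
  exact: SymHS_D sD (SymHS_N sW1).
have nW2 : hsn W2 <= (c / 2)^-1 * c^-1 ^+ 2 * hsn V ^+ 2.
  have [h1 n1] := HS_compl Hsep Hinf (hsn_ge0 V) sV.1.1 (HS_bnd Hsep Hinf sV.2) sW1.2.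
  have [_ n2] := HS_compl Hsep Hinf ci2 sB'.1 bB' h1.
  apply: (le_trans n2); rewrite -mulrA ler_wpM2l//; apply: (le_trans n1).
  by rewrite expr2 [leRHS]mulrA [leRHS]mulrC ler_wpM2l ?hsn_ge0//; exact: hsnBVB.
have nD : hsn D <= (c / 2)^-1 * c^-1 * hsn V.
  have [h1 n1] := HS_compr Hsep Hinf ci0 sB.1 bB sV.2.
  have [_ n2] := HS_compl Hsep Hinf ci2 sB'.1 bB' h1.
  by rewrite DE; apply: (le_trans n2); rewrite -mulrA ler_wpM2l.
have [a ha] := log_quad_density hS; have [a' ha'] := log_quad_density hS'.
pose m := 2^-1 * hs D S + (a' - a).
have I1 (X : H -> H) (k : R) : SymHS X -> \int[P]_x (- 2^-1 * qform T X x + k) = 2^-1 * hs X S + k.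
  move=> sX; have iX := sqint_integrable (qsq sX).
  rewrite RintegralD//; [|exact: RintegrableZ|exact: finite_measure_integrable_cst].
  by rewrite RintegralZl// qmean// Rintegral_cst_prob; ring.
(* Jensen under [P], where [m] is the mean of the log density of the measure of S + V. *)
have m_le0 : m <= 0.
  have hd := log_density_trans (log_density_sym ha) ha'.
  have i1 := sqint_integrable (qsq sB'I); have i2 := sqint_integrable (qsq sBI).
  have E x : - log_quad S a x + log_quad S' a' x =
     (- 2^-1 * qform T (B' \- idfun) x + (a' - a)) - (- 2^-1 * qform T (B \- idfun) x + 0).
    rewrite /log_quad -/G -/G' -/B -/B'.
    by move: (qform _ _ _) (qform _ _ _) => *; ring.
  have hd' := log_density_eq hd E.
  have ic (k : R) : P.-integrable setT (EFin \o cst k) by exact: finite_measure_integrable_cst.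
  have j1 := RintegrableD (RintegrableZ (- 2^-1) i1) (ic (a' - a)).
  have j2 := RintegrableD (RintegrableZ (- 2^-1) i2) (ic 0).
  have := log_density_mean_le0 hd' (RintegrableB j1 j2).
  rewrite (RintegralB measurableT j1 j2) !I1// /m.
  have -> : D = (B' \- idfun) \- (B \- idfun).
    by apply/funext => x; rewrite /D /= opprB addrA subrK.
  rewrite (hsBl Hsep Hinf sB'I.2 sBI.2 hS.1.2).
  by move: (hs _ _) (hs _ _) => y z; lra.
(* Jensen under the measure of S + V. The means now involve S + V in place of [S], which shifts the
   bound by half of <D, V>, a product of two first-order terms. *)
have m_ge : - (2^-1 * hs D V) <= m.
  have IG' : idfun \- G' = S' by apply/funext => x; rewrite /G' /= opprB addrC subrK.
  have hG' : HS (idfun \- G') by rewrite IG'; exact: hS'.1.2.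
  have [M' M'0 bM'] := bounded_op_bnd sG'.1.
  have qsq' X (sX : SymHS X) := qform_sqint Hsep Hinf sT bh nuE pG' hG' M'0 bM' sX.
  have qmean' X : SymHS X -> \int[nu G']_x qform T X x = - hs X S'.
    by move=> sX; rewrite (qform_mean Hsep Hinf sT bh nuE pG' hG' M'0 bM' sX) IG'.
  have I1' (X : H -> H) (k : R) : SymHS X -> \int[nu G']_x (- 2^-1 * qform T X x + k) = 2^-1 * hs X S' + k.
    move=> sX; have iX := sqint_integrable (qsq' _ sX).
    rewrite RintegralD//; [|exact: RintegrableZ|exact: finite_measure_integrable_cst].
    by rewrite RintegralZl// qmean'// Rintegral_cst_prob; ring.
  have hd := log_density_trans (log_density_sym ha') ha.
  have i1 := sqint_integrable (qsq' _ sB'I); have i2 := sqint_integrable (qsq' _ sBI).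
  have E x : - log_quad S' a' x + log_quad S a x =
     (- 2^-1 * qform T (B \- idfun) x + (a - a')) - (- 2^-1 * qform T (B' \- idfun) x + 0).
    rewrite /log_quad -/G -/G' -/B -/B'.
    by move: (qform _ _ _) (qform _ _ _) => *; ring.
  have hd' := log_density_eq hd E.
  have ic (k : R) : (nu G').-integrable setT (EFin \o cst k) by exact: finite_measure_integrable_cst.
  have j1 := RintegrableD (RintegrableZ (- 2^-1) i2) (ic (a - a')).
  have j2 := RintegrableD (RintegrableZ (- 2^-1) i1) (ic 0).
  have := log_density_mean_le0 hd' (RintegrableB j1 j2).
  rewrite (RintegralB measurableT j1 j2) !I1'// /m.
  have DE' : D = (B' \- idfun) \- (B \- idfun).
    by apply/funext => x; rewrite /D /= opprB addrA subrK.
  have : hs D S' = hs D S + hs D V by exact: hsDr hS.1.2 sV.2 sD.2.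
  have -> : hs D S' = hs (B' \- idfun) S' - hs (B \- idfun) S'.
    by rewrite DE' (hsBl Hsep Hinf sB'I.2 sBI.2 hS'.1.2).
  by move: (hs _ _) (hs _ _) (hs _ _) (hs _ _) => y z t u; lra.
have absm : `|m| <= 2^-1 * (hsn D * hsn V).
  have := hs_CauchySchwarz Hsep Hinf sD.2 sV.2; rewrite ler_norml => /andP[_ h1].
  rewrite ler_norml; apply/andP; split; last first.
    by apply: (le_trans m_le0); rewrite mulr_ge0// mulr_ge0// hsn_ge0.
  by apply: le_trans m_ge; rewrite lerN2 ler_wpM2l.
have aeE : {ae P, forall x : borel H, llik S' x - llik S x - dlik V x =
    - 2^-1 * (qform T W2 x + hs W2 S) + m}.
  have e1 := dominates_ae (log_density_dominates ha) (log_density_ae ha).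
  have e2 := dominates_ae (log_density_dominates ha) (log_density_ae ha').
  have e3 := qform_linear Hsep Hinf sT bh nuE pG hG M0 bG 1 sW1 sW2.
  have e4 := qform_linear Hsep Hinf sT bh nuE pG hG M0 bG 1 sD sBI.
  apply: (ae_mono2 P) (e1) _ => [x y z|]; last first.
    apply: (ae_mono2 P) (e2) _ => [x y z|]; last first.
      by apply: (ae_mono2 P) e3 e4 => x y z; exact: (conj y z).
    exact: (conj y z).
  move: z => [z [t u]].
  have D1 : 1 \*: W1 \+ W2 = D by apply/funext => v; rewrite DW /= scale1r.
  have D2 : 1 \*: D \+ (B \- idfun) = B' \- idfun.
    by apply/funext => v; rewrite /D /= scale1r addrA subrK.
  rewrite D1 in t; rewrite D2 t in u.
  rewrite /llik y z /dlik /log_quad -/G -/G' -/B -/B' u -/W1 /m DW.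
  rewrite (hsDl Hsep Hinf sW1.2 sW2.2 hS.1.2).
  by move: (qform _ _ _) (qform _ _ _) (qform _ _ _) (hs _ _) (hs _ _) => *; field.
have sqE : sqint P (fun x => - 2^-1 * (qform T W2 x + hs W2 S)).
  by apply: sqintZ; apply: (sqintD (qsq sW2)); exact: sqint_cst (hs _ _).
have sqE' : sqint P (fun x => qform T W2 x + hs W2 S).
  by apply: (sqintD (qsq sW2)); exact: sqint_cst (hs _ _).
rewrite (l2_ae_eq _ _ aeE); last 2 first.
- by apply: (sqintB (sqintB (llik_sqint hS') (llik_sqint hS)) (dlik_sqint sV)).1.
- exact: (sqintD sqE (sqint_cst P m)).1.
apply: (le_trans (l2D sqE (sqint_cst P m))).
rewrite (l2Z _ sqE') l2_cst normrN (ger0_norm (_ : 0 <= 2^-1)) ?invr_ge0//.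
have h1 := qcenter sW2; have h2 := ler_wpM2l M0 nW2.
have h3 := ler_wpM2r (hsn_ge0 V) nD.
have h4 : 0 <= (c / 2)^-1 * c^-1 * hsn V ^+ 2.
  by apply: mulr_ge0 (sqr_ge0 _); exact: mulr_ge0.
rewrite expr2 in h4 *.
move: (l2 _ _) (hsn D * hsn V) (hsn W2) (hsn V) (c^-1) ((c / 2)^-1) h1 h2 h3 h4 absm => y z t v p q.
rewrite expr2; nra.
Qed.

Lemma dlik_frechet : is_frechet_derivative P llik S dlik.
Proof.
split.
- by move=> S' hS'; apply/Lfun_sqint; exact: llik_sqint.
- by move=> V sV; apply/Lfun_sqint; exact: dlik_sqint.
- by move=> a V W sV sW; exact: dlik_linear.
- exists (M * c^-1 ^+ 2) => V sV.
  by rewrite /L2norm (L2norm_l2 (dlik_sqint sV)) (hs_normE Hsep Hinf sV.2) dlik_l2.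
move=> eps eps0; pose K := M * ((c / 2)^-1 * c^-1 ^+ 2) + (c / 2)^-1 * c^-1.
have c20 : 0 < c / 2 by rewrite divr_gt0.
have ci2 : 0 <= (c / 2)^-1 by rewrite invr_ge0 ltW.
have K0 : 0 <= K by rewrite addr_ge0 ?mulr_ge0 ?sqr_ge0.
have K1 : 0 < K + 1 by rewrite ltr_wpDl.
exists (Num.min (c / 2) (eps / (K + 1))); first by rewrite lt_min c20 divr_gt0.
move=> V sV hS'; rewrite (hs_normE Hsep Hinf sV.2) lt_min => /andP[/ltW V1 /ltW V2].
have sq := sqintB (sqintB (llik_sqint hS') (llik_sqint hS)) (dlik_sqint sV).
rewrite /L2norm (L2norm_l2 sq); apply: (le_trans (llik_remainder sV V1 hS')).
rewrite -/K expr2 mulrA ler_wpM2r ?hsn_ge0//.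
apply: (@le_trans _ _ (K * (eps / (K + 1)))); first by rewrite ler_wpM2l.
by rewrite mulrCA ler_piMr ?ltW// ltr_pdivrMr// mul1r ltrDl.
Qed.

(** Stated for any [D] that agrees with [dlik] almost everywhere, so as to apply to the derivative
    selected by [score]. *)
Lemma fisher_rao_score (D : (H -> H) -> H -> R) V1 V2 :
  (forall V, SymHS V -> {ae P, forall x : borel H, D V x = dlik V x}) ->
  (forall V, SymHS V -> sqint P (D V)) -> SymHS V1 -> SymHS V2 ->
  \int[P]_x (D V1 x * D V2 x) = 2^-1 * trace (B \o V1 \o B \o V2).
Proof.
move=> DE sD s1 s2.
rewrite (@ae_eq_Rintegral _ (borel H) R P _ (fun x => dlik V1 x * dlik V2 x)).
- by rewrite dlik_product// (trace_hs Hsep Hinf (sBVB s1).1 (sBVB s1).2 s2.2).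
- exact: measurable_funM (sD _ s1).1 (sD _ s2).1.
- exact: measurable_funM (dlik_sqint s1).1 (dlik_sqint s2).1.
by apply: (ae_mono2 P) (DE _ s1) (DE _ s2) => x -> ->.
Qed.

End at_point.
End fisher_rao.

(** * Change of reference covariance *)

Section dense_range.
Context {R : realType} {H : hilbertType R}.
Variables (U : H -> H) (h : nat -> H).
Hypotheses (lU : linear U) (bh : orthonormal_basis (U \o h)).

Let y n x := \sum_(0 <= i < n) '<<x, U (h i)>> *: h i.

Let Uy x : (fun n => U (y n x)) @ \oo --> x.
Proof.
have hb := bh.2 x.
suff e : (fun n => U (y n x)) = series (fun i => '<<x, (U \o h) i>> *: (U \o h) i) by rewrite e.
apply/funext => n.
by rewrite /y (linear_sum_ _ _ _ lU); apply: eq_bigr => i _; rewrite (linearZ_ lU).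
Qed.

Lemma bounded_op_eq_range X Y : bounded_op X -> bounded_op Y ->
  (forall z, X (U z) = Y (U z)) -> X = Y.
Proof.
move=> bX bY XY; apply/funext => x.
have h1 := bounded_op_cvg bX (@Uy x); have h2 := bounded_op_cvg bY (@Uy x).
have e : X \o (fun n => U (y n x)) = Y \o (fun n => U (y n x)) by apply/funext => n /=.
rewrite e in h1; exact: (cvg_unique _ h1 h2).
Qed.

Lemma sandwich_cancel X Y : (forall z, U z = 0 -> z = 0) -> bounded_op X -> bounded_op Y ->
  U \o X \o U = U \o Y \o U -> X = Y.
Proof.
move=> U0 bX bY XY; apply: bounded_op_eq_range => // z.
apply/eqP; rewrite -subr_eq0; apply/eqP/U0; rewrite (linearB_ lU).
by have := congr1 (fun f => f z) XY; rewrite /= => ->; rewrite subrr.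
Qed.

(** Douglas' factorization T = K U. Since U (y n x) tends to x, the inequality makes T (y n x)
    Cauchy, and its limit defines K x. *)
Lemma factor_through_range (T : H -> H) (m : R) : linear T -> 0 <= m ->
  (forall z, `|T z| <= m * `|U z|) ->
  exists K, bounded_op K /\ forall z, K (U z) = T z.
Proof.
move=> lT m0 hm.
have yD a x x' n : y n (a *: x + x') = a *: y n x + y n x'.
  rewrite /y scaler_sumr -big_split /=; apply: eq_bigr => i _.
  by rewrite hdotDl hdotZl scalerDl scalerA.
have cT x : cvgn (fun n => T (y n x)).
  apply/cauchy_cvgP/cauchy_ballP => eps eps0.
  have cU : cauchy ((fun n => U (y n x)) @ \oo).
    by apply/cauchy_cvgP; apply/cvg_ex; exists x; exact: Uy.
  have m1 : 0 < m + 1 by rewrite ltr_wpDl.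
  move/cauchy_ballP : cU => /(_ (eps / (m + 1))) /(_ (divr_gt0 eps0 m1)).
  rewrite !near_simpl /=; apply: filterS => -[p q] /=.
  rewrite -!ball_normE /= -(linearB_ lT) -(linearB_ lU) ltr_pdivlMr// => hpq.
  apply: le_lt_trans (hm _) _; apply: le_lt_trans hpq.
  by rewrite mulrC ler_wpM2l// lerDl.
pose K x := limn (fun n => T (y n x)).
have KP x : (fun n => T (y n x)) @ \oo --> K x by exact: cT.
exists K; split; last first.
  move=> z; apply: (cvg_unique _ (KP (U z))) => //=.
  apply/cvgrPdist_lt => e e0.
  have m1 : 0 < m + 1 by rewrite ltr_wpDl.
  have /cvgrPdist_lt/(_ (e / (m + 1)) (divr_gt0 e0 m1)) := @Uy (U z).
  apply: filterS => n; rewrite -(linearB_ lT) -(linearB_ lU) ltr_pdivlMr// => hn.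
  apply: le_lt_trans (hm _) _; apply: le_lt_trans hn.
  by rewrite mulrC ler_wpM2l// lerDl.
apply/bounded_opP; split.
  move=> a x x'; apply: (cvg_unique _ (KP (a *: x + x'))) => //=.
  under eq_fun do rewrite yD (linearD_ lT) (linearZ_ lT).
  by apply: cvgD; [apply: cvgZr; exact: KP|exact: KP].
exists m => // x.
have h1 : (fun n => `|T (y n x)|) @ \oo --> `|K x| by apply: cvg_norm; exact: KP.
have h2 : (fun n => m * `|U (y n x)|) @ \oo --> m * `|x|.
  by apply: cvgMr; apply: cvg_norm; exact: Uy.
rewrite -(cvg_lim _ h1)// -(cvg_lim _ h2)//.
apply: ler_lim; [by apply/cvg_ex; eexists; exact: h1|by apply/cvg_ex; eexists; exact: h2|].
by apply: nearW => n; exact: hm.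
Qed.

End dense_range.

(** * Covariance operators of the form T G T *)

Section covariance.
Context {R : realType} {H : hilbertType R}.
Hypotheses (Hsep : separable H) (Hinf : infinite_dimensional H).
Variable C0 : H -> H.
Hypotheses (C0pos : SymPos C0) (C0ker : forall x : H, C0 x = 0 -> x = 0).

Local Notation T := (sqrt_op C0).
Let pT : SymPos T := (sqrt_opP C0pos).1.
Let sT : Sym T := pT.1.
Let lT : linear T. Proof. exact: bounded_op_linear sT.1. Qed.

Lemma sqrt_opK x : sqrt_op C0 (sqrt_op C0 x) = C0 x.
Proof. by have /(congr1 (fun f => f x)) := (sqrt_opP C0pos).2. Qed.

Lemma sqrt_op_ker x : sqrt_op C0 x = 0 -> x = 0.
Proof. by move=> Tx; apply: C0ker; rewrite -sqrt_opK Tx (linear0_ lT). Qed.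

Lemma sqr_sqrt_op x : `|sqrt_op C0 x| ^+ 2 = '<<C0 x, x>>.
Proof. by rewrite sqr_normE sT.2 sqrt_opK hdotC. Qed.

Lemma sqrt_op_basis : exists h, orthonormal_basis (sqrt_op C0 \o h).
Proof. exact: (basis_in_range Hsep Hinf sT.1 sT.2 sqrt_op_ker). Qed.

Lemma sandwich_idfun : sandwich C0 idfun = C0.
Proof. by apply/funext => x; exact: sqrt_opK. Qed.

Lemma sandwich_dot G x y : '<<sandwich C0 G x, y>> = '<<G (sqrt_op C0 x), sqrt_op C0 y>>.
Proof. by rewrite /sandwich /= sT.2. Qed.

Lemma sandwich_SymPos G : SymPos G -> SymPos (sandwich C0 G).
Proof. exact: SymPos_conj. Qed.

(** Makes the choices in [chart], [dchart] and [sandwich_inv] unambiguous. *)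
Lemma sandwich_inj X Y : bounded_op X -> bounded_op Y ->
  sandwich C0 X = sandwich C0 Y -> X = Y.
Proof.
have [h bh] := sqrt_op_basis => bX bY.
exact: (sandwich_cancel lT bh sqrt_op_ker bX bY).
Qed.

(** Gives access to [N], which is specified on trace class covariances. Each diagonal term <<G T
    e_n, T e_n>> is at most M |T e_n|^2 = M <<C0 e_n, e_n>>. *)
Lemma sandwich_Tr G : Tr C0 -> SymPos G -> Tr (sandwich C0 G).
Proof.
move=> [_ trC] pG; have pS := sandwich_SymPos pG; split; first exact: pS.1.1.
rewrite (abs_op_pos C0pos) in trC; rewrite (abs_op_pos pS).
have [M M0 bM] := bounded_op_bnd pG.1.1.
apply: (@le_lt_trans _ _ (M%:E * \sum_(0 <= n <oo) ('<<C0 (Defs.basis H n), Defs.basis H n>>)%:E)%E).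
  rewrite -nneseriesZl//; last by move=> n _; rewrite lee_fin; exact: C0pos.2.
  apply: lee_nneseries => [n _ _|n _]; first by rewrite lee_fin; exact: pS.2.
  rewrite -EFinM lee_fin sandwich_dot -sqr_sqrt_op.
  have := CauchySchwarz (G (T (Defs.basis H n))) (T (Defs.basis H n)).
  move=> /(le_trans (ler_norm _)) /le_trans; apply.
  by rewrite expr2 mulrA ler_wpM2r.
by rewrite lte_mul_pinfty.
Qed.

Lemma covariance_gaussian (N : (H -> H) -> probability (borel H) R)
    (NE : forall C : H -> H, SymPos C -> Tr C -> is_gaussian (N C) C) : Tr C0 ->
  forall G, SymPos G -> forall (k : H) (A : set R), measurable A ->
    N (sandwich C0 G) [set x : H | A '<<x, k>>] =
    centered_normal '<<G (sqrt_op C0 k), sqrt_op C0 k>> A.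
Proof.
move=> trC G pG k A mA; rewrite -sandwich_dot; apply: NE => //.
- exact: sandwich_SymPos.
- exact: sandwich_Tr.
Qed.

End covariance.

Section change_of_reference.
Context {R : realType} {H : hilbertType R}.
Hypotheses (Hsep : separable H) (Hinf : infinite_dimensional H).
Variable C0 : H -> H.
Hypotheses (C0pos : SymPos C0) (C0ker : forall x : H, C0 x = 0 -> x = 0).
Variables (S : H -> H) (hS : SymHS_ltI S).
Local Notation T := (sqrt_op C0).
Local Notation G := (idfun \- S).
Local Notation Sigma := (cov C0 S).
Local Notation U := (sqrt_op Sigma).

Lemma cov_SymPos : SymPos Sigma.
Proof.
have [c [c0 sG cG _]] := SymHS_ltI_adm Hsep Hinf hS.
apply: sandwich_SymPos => //; split => // x.
by apply: le_trans (cG x); rewrite mulr_ge0 ?sqr_ge0// ltW.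
Qed.

Lemma cov_ker x : Sigma x = 0 -> x = 0.
Proof.
have [c [c0 sG cG _]] := SymHS_ltI_adm Hsep Hinf hS.
move=> Sx; apply: (sqrt_op_ker C0pos C0ker).
have := cG (T x); rewrite -(sandwich_dot C0pos) -[sandwich _ _ _]/(Sigma x) Sx hdot0l.
rewrite pmulr_rle0// => h; apply/eqP; rewrite -normr_le0.
by rewrite -(@ler_sqr R) ?nnegrE// expr0n.
Qed.

(* K intertwines the two square roots: K Sigma^(1/2) = C0^(1/2). It is
   invertible, K^* (I - S) K = I and K K^* = (I - S)^-1. *)
Lemma intertwining : exists K K' Ks Ks' : H -> H,
  [/\ [/\ bounded_op K, bounded_op K', bounded_op Ks & bounded_op Ks'],
      (forall x y, '<<K x, y>> = '<<x, Ks y>>) /\ (forall x y, '<<K' x, y>> = '<<x, Ks' y>>),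
      [/\ U \o Ks = T, K \o U = T, T \o Ks' = U & K' \o T = U] &
      forall x, inv_op G x = K (Ks x)].
Proof.
have [c [c0 sG cG _]] := SymHS_ltI_adm Hsep Hinf hS.
have pS := cov_SymPos; have [M M0 bM] := bounded_op_bnd sG.1.
have sT := (sqrt_opP C0pos).1.1; have sU := (sqrt_opP pS).1.1.
have lT := bounded_op_linear sT.1; have lU := bounded_op_linear sU.1.
have U0 x : U x = 0 -> x = 0 by exact: (sqrt_op_ker pS cov_ker).
have T0 x : T x = 0 -> x = 0 by exact: (sqrt_op_ker C0pos C0ker).
have [h bh] := sqrt_op_basis Hsep Hinf C0pos C0ker.
have [h' bh'] := sqrt_op_basis Hsep Hinf pS cov_ker.
have nU z : `|U z| ^+ 2 = '<<G (T z), T z>>.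
  by rewrite (sqr_sqrt_op pS) -(sandwich_dot C0pos).
(* Coercivity of I - S compares the two square roots in one direction and its boundedness in the
   other; each comparison yields a factorization. *)
have nTU z : `|T z| <= Num.sqrt c^-1 * `|U z|.
  rewrite -ler_sqr ?nnegrE ?mulr_ge0 ?sqrtr_ge0// exprMn sqr_sqrtr ?invr_ge0 ?(ltW c0)//.
  by rewrite nU mulrC ler_pdivlMr// mulrC.
have nUT z : `|U z| <= Num.sqrt M * `|T z|.
  rewrite -ler_sqr ?nnegrE ?mulr_ge0 ?sqrtr_ge0// exprMn sqr_sqrtr// nU.
  apply: (le_trans (ler_norm _)); apply: (le_trans (CauchySchwarz _ _)).
  by rewrite expr2 mulrA ler_wpM2r.
have [K [bK KU]] := factor_through_range lU bh' lT (sqrtr_ge0 _) nTU.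
have [K' [bK' K'T]] := factor_through_range lT bh lU (sqrtr_ge0 _) nUT.
have [bKs KKs] := adjointP bh bK; have [bKs' KKs'] := adjointP bh bK'.
set Ks := adjoint K in bKs KKs; set Ks' := adjoint K' in bKs' KKs'.
have UKs : U \o Ks = T.
  by apply/funext => x; apply: hdot_inj => z; rewrite /= sU.2 hdotC -KKs KU hdotC -sT.2.
have TKs : T \o Ks' = U.
  by apply/funext => x; apply: hdot_inj => z; rewrite /= sT.2 hdotC -KKs' K'T hdotC -sU.2.
have KK' : K \o K' = idfun.
  apply: (bounded_op_eq_range lT bh); [exact: bounded_op_comp|exact: bounded_op_id|].
  by move=> z /=; rewrite K'T KU.
(* Conjugation by [U] turns the left-hand side into T (I - S) T = Sigma = U^2, and [U] can then be
   cancelled on both sides. *)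
have KGK : Ks \o G \o K = idfun.
  apply: (sandwich_cancel lU bh' U0).
  - by apply: bounded_op_comp => //; apply: bounded_op_comp => //; exact: sG.1.
  - exact: bounded_op_id.
  apply/funext => x /=; rewrite KU.
  have := congr1 (fun f => f (G (T x))) UKs; rewrite /= => ->.
  have := sqrt_opK pS x; rewrite /= => ->.
  by [].
exists K, K', Ks, Ks'; split => //.
- by split => //; apply/funext => z /=.
move=> x; have [_ GB BG _ _] := inv_opP c0 sG cG.
have GKK y : K (Ks (G y)) = y.
  have e := congr1 (fun f => f (K' y)) KGK; rewrite /= in e.
  have e' z : K (K' z) = z by have := congr1 (fun f => f z) KK'.
  by rewrite e' in e; rewrite e e'.
by rewrite -[in RHS](GB x) GKK.
Qed.

End change_of_reference.

(** * The score and the Fisher-Rao metric of the given Gaussian family *)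

Section score.
Context {R : realType} {H : hilbertType R}.
Hypotheses (Hsep : separable H) (Hinf : infinite_dimensional H).
Variable N : (H -> H) -> probability (borel H) R.
Hypothesis NE : forall C : H -> H, SymPos C -> Tr C -> is_gaussian (N C) C.
Variable C0 : H -> H.
Hypotheses (C0pos : SymPos C0) (C0tr : Tr C0) (C0ker : forall x : H, C0 x = 0 -> x = 0).
Local Notation T := (sqrt_op C0).

Let nu G := N (sandwich C0 G).
Let sT : Sym T := (sqrt_opP C0pos).1.1.
Let nuE : forall G, SymPos G -> forall (k : H) (A : set R), measurable A ->
  nu G [set x : H | A '<<x, k>>] = centered_normal '<<G (T k), T k>> A
  := covariance_gaussian C0pos NE C0tr.

Let log_likelihoodE : log_likelihood N C0 = llik nu.
Proof. by apply/funext => S; rewrite /log_likelihood /llik /nu sandwich_idfun. Qed.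

Lemma cov_dominates S : SymHS_ltI S -> N (cov C0 S) `<< N C0 /\ N C0 `<< N (cov C0 S).
Proof.
move=> hS; have [h bh] := sqrt_op_basis Hsep Hinf C0pos C0ker.
have [a ha] := log_quad_density Hsep Hinf sT bh nuE hS.
have E : N C0 = nu idfun by rewrite /nu sandwich_idfun.
rewrite E; split; first exact: log_density_dominates ha.
exact: log_density_dominates (log_density_sym ha).
Qed.

Lemma score_exists S : SymHS_ltI S ->
  exists D, is_frechet_derivative (N (cov C0 S)) (log_likelihood N C0) S D.
Proof.
move=> hS; have [h bh] := sqrt_op_basis Hsep Hinf C0pos C0ker.
rewrite log_likelihoodE; exists (dlik T S).
exact: (dlik_frechet Hsep Hinf sT bh nuE hS).
Qed.

Lemma fisher_raoE S V1 V2 : SymHS_ltI S -> SymHS V1 -> SymHS V2 ->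
  fisher_rao N C0 S V1 V2 =
  2^-1 * trace (inv_op (idfun \- S) \o V1 \o inv_op (idfun \- S) \o V2).
Proof.
move=> hS s1 s2; have [h bh] := sqrt_op_basis Hsep Hinf C0pos C0ker.
have hd := dlik_frechet Hsep Hinf sT bh nuE hS.
have hsc : is_frechet_derivative (N (cov C0 S)) (llik nu) S (score N C0 S).
  rewrite -log_likelihoodE; apply: (@xgetPex _ _
    (is_frechet_derivative (N (cov C0 S)) (log_likelihood N C0) S)).
  exact: score_exists.
apply: (fisher_rao_score Hsep Hinf sT bh nuE hS _ _ s1 s2).
- by move=> V sV; exact: (frechet_derivative_unique Hsep Hinf hS hsc hd sV).
- by move=> V sV; have [_ h2 _ _ _] := hsc; apply/Lfun_sqint; exact: h2.
Qed.

End score.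

Theorem theorem4 (R : realType) (H : hilbertType R)
    (Hsep : separable H) (Hinf : infinite_dimensional H)
    (N : (H -> H) -> probability (borel H) R)
    (NE : forall C : H -> H, SymPos C -> Tr C -> is_gaussian (N C) C)
    (C0 : H -> H) (C0pos : SymPos C0) (C0tr : Tr C0)
    (C0ker : forall x : H, C0 x = 0 -> x = 0) :
  (forall S : H -> H, SymHS_ltI S ->
     [/\ N (cov C0 S) `<< N C0,
         N C0 `<< N (cov C0 S),
         exists D, is_frechet_derivative (N (cov C0 S))
                     (log_likelihood N C0) S D
       & forall V1 V2 : H -> H, SymHS V1 -> SymHS V2 ->
           fisher_rao N C0 S V1 V2 =
           2^-1 * trace (inv_op (idfun \- S) \o V1 \o
                         inv_op (idfun \- S) \o V2)]) /\
  (forall Sigma : H -> H, TrC C0 Sigma ->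
     SymHS_of C0 = SymHS_of Sigma /\
     forall A1 A2 : H -> H, SymHS_of C0 A1 -> SymHS_of C0 A2 ->
       cov_metric N C0 Sigma A1 A2 =
         2^-1 * hs_dot (sandwich_inv Sigma A1) (sandwich_inv Sigma A2) /\
       2^-1 * hs_dot (sandwich_inv Sigma A1) (sandwich_inv Sigma A2) =
         2^-1 * trace (sandwich_inv Sigma A1 \o sandwich_inv Sigma A2)).
Proof.
split=> [S hS|_ [S hS <-]].
  have [d1 d2] := cov_dominates Hsep Hinf NE C0pos C0tr C0ker hS; split => //.
    exact: score_exists.
  by move=> V1 V2 s1 s2; exact: fisher_raoE.
have [K [K' [Ks [Ks' [[bK bK' bKs bKs'] [KKs KKs'] [UKs KU TKs K'T] BE]]]]] :=
  intertwining Hsep Hinf C0pos C0ker hS.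
have pS := cov_SymPos Hsep Hinf C0pos hS.
have kS := @cov_ker _ _ Hsep Hinf _ C0pos C0ker _ hS.
have sT := (sqrt_opP C0pos).1.1.
have KsK x y : '<<Ks x, y>> = '<<x, K y>> by rewrite hdotC -KKs hdotC.
have hs_cong (L Ls X : H -> H) : bounded_op L -> bounded_op Ls ->
    (forall x y, '<<L x, y>> = '<<x, Ls y>>) -> SymHS X -> SymHS (Ls \o X \o L).
  move=> bL bLs LLs [sX hX].
  have [M M0 bM] := bounded_op_bnd bL; have [M' M'0 bM'] := bounded_op_bnd bLs.
  have [h1 _] := HS_compr Hsep Hinf M0 bL bM hX.
  have [h2 _] := HS_compl Hsep Hinf M'0 bLs bM' h1.
  split => //; split; first exact: HS_bounded h2.
  by move=> x y; rewrite /= hdotC -LLs -sX.2 hdotC LLs hdotC.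
(* Congruence by [K] carries coordinates relative to C0 to coordinates relative to Sigma; congruence
   by [K'] goes back, which gives the equality of the tangent spaces. *)
have Y_of X : sandwich C0 X = sandwich (cov C0 S) (Ks \o X \o K).
  apply/funext => x; rewrite /sandwich /=.
  have e1 z : sqrt_op (cov C0 S) (Ks z) = sqrt_op C0 z := congr1 (fun f => f z) UKs.
  have e2 z : K (sqrt_op (cov C0 S) z) = sqrt_op C0 z := congr1 (fun f => f z) KU.
  by rewrite e1 e2.
split.
  apply/seteqP; split=> [_ [X sX <-]|_ [Y sY <-]].
    by exists (Ks \o X \o K); [exact: hs_cong|rewrite -Y_of].
  exists (Ks' \o Y \o K'); first exact: hs_cong.
  apply/funext => x; rewrite /sandwich /=.
  have e1 z : sqrt_op C0 (Ks' z) = sqrt_op (cov C0 S) z := congr1 (fun f => f z) TKs.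
  have e2 z : K' (sqrt_op C0 z) = sqrt_op (cov C0 S) z := congr1 (fun f => f z) K'T.
  by rewrite e1 e2.
move=> _ _ [X1 s1 <-] [X2 s2 <-].
have bS (X : H -> H) : SymHS X -> bounded_op X by move=> sX; exact: sX.1.1.
have chartE : chart C0 (cov C0 S) = S.
  have [] : [set S' | SymHS_ltI S' /\ cov C0 S' = cov C0 S] (chart C0 (cov C0 S)).
    by apply: xgetPex; exists S.
  move=> hS' /(sandwich_inj Hsep Hinf C0pos C0ker) e.
  have bI (S' : H -> H) : SymHS_ltI S' -> bounded_op (idfun \- S').
    by move=> hs; exact: hs.2.1.1.
  have {}e := e (bI _ hS') (bI _ hS).
  apply/funext => x; have := congr1 (fun f => f x) e => /= /addrI.
  exact: oppr_inj.
have dchartE X : SymHS X -> dchart C0 (sandwich C0 X) = \- X.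
  move=> sX.
  have sand V : \- sandwich C0 V = sandwich C0 (\- V).
    by apply/funext => x; rewrite /sandwich /= (linearN_ (bounded_op_linear sT.1)).
  have [] : [set V | SymHS V /\ sandwich C0 X = \- sandwich C0 V] (dchart C0 (sandwich C0 X)).
    apply: xgetPex; exists (\- X); split; first exact: SymHS_N.
    by rewrite sand; congr sandwich; apply/funext => x /=; rewrite opprK.
  move=> sV; rewrite sand => e.
  have {}e := sandwich_inj Hsep Hinf C0pos C0ker (bS _ sX) (bS _ (SymHS_N Hsep Hinf sV)) e.
  by rewrite [in RHS]e; apply/funext => x /=; rewrite opprK.
have invE X : SymHS X -> sandwich_inv (cov C0 S) (sandwich C0 X) = Ks \o X \o K.
  move=> sX; have sY := hs_cong _ _ _ bK bKs KKs sX.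
  have [] : [set Y | SymHS Y /\ sandwich (cov C0 S) Y = sandwich C0 X]
      (sandwich_inv (cov C0 S) (sandwich C0 X)).
    by apply: xgetPex; exists (Ks \o X \o K); split => //; rewrite -Y_of.
  move=> sZ e0; have e := etrans e0 (Y_of X).
  exact: (sandwich_inj Hsep Hinf pS kS (bS _ sZ) (bS _ sY) e).
have sY1 := hs_cong _ _ _ bK bKs KKs s1; have sY2 := hs_cong _ _ _ bK bKs KKs s2.
rewrite /cov_metric chartE !dchartE// !invE//.
rewrite (hs_dotE Hsep Hinf sY1.2 sY2.2) (trace_hs Hsep Hinf sY1.1 sY1.2 sY2.2).
split => //; rewrite (fisher_raoE Hsep Hinf NE C0pos C0tr C0ker hS (SymHS_N Hsep Hinf s1) (SymHS_N Hsep Hinf s2)).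
set B := inv_op (idfun \- S) in BE *.
have sB : Sym B by have [c [c0 sG cG _]] := SymHS_ltI_adm Hsep Hinf hS; have [] := inv_opP c0 sG cG.
have lB := bounded_op_linear sB.1.
have sW := SymHS_conj Hsep Hinf sB s1.
(* The two signs from the differential of the chart cancel. *)
have -> : B \o (\- X1) \o B \o (\- X2) = (B \o X1 \o B) \o X2.
  by apply/funext => x /=; rewrite !(linearN_ lB) (linearN_ (bounded_op_linear s1.1.1)) (linearN_ lB) opprK.
rewrite (trace_hs Hsep Hinf sW.1 sW.2 s2.2); congr (_ * _).
have [MK MK0 bMK] := bounded_op_bnd bK.
have [MB MB0 bMB] := bounded_op_bnd sB.1.
have [x1K _] := HS_compr Hsep Hinf MK0 bK bMK s1.2.
have BKK : B = K \o Ks by apply/funext => x; exact: BE.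
have [x1B _] := HS_compr Hsep Hinf MB0 sB.1 bMB s1.2.
(* All outer factors are moved to the second argument by adjunction; since B = K Ks, both sides
   become <X1, B X2 B>. *)
rewrite (hs_movel Hsep Hinf sB.1 sB.1 sB.2 x1B s2.2).
rewrite (hs_movel Hsep Hinf bKs bK KsK x1K sY2.2).
have -> : K \o (Ks \o X2 \o K) = B \o X2 \o K by rewrite BKK.
have [BX2 _] := HS_compl Hsep Hinf MB0 sB.1 bMB s2.2.
have [BX2K _] := HS_compr Hsep Hinf MK0 bK bMK BX2.
rewrite (hs_mover Hsep Hinf bK bKs KKs s1.2 BX2K).
have -> : B \o X2 \o K \o Ks = (B \o X2) \o B.
  by apply/funext => x /=; rewrite -BE.
by rewrite (hs_mover Hsep Hinf sB.1 sB.1 sB.2 s1.2 BX2).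
Qed.
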